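(* Let $A$ be the infinitesimal generator of a $C_0$ group $\{U^t\}_{t\in\mathbb R}$ on $X$ of positive linear operators that are isometries on $X_+$. Suppose that $U^t\mathcal D(\Lambda)=\mathcal D(\Lambda)$ and $U^t\mathcal D(\Lambda_1)=\mathcal D(\Lambda_1)$, and that for each $t>0$, $U^t\Lambda=\Lambda U^t$ on $\mathcal D(\Lambda)$ and $U^t\Lambda_1=\Lambda_1U^t$ on $\mathcal D(\Lambda_1)$. Let $f_0\in\mathcal D_+(\Lambda^2)$. Suppose that $Q^+(t,\mathcal D_+(\Lambda^\infty))\subset\mathcal D_+(\Lambda^\infty)$ for a.a. $t\in\mathbb R_+$, and that the map $t\mapsto\Lambda^kQ^+(t,U^tg)$ belongs to $L^1_{loc}(\mathbb R_+;X_+)$ for all $g\in\mathcal D_+(\Lambda^\infty)$ and $k=1,2,\dots$. Then the Cauchy problem $$\frac{d}{dt}f(t)=Af+Q^{+}(t,f(t))-Q^{-}(t,f(t)),\quad f(0)=f_0,\quad t\ge0,$$ has a unique positive global mild solution $f$ on $\mathbb R_+$ such that $f(t)\in\mathcal D_+(\Lambda^2)$ for all $t\ge0$ and $\|\Lambda^2f(\cdot)\|$ is locally bounded on $\mathbb R_+$. Moreover, $\Lambda f\in C(\mathbb R_+;X_+)$. Furthermore, $f$ satisfies $$\|\Lambda f(t)\|+\int_0^t\Delta(s,f(s))\,ds=\|\Lambda f_0\|,\quad\forall t\ge0,$$ and $$\|\Lambda^2f(t)\|\le\|\Lambda^2f_0\|\exp\big(\rho(\|\Lambda_1f_0\|)\,t\big),\quad\forall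 t\ge0.$$
   Context: **Space.** $X$ is a separable real ordered Banach space with order $\le$ and norm $\|\cdot\|$; its positive cone $X_+=\{g\in X:0\le g\}$ is closed and generating ($X=X_+-X_+$), and the norm is additive on $X_+$: $\|g+h\|=\|g\|+\|h\|$ for $g,h\in X_+$ ($X$ need not be a lattice). $\mathbb R_+=[0,\infty)$. Measurability and ''a.a.''/''a.e.'' refer to Lebesgue measure; $X$-valued integrals are Bochner integrals. $L^1_{loc}(\mathbb R_+;X_+)$ is the space of (classes of) locally Bochner integrable maps $\mathbb R_+\to X_+$, and $C(\mathbb R_+;X_+)$ the space of continuous maps. Real-valued functions are called positive if they are $\ge 0$. An operator $\Gamma$ with domain $\mathcal D(\Gamma)$ is positive if $\Gamma g\ge 0$ for all $0\le g\in\mathcal D(\Gamma)$; it is isotone if $g\le h$ implies $\Gamma g\le\Gamma h$ for all $g,h\in\mathcal D(\Gamma)$ (similarly for real-valued maps). $\Gamma$ is o-closed if for every increasing sequence $\{g_n\}\subset\mathcal D(\Gamma)$ converging in norm to $g\in X$ with $\Gamma g_n\to h\in X$ one has $g\in\mathcal D(\Gamma)$ and $\Gamma g=h$. A nonempty set $\mathcal M\subset X$ is p-saturated if $h\in\mathcal M$, $g\in X_+$, $g\le h$ imply $g\in\mathcal M$. A positive $C_0$ semigroup on $X$ is a $C_0$ semigroup leaving $X_+$ invariant. For a linear operator $\Lambda$: $\mathcal D(\Lambda^k)=\{g\in\mathcal D(\Lambda^{k-1}):\Lambda^{k-1}g\in\mathcal D(\Lambda)\}$, $\Lambda^kg=\Lambda(\Lambda^{k-1}g)$,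 $\mathcal D_+(\Lambda^k)=\mathcal D(\Lambda^k)\cap X_+$, $\mathcal D_+(\Lambda^\infty)=\bigcap_{k\ge1}\mathcal D_+(\Lambda^k)$. **Standing assumptions on the model.** $\mathcal D\subset X_+$ is dense in $X_+$ and p-saturated, and $Q^{\pm}:\mathbb R_+\times\mathcal D\to X_+$ are such that: $t\mapsto Q^{\pm}(t,g(t))$ is measurable for every measurable $g:\mathbb R_+\to X_+$ with $g(t)\in\mathcal D$ a.e.; for a.a. $t\ge0$ the operators $Q^{\pm}(t,\cdot)$ are isotone and o-closed (with domain $\mathcal D$). Moreover: (A) There is a linear operator $\Lambda:\mathcal D(\Lambda)\subset X\to X$ such that $-\Lambda$ is the infinitesimal generator of a positive $C_0$ semigroup on $X$, $\mathcal D_+(\Lambda)\subset\mathcal D$, and $Q^{\pm}(t,\mathcal D_+(\Lambda^k))\subset\mathcal D_+(\Lambda^{k-1})$ for a.a. $t\ge0$, $k=2,3$. ($A_0$) There is $\lambda_0>0$ such that $\lambda_0g\le\Lambda g$ for all $g\in\mathcal D_+(\Lambda)$. ($A_1$) There is a positive, non-decreasing, convex function $a:\mathbb R_+\to\mathbb R_+$ such that for a.a. $t\ge0$: $0\le Q^-(t,g)\le a(\|\Lambda g\|)\Lambda g$ for all $g\in\mathcal D_+(\Lambda)$, and the map $\mathcal D_+(\Lambda)\ni g\mapsto a(\|\Lambda g\|)\Lambda g-Q^-(t,g)\in X$ is isotone. ($A_2$) For a.a. $t\ge0$, $\Delta(t,g):=\|\Lambda Q^-(t,g)\|-\|\Lambda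 Q^+(t,g)\|\ge0$ for all $g\in\mathcal D_+(\Lambda^2)$, and $\mathcal D_+(\Lambda^2)\ni g\mapsto\Delta(t,g)\in\mathbb R_+$ is isotone. ($A_3$) There are a positive non-decreasing function $\rho:\mathbb R_+\to\mathbb R_+$ and a closed, positive, linear operator $\Lambda_1:\mathcal D(\Lambda_1)\subset X\to X$ with $\mathcal D_+(\Lambda)\subset\mathcal D(\Lambda_1)$, such that for a.a. $t\ge0$: $\|\Lambda_1Q^-(t,g)\|-\|\Lambda_1Q^+(t,g)\|\ge0$ for all $g\in\mathcal D_+(\Lambda^2)$, and $\|\Lambda^2Q^+(t,g)\|\le\|\Lambda^2Q^-(t,g)\|+\rho(\|\Lambda_1g\|)\|\Lambda^2g\|$ for all $g\in\mathcal D_+(\Lambda^3)$. **Mild solution.** $f\in C(\mathbb R_+;X_+)$ is a mild solution of the Cauchy problem with the operator $A$ on $\mathbb R_+$ if $$f(t)=U^tf_0+\int_0^tU^{t-s}[Q^+(s,f(s))-Q^-(s,f(s))]\,ds,\quad\forall t\ge0.$$ *)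

(* Defs.v *)
From HB Require Import structures.
From mathcomp Require Import all_boot all_order all_algebra.
From mathcomp Require Import all_classical all_reals all_analysis.

Set Implicit Arguments.
Unset Strict Implicit.
Unset Printing Implicit Defensive.

Import Order.TTheory GRing.Theory Num.Theory.
Import numFieldNormedType.Exports.
Local Open Scope classical_set_scope.
Local Open Scope ring_scope.

Section bochner.
Context d (T : measurableType d) (R : realType)
  (mu : {measure set T -> \bar R}) (X : completeNormedModType R).
Implicit Types (D : set T) (f : T -> X).

Definition simple_function (s : T -> X) : Prop :=
  finite_set (range s) /\ forall x, measurable (s @^-1` [set x]).

(* An a.e. limit of mu-measurable simple functions is unchanged by
   modification on a negligible set: when mu is the (Borel) Lebesgue measure,
   this is strong measurability with respect to the Lebesgue sigma-algebra,
   and f need only be meaningful almost everywhere on D. *)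
Definition strongly_measurable D f : Prop :=
  exists s : nat -> T -> X, (forall n, simple_function (s n)) /\
    \forall t \ae mu, D t -> s n t @[n --> \oo] --> f t.

Definition simple_integral D (s : T -> X) : X :=
  \sum_(x \in [set: X]) fine (mu (D `&` s @^-1` [set x])) *: x.

Definition bochner_approx D f (s : nat -> T -> X) : Prop :=
  [/\ forall n, simple_function (s n),
      forall n x, x != 0 -> (mu (D `&` s n @^-1` [set x]) < +oo)%E,
      (\forall t \ae mu, D t -> s n t @[n --> \oo] --> f t) &
      (\int[mu]_(t in D) (`|f t - s n t|)%:E)%E @[n --> \oo] --> 0%E].

Definition bochner_integrable D f : Prop := exists s, bochner_approx D f s.

(* Meaningful only under [bochner_integrable D f]; otherwise 0. *)
Definition bochner_integral D f : X :=
  xget 0 [set I | exists2 s, bochner_approx D f s &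
                    simple_integral D (s n) @[n --> \oo] --> I].

End bochner.

Section ordered_space.
Context (R : realType) (X : completeNormedModType R).
Implicit Types (le : X -> X -> Prop) (M : set X) (g h : X).

Record vector_order le : Prop := VectorOrder {
  vo_refl : forall g, le g g;
  vo_anti : forall g h, le g h -> le h g -> g = h;
  vo_trans : forall g h k, le g h -> le h k -> le g k;
  vo_add : forall g h k, le g h -> le (g + k) (h + k);
  vo_scale : forall (a : R) g h, 0 <= a -> le g h -> le (a *: g) (a *: h) }.

Definition cone le : set X := [set g | le 0 g].

Record state_space le : Prop := StateSpace {
  ss_order : vector_order le;
  ss_separable : exists2 S : set X, countable S & dense S;
  ss_closed : closed (cone le);
  ss_generating : forall x, exists g h,
    [/\ cone le g, cone le h & x = g - h];
  ss_additive : forall g h, cone le g -> cone le h ->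
    `|g + h| = `|g| + `|h| }.

Definition isotone_on (Y : Type) (leX : X -> X -> Prop) (leY : Y -> Y -> Prop)
    M (F : X -> Y) : Prop :=
  forall g h, M g -> M h -> leX g h -> leY (F g) (F h).

(* F is an operator with domain M. *)
Definition o_closed le M (F : X -> X) : Prop :=
  forall (u : nat -> X) g h, (forall n, M (u n)) ->
    (forall n, le (u n) (u n.+1)) ->
    u n @[n --> \oo] --> g -> F (u n) @[n --> \oo] --> h -> M g /\ F g = h.

Definition p_saturated le M : Prop :=
  M !=set0 /\ forall g h, M h -> cone le g -> le g h -> M g.

End ordered_space.

Section operators.
Context (R : realType) (X : completeNormedModType R).
Implicit Types (le : X -> X -> Prop) (g : X).

(* The values of [op] outside [domain] are irrelevant. *)
Record operator := Operator { domain : set X; op :> X -> X }.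
Implicit Types L : operator.

Definition opp_operator L : operator := Operator (domain L) (fun g => - L g).

Definition linear_operator L : Prop :=
  domain L 0 /\
  forall (a : R) g h, domain L g -> domain L h ->
    domain L (a *: g + h) /\ L (a *: g + h) = a *: L g + L h.

Definition positive_operator le L : Prop :=
  forall g, domain L g -> cone le g -> cone le (L g).

Definition closed_operator L : Prop :=
  closed [set p : X * X | domain L p.1 /\ p.2 = L p.1].

Fixpoint domain_pow L (k : nat) : set X :=
  if k is j.+1 then [set g | domain_pow L j g /\ domain L (iter j L g)]
  else setT.

Definition domain_pos le L k : set X := domain_pow L k `&` cone le.

Definition domain_pos_oo le L : set X :=
  [set g | forall k, (1 <= k)%N -> domain_pos le L k g].

(* [S t] is only relevant for [0 <= t]. *)
Record C0_semigroup (S : R -> X -> X) : Prop := C0Semigroup {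
  sg_linear : forall t, 0 <= t -> linear (S t);
  sg_bounded : forall t, 0 <= t -> continuous (S t);
  sg_0 : forall g, S 0 g = g;
  sg_add : forall s t g, 0 <= s -> 0 <= t -> S (s + t) g = S s (S t g);
  sg_cont : forall g, S h g @[h --> 0^'+] --> g }.

Definition semigroup_generator (S : R -> X -> X) L : Prop :=
  forall g l, (domain L g /\ L g = l) <->
              h^-1 *: (S h g - g) @[h --> 0^'+] --> l.

Record C0_group (U : R -> X -> X) : Prop := C0Group {
  gr_linear : forall t, linear (U t);
  gr_bounded : forall t, continuous (U t);
  gr_0 : forall g, U 0 g = g;
  gr_add : forall s t g, U (s + t) g = U s (U t g);
  gr_cont : forall g, U h g @[h --> (0 : R)] --> g }.

Definition group_generator (U : R -> X -> X) L : Prop :=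
  forall g l, (domain L g /\ L g = l) <->
              h^-1 *: (U h g - g) @[h --> 0^'] --> l.

End operators.

Section model.
Context (R : realType) (X : completeNormedModType R).
Variables (le : X -> X -> Prop) (D : set X).
Implicit Types (L : operator X) (Q Qp Qm : R -> X -> X) (g : X).

Local Notation mu := (@lebesgue_measure R).
Local Notation Rplus := (`[0, +oo[%classic : set R).

Definition admissible_domain : Prop :=
  [/\ D `<=` cone le, cone le `<=` closure D & p_saturated le D].

(* [Q t g] is only relevant for [0 <= t] and [D g]. *)
Record nonlinear_operator Q : Prop := NonlinearOperator {
  nl_pos : forall t g, 0 <= t -> D g -> cone le (Q t g);
  nl_measurable : forall f : R -> X,
    strongly_measurable mu Rplus f -> (forall t, 0 <= t -> cone le (f t)) ->
    (\forall t \ae mu, 0 <= t -> D (f t)) ->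
    strongly_measurable mu Rplus (fun t => Q t (f t));
  nl_isotone : \forall t \ae mu, 0 <= t -> isotone_on le le D (Q t);
  nl_oclosed : \forall t \ae mu, 0 <= t -> o_closed le D (Q t) }.

Record generator_assumption Qp Qm L : Prop := GeneratorAssumption {
  ga_linear : linear_operator L;
  ga_generator : exists S : R -> X -> X,
    [/\ C0_semigroup S,
        forall t g, 0 <= t -> cone le g -> cone le (S t g) &
        semigroup_generator S (opp_operator L)];
  ga_domain : domain_pos le L 1 `<=` D;
  ga_gain : forall k : nat, k = 2%N \/ k = 3%N ->
    \forall t \ae mu, 0 <= t ->
      forall g, domain_pos le L k g -> domain_pos le L k.-1 (Qp t g);
  ga_loss : forall k : nat, k = 2%N \/ k = 3%N ->
    \forall t \ae mu, 0 <= t ->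
      forall g, domain_pos le L k g -> domain_pos le L k.-1 (Qm t g) }.

Definition lower_bound_assumption L : Prop :=
  exists2 l0 : R, 0 < l0 &
    forall g, domain_pos le L 1 g -> le (l0 *: g) (L g).

Record loss_assumption Qm L (a : R -> R) : Prop := LossAssumption {
  la_pos : forall x, 0 <= x -> 0 <= a x;
  la_mono : forall x y, 0 <= x -> x <= y -> a x <= a y;
  la_convex : convex_function (E := R^o) Rplus a;
  la_bound : \forall t \ae mu, 0 <= t ->
    forall g, domain_pos le L 1 g ->
      le 0 (Qm t g) /\ le (Qm t g) (a `|L g| *: L g);
  la_isotone : \forall t \ae mu, 0 <= t ->
    isotone_on le le (domain_pos le L 1)
      (fun g => a `|L g| *: L g - Qm t g) }.

Definition dissipation Qp Qm L (t : R) g : R := `|L (Qm t g)| - `|L (Qp t g)|.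

Record dissipation_assumption Qp Qm L : Prop := DissipationAssumption {
  da_ge0 : \forall t \ae mu, 0 <= t ->
    forall g, domain_pos le L 2 g -> 0 <= dissipation Qp Qm L t g;
  da_isotone : \forall t \ae mu, 0 <= t ->
    isotone_on le (fun x y : R => x <= y) (domain_pos le L 2)
      (dissipation Qp Qm L t) }.

Record moment_assumption Qp Qm L (L1 : operator X) (rho : R -> R) : Prop :=
  MomentAssumption {
  ma_pos : forall x, 0 <= x -> 0 <= rho x;
  ma_mono : forall x y, 0 <= x -> x <= y -> rho x <= rho y;
  ma_linear : linear_operator L1;
  ma_closed : closed_operator L1;
  ma_positive : positive_operator le L1;
  ma_domain : domain_pos le L 1 `<=` domain L1;
  ma_dissipation : \forall t \ae mu, 0 <= t ->
    forall g, domain_pos le L 2 g -> 0 <= dissipation Qp Qm L1 t g;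
  ma_bound : \forall t \ae mu, 0 <= t ->
    forall g, domain_pos le L 3 g ->
      `|L (L (Qp t g))| <= `|L (L (Qm t g))| + rho `|L1 g| * `|L (L g)| }.

Definition L1loc_pos (f : R -> X) : Prop :=
  (forall T : R, 0 <= T -> bochner_integrable mu `[0, T] f) /\
  \forall t \ae mu, 0 <= t -> cone le (f t).

Definition continuous_pos (f : R -> X) : Prop :=
  {within Rplus, continuous f} /\ forall t, 0 <= t -> cone le (f t).

(* That f takes values in the domain of the nonlinear operators, and that the
   integrand is integrable, is implicit in writing the integral equation. *)
Record mild_solution (U : R -> X -> X) Qp Qm (f0 : X) (f : R -> X) : Prop :=
  MildSolution {
  ms_continuous : continuous_pos f;
  ms_domain : \forall s \ae mu, 0 <= s -> D (f s);
  ms_integrable : forall t, 0 <= t -> bochner_integrable mu `[0, t]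
    (fun s => U (t - s) (Qp s (f s) - Qm s (f s)));
  ms_equation : forall t, 0 <= t ->
    f t = U t f0 + bochner_integral mu `[0, t]
      (fun s => U (t - s) (Qp s (f s) - Qm s (f s))) }.

Definition regular_mild_solution (U : R -> X -> X) Qp Qm L (f0 : X)
    (f : R -> X) : Prop :=
  [/\ mild_solution U Qp Qm f0 f,
      forall t, 0 <= t -> domain_pos le L 2 (f t) &
      forall T, exists B : R, forall t, 0 <= t -> t <= T ->
        `|L (L (f t))| <= B].

End model.

(* Main.v *)
Require Import Defs.
From mathcomp Require Import all_boot all_order all_algebra.
From mathcomp Require Import all_classical all_reals all_analysis.
From mathcomp Require Import measurable_realfun.
From mathcomp Require Import ring lra.
Import Order.TTheory GRing.Theory Num.Theory.
Import numFieldNormedType.Exports.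
Local Open Scope classical_set_scope.
Local Open Scope ring_scope.


(** Additivity of the norm on the cone makes it the restriction of a bounded
    linear functional [mass], and makes increasing sequences with bounded norms
    converge. The whole proof is monotone: integrals, limits and estimates are
    taken in the order of [X] and then evaluated by [mass].

    In the frame moving with the group, [f t = U t (g t)], the transport
    disappears and the equation becomes [g' = Kp t g - Km t g] with the pulled
    back operators ([pulled_back], [mild_evolution], [evolution_mild]). As the
    group preserves the norm on the cone and commutes with [L] and [L1], all the
    hypotheses survive this change of frame ([pulled_back_gain_loss]).

    The loss term has the wrong monotonicity. Let [M = |L f0|] and [c = a M],
    and let [d t] be the mass dissipated up to time [t], the integral of the
    dissipation along [g]. As long as [|L g| + d = M], the equation may be
    written
      [g' + c L g = Kp t g + a (|L g| + d) L g - Km t g],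
    and the right-hand side ([source]) is isotone in [(g, d)], because [a] is
    convex and the loss subtracted from [a (|L g|) L g] is isotone. Solving
    successively the linear problems on the left, where [- L] generates a
    positive semigroup with decreasing orbits ([generator_dataP],
    [linear_solution_exists], [linear_solution_comparison]), gives increasing
    sequences [f n], [d n].

    The iterates are controlled by their moments ([step_moment]): since
    [f n <= f (n+1)], the terms added to both sides have a favourable sign, and
    the balance of gain and loss bounds [|L (f n)| + d n] by [M], [|L1 (f n)|]
    by [|L1 f0|] and [|L^2 (f n)|] by the exponential of the statement. These
    computations need all the powers of [L]; the datum is therefore approximated
    from below by elements of all the domains ([domain_pos_oo_approx]), and
    every iterate is bounded on bounded intervals by such an element ([tame]).

    In the limit, the defect [M - |L g| - d] is the integral of
    [(a M - a (|L g| + d)) |L^2 g|], hence vanishes by Gronwall's argument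
    ([limit_energy]); this is the energy identity, and it cancels the two added
    terms, so that the limit solves the original problem. Conversely the energy
    identity holds for every regular solution, which therefore solves the same
    kind of linear problem and lies above all the iterates ([solution_above]).
    Two solutions are thus comparable, their dissipated masses are ordered in
    the same way, and since their sums with [|L g|] are both [M], the solutions
    coincide ([evolution_well_posed]).

    Integrals are handled through the relation [has_int], an approximation by
    simple functions together with the limit of their integrals. *)

Set Implicit Arguments.
Unset Strict Implicit.
Unset Printing Implicit Defensive.

(** * Linear identities in a module *)

Section module_identities.
Context (R : comNzRingType) (V : lmodType R).

Inductive mexp :=
  | MVar of nat | MZero | MAdd of mexp & mexp | MOpp of mexp
  | MScale of R & mexp.

Fixpoint meval (xs : seq V) (m : mexp) : V :=
  match m with
  | MVar i => nth 0 xs i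
  | MZero => 0
  | MAdd a b => meval xs a + meval xs b
  | MOpp a => - meval xs a
  | MScale k a => k *: meval xs a
  end.

Fixpoint mcoef (m : mexp) (i : nat) : R :=
  match m with
  | MVar j => if Nat.eqb j i then 1 else 0
  | MZero => 0
  | MAdd a b => mcoef a i + mcoef b i
  | MOpp a => - mcoef a i
  | MScale k a => k * mcoef a i
  end.

Lemma meval_coef xs m : meval xs m = \sum_(i < size xs) mcoef m i *: xs`_i.
Proof.
elim: m => [j||a IHa b IHb|a IHa|k a IHa] /=.
- have [ij|ij] := ltnP j (size xs); last first.
    rewrite nth_default// big1// => i _.
    case: PeanoNat.Nat.eqb_spec => [e|_]; rewrite ?scale0r//.
    by move: (ltn_ord i); rewrite -e ltnNge ij.
  rewrite (bigD1 (Ordinal ij))//= PeanoNat.Nat.eqb_refl scale1r big1 ?addr0// => i.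
  rewrite -val_eqE/= => /eqP ij'.
  by case: PeanoNat.Nat.eqb_spec => [/esym|_]; rewrite ?scale0r.
- by rewrite big1// => i _; rewrite scale0r.
- by rewrite IHa IHb -big_split; apply: eq_bigr => i _; rewrite scalerDl.
- by rewrite IHa -sumrN; apply: eq_bigr => i _; rewrite scaleNr.
- by rewrite IHa scaler_sumr; apply: eq_bigr => i _; rewrite scalerA.
Qed.

Fixpoint mcoefs_eq (n : nat) (m1 m2 : mexp) : Prop :=
  if n is k.+1 then mcoef m1 k = mcoef m2 k /\ mcoefs_eq k m1 m2 else True.

Lemma meval_eq xs m1 m2 : mcoefs_eq (size xs) m1 m2 ->
  meval xs m1 = meval xs m2.
Proof.
move=> H; rewrite !meval_coef; apply: eq_bigr => -[i /= ilt] _; congr (_ *: _).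
move: (size xs) ilt H => n; elim: n => // n IH; rewrite ltnS leq_eqVlt.
by case/orP => [/eqP -> []//|/IH h /= [_ /h]].
Qed.

End module_identities.

Ltac mod_index x xs :=
  lazymatch xs with
  | x :: _ => constr:(O)
  | _ :: ?r => let n := mod_index x r in constr:(S n)
  end.
Ltac mod_member x xs :=
  lazymatch xs with
  | nil => constr:(false)
  | x :: _ => constr:(true)
  | _ :: ?r => mod_member x r
  end.
Ltac mod_atoms xs t :=
  lazymatch t with
  | (?a + ?b)%R => let ys := mod_atoms xs a in mod_atoms ys b
  | (- ?a)%R => mod_atoms xs a
  | (_ *: ?a)%R => mod_atoms xs a
  | (0)%R => xs
  | _ => lazymatch mod_member t xs with
         | true => xs
         | false => constr:(t :: xs)
         end
  end.
Ltac mod_reify R xs t :=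
  lazymatch t with
  | (?a + ?b)%R =>
      let u := mod_reify R xs a in let v := mod_reify R xs b in
      constr:(@MAdd R u v)
  | (- ?a)%R => let u := mod_reify R xs a in constr:(@MOpp R u)
  | (?k *: ?a)%R => let u := mod_reify R xs a in constr:(@MScale R k u)
  | (0)%R => constr:(@MZero R)
  | _ => let n := mod_index t xs in constr:(@MVar R n)
  end.

(** Identities between linear combinations in a module over [R], reduced to
    the equality of the coefficients of each atom. *)
Ltac lmod R :=
  lazymatch goal with
  | |- @eq ?V ?s ?t =>
      let xs0 := mod_atoms (@nil V) s in
      let xs := mod_atoms xs0 t in
      let m1 := mod_reify R xs s in
      let m2 := mod_reify R xs t in
      refine (@meval_eq R _ xs m1 m2 _);
      cbn [mcoefs_eq mcoef size Nat.eqb]; repeat split; try ring; try lra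
  end.

(** * Sequences in a Banach space *)

Section sequences.
Context (R : realType) (V : normedModType R).

Lemma cvgn_distP (u : nat -> V) (l : V) : u n @[n --> \oo] --> l <->
  forall eps : R, 0 < eps -> exists N, forall n, (N <= n)%N -> `|u n - l| < eps.
Proof.
split=> [/cvgrPdist_lt h eps eps0|h].
  have [N _ hN] := h _ eps0; exists N => n Nn.
  by rewrite distrC; exact: hN.
apply/cvgrPdist_lt => eps /h[N hN]; exists N => // n Nn.
by rewrite /= distrC; exact: hN.
Qed.

Lemma cvgn_bound (u : nat -> V) l (b : nat -> R) :
  (forall n, `|u n - l| <= b n) -> b n @[n --> \oo] --> (0 : R) ->
  u n @[n --> \oo] --> l.
Proof.
move=> ub b0; apply/cvgn_distP => eps eps0.
have /cvgrPdist_lt/(_ _ eps0)[N _ hN] := b0.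
exists N => n Nn; apply: le_lt_trans (ub n) _.
by have := hN n Nn; rewrite /= sub0r normrN => /(le_lt_trans (ler_norm _)).
Qed.

Lemma cvgn_norm_le (u : nat -> V) l (B : R) :
  u n @[n --> \oo] --> l -> (forall n, `|u n| <= B) -> `|l| <= B.
Proof.
move=> /cvgn_distP ul uB; apply/ler_addgt0Pr => eps /ul[N /(_ _ (leqnn N)) hN].
have -> : l = u N - (u N - l) by lmod R.
by rewrite (le_trans (ler_normB _ _))// lerD// ltW.
Qed.

Lemma cvgn_map (W : normedModType R) (u : nat -> V) l (T : V -> W) :
  continuous T -> u n @[n --> \oo] --> l -> T (u n) @[n --> \oo] --> T l.
Proof. by move=> cT ul; apply: cvg_comp ul (cT l). Qed.

Lemma cvgn_succ (u : nat -> V) (l : V) :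
  u n @[n --> \oo] --> l -> u n.+1 @[n --> \oo] --> l.
Proof. by move=> ul; rewrite cvg_shiftS. Qed.

End sequences.

Lemma cvgn_uniq (R : realType) (V : normedModType R) (u : nat -> V) (l l' : V) :
  u n @[n --> \oo] --> l -> u n @[n --> \oo] --> l' -> l = l'.
Proof. exact: (@cvg_unique _ (@norm_hausdorff _ V)). Qed.

Lemma cauchy_cvgn (R : realType) (X : completeNormedModType R) (u : nat -> X) :
  (forall eps : R, 0 < eps -> exists N, forall n, (N <= n)%N ->
     `|u n - u N| < eps) ->
  exists l : X, u n @[n --> \oo] --> l.
Proof.
move=> h; exists (lim (u n @[n --> \oo])).
apply: cauchy_cvg; apply: cauchy_exP => eps /h[N hN].
exists (u N); exists N => // n Nn /=.
by rewrite -ball_normE /= distrC; exact: hN.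
Qed.

Lemma lin_continuous (R : realType) (V W : normedModType R) (T : V -> W) (C : R) :
  (forall x y, T (x - y) = T x - T y) -> (forall x, `|T x| <= C * `|x|) ->
  continuous T.
Proof.
move=> TB TC x; apply/cvgrPdist_lt => eps eps0.
have C1 : 0 < `|C| + 1 by rewrite ltr_pwDr.
near=> y; rewrite -TB (le_lt_trans (TC _))//.
rewrite (@le_lt_trans _ _ ((`|C| + 1) * `|x - y|))//.
  by rewrite ler_wpM2r// (le_trans (ler_norm _))// lerDl.
rewrite mulrC -ltr_pdivlMr//; near: y.
by apply: cvgr_dist_lt => //; exact: divr_gt0.
Unshelve. all: end_near. Qed.

Lemma cvg_geometric_half (R : realType) (C : R) :
  C * 2^-1 ^+ n @[n --> \oo] --> (0 : R).
Proof. by apply: cvg_geometric; rewrite ger0_norm ?invf_lt1 ?ltr1n. Qed.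

(** * Ordered Banach spaces with a norm additive on the cone *)

Section state_space.
Context (R : realType) (X : completeNormedModType R) (le : X -> X -> Prop).
Hypothesis ss : state_space le.
Local Notation K := (cone le).
Implicit Types x y z g h : X.

Lemma le_coneB x y : le x y <-> K (y - x).
Proof.
split=> [xy|yx].
  by have := vo_add (ss_order ss) (- x) xy; rewrite subrr.
have := vo_add (ss_order ss) x yx.
by rewrite add0r subrK.
Qed.

Lemma cone0 : K 0. Proof. exact: vo_refl (ss_order ss) _. Qed.

Lemma coneD x y : K x -> K y -> K (x + y).
Proof.
move=> Kx Ky; apply: (vo_trans (ss_order ss) Ky).
by have := vo_add (ss_order ss) y Kx; rewrite add0r.
Qed.

Lemma coneZ (a : R) x : 0 <= a -> K x -> K (a *: x).
Proof.
by move=> a0 Kx; have := vo_scale (ss_order ss) a0 Kx; rewrite scaler0.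
Qed.

Lemma cone_sum I (r : seq I) (P : pred I) (F : I -> X) :
  (forall i, P i -> K (F i)) -> K (\sum_(i <- r | P i) F i).
Proof. move=> KF; apply: big_ind => //; [exact: cone0|exact: coneD]. Qed.

Lemma cone_norm_le x y : K x -> K (y - x) -> `|x| <= `|y|.
Proof.
move=> Kx Kyx; rewrite -[y in leRHS](subrK x) addrC (ss_additive ss)//.
by rewrite lerDl.
Qed.

Lemma cone_closed (u : nat -> X) (l : X) :
  u n @[n --> \oo] --> l -> (exists N, forall n, (N <= n)%N -> K (u n)) -> K l.
Proof.
move=> ul [N Ku]; apply: (closed_cvg _ (ss_closed ss)) ul => //.
by exists N.
Qed.

Lemma cone_lim (u : nat -> X) (l : X) :
  u n @[n --> \oo] --> l -> (forall n, K (u n)) -> K l.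
Proof. by move=> ul Ku; apply: cone_closed ul _; exists 0%N. Qed.

Lemma incr_cone (u : nat -> X) : (forall n, K (u n.+1 - u n)) ->
  forall m n, (m <= n)%N -> K (u n - u m).
Proof.
move=> uS m n /subnK <-; elim: (n - m)%N => [|k IH].
  by rewrite add0n subrr; exact: cone0.
rewrite addSn (_ : _ - _ = (u (k + m).+1 - u (k + m)%N) + (u (k + m)%N - u m)).
  exact: coneD.
lmod R.
Qed.

Lemma incr_cone_lim (u : nat -> X) (l : X) : (forall n, K (u n.+1 - u n)) ->
  u n @[n --> \oo] --> l -> forall n, K (l - u n).
Proof.
move=> uS ul n; apply: (@cone_closed (fun k => u k - u n)).
  by apply: cvgB ul _; exact: cvg_cst.
by exists n => k; exact: incr_cone.
Qed.

(** On an increasing sequence the distances are differences of the increasing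
    numbers [|u n - u 0|]; hence bounded increasing sequences converge. *)
Lemma incr_cvg (u : nat -> X) (B : R) : (forall n, K (u n.+1 - u n)) ->
  (forall n, `|u n| <= B) -> exists l : X, u n @[n --> \oo] --> l.
Proof.
move=> uS uB; have um := incr_cone uS.
have ud m n : (m <= n)%N -> `|u n - u m| = `|u n - u 0%N| - `|u m - u 0%N|.
  move=> mn; have -> : u n - u 0%N = (u n - u m) + (u m - u 0%N) by lmod R.
  by rewrite (ss_additive ss (um _ _ mn) (um _ _ (leq0n m))) addrK.
pose r n := `|u n - u 0%N|.
have cr : cvgn r.
  apply: nondecreasing_is_cvgn => [m n mn|].
    by rewrite -subr_ge0 /r -ud.
  exists (B + B) => _ [n _ <-]; rewrite /r (le_trans (ler_normB _ _))//.
  exact: lerD.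
apply: cauchy_cvgn => eps eps0.
have eps2 : 0 < eps / 2 by rewrite divr_gt0.
have /cvgn_distP/(_ _ eps2)[N hN] := cr.
exists N => n Nn; rewrite ud//.
have := hN n Nn; have := hN N (leqnn N); rewrite /r !ltr_norml.
by move=> /andP[] h1 h2 /andP[] h3 h4; lra.
Qed.

(** The two halves of a generating closed cone can be chosen of norm at most a
    multiple of that of the vector (Andô): by Baire's theorem the differences
    of bounded positive vectors are dense in some ball around the origin, and
    a decomposition up to a remainder of half the norm can be iterated. *)
Lemma cone_approx_decomposition : exists2 c : R, 0 < c & forall x, exists g h,
  [/\ K g, K h, `|g| <= c * `|x|, `|h| <= c * `|x| & `|x - (g - h)| <= `|x| / 2].
Proof.
pose B n := [set x | exists g h, [/\ K g, K h, `|g| <= n%:R, `|h| <= n%:R & x = g - h]].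
have [[n hn]|H] := pselect (exists n, ~ dense (~` closure (B n))); last first.
  have /Baire : forall n, open (~` closure (B n)) /\ dense (~` closure (B n)).
    move=> n; split; first by rewrite openC; exact: closed_closure.
    by apply: contrapT => nd; apply: H; exists n.
  case/(_ setT); [by exists 0|exact: openT|].
  move=> x [_ Hx]; have [g [h [Kg Kh xgh]]] := ss_generating ss x.
  have [n nb] : exists n : nat, Num.max `|g| `|h| <= n%:R.
    have := truncnS_gt (Num.max `|g| `|h|) => /ltW gt; by eexists; exact: gt.
  exfalso; apply: (Hx n I); apply: subset_closure; exists g, h; split => //.
    by rewrite (le_trans _ nb)// le_max lexx.
  by rewrite (le_trans _ nb)// le_max lexx orbT.
have [r [x0 [r0 hr]]] : exists (r : R) x0, 0 < r /\
    forall y, `|y| < r -> closure (B n) (x0 + y).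
  apply: contrapT => nr; apply: hn => O [x Ox] oO.
  apply: contrapT => nO; apply: nr.
  have /nbhs_ballP[r /= r0 hr] : nbhs x O by exact: open_nbhs_nbhs.
  exists r, x; split => // y yr; apply: contrapT => ny.
  apply: nO; exists (x + y); split => //; apply: hr.
  by rewrite -ball_normE /= opprD addrA subrr sub0r normrN.
have BN x : closure (B n) x -> forall eps : R, 0 < eps -> exists2 y, B n y & `|x - y| < eps.
  move=> /(_ _ (nbhsx_ballx x _ _)) cx eps eps0.
  have [y [By]] := cx eps eps0; rewrite -ball_normE /= => xy.
  by exists y.
have step y : `|y| < r -> forall eps : R, 0 < eps -> exists g h,
    [/\ K g, K h, `|g| <= n%:R + n%:R, `|h| <= n%:R + n%:R & `|y - (g - h)| < eps].
  move=> yr eps eps0; have eps2 : 0 < eps / 2 by rewrite divr_gt0.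
  have [_ [g1 [h1 [Kg1 Kh1 g1n h1n ->]]] d1] := BN _ (hr y yr) _ eps2.
  have n0r : `|0 : X| < r by rewrite normr0.
  have [_ [g2 [h2 [Kg2 Kh2 g2n h2n ->]]] d2] := BN _ (hr 0 n0r) _ eps2.
  exists (g1 + h2), (h1 + g2); split; [exact: coneD|exact: coneD| | |].
  - by rewrite (le_trans (ler_normD _ _))// lerD.
  - by rewrite (le_trans (ler_normD _ _))// lerD.
  - rewrite (_ : _ - _ = (x0 + y - (g1 - h1)) - (x0 + 0 - (g2 - h2))); last by lmod R.
    rewrite (le_lt_trans (ler_normB _ _))//; lra.
exists (2 * (n%:R + n%:R + 1) / r); first by rewrite divr_gt0// mulr_gt0// ltr_wpDl.
move=> x; have [->|x0'] := eqVneq x 0.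
  exists 0, 0; rewrite !subr0 !normr0 !mulr0 mul0r; split => //; exact: cone0.
have nx : 0 < `|x| by rewrite normr_gt0.
pose k := r / (2 * `|x|).
have k0 : 0 < k by rewrite divr_gt0// mulr_gt0.
have kx : `|k *: x| < r.
  rewrite normrZ gtr0_norm// (_ : k * `|x| = r / 2); first by lra.
  by rewrite /k; field; rewrite gt_eqF.
have e0 : 0 < k * (`|x| / 2) by rewrite mulr_gt0// divr_gt0.
have [g [h [Kg Kh gn hn' d]]] := step _ kx _ e0.
have ki0 : 0 <= k^-1 by rewrite invr_ge0 ltW.
have bound y : `|y| <= n%:R + n%:R ->
    `|k^-1 *: y| <= 2 * (n%:R + n%:R + 1) / r * `|x|.
  move=> yn; rewrite normrZ ger0_norm// /k invf_div.
  rewrite (_ : 2 * _ / r * _ = 2 * `|x| / r * (n%:R + n%:R + 1)); last by ring.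
  by rewrite ler_wpM2l ?divr_ge0 ?mulr_ge0 ?ltW// (le_lt_trans yn)// ltrDl.
exists (k^-1 *: g), (k^-1 *: h); split; [exact: coneZ|exact: coneZ|exact: bound|exact: bound|].
have -> : x - (k^-1 *: g - k^-1 *: h) = k^-1 *: (k *: x - (g - h)).
  by rewrite scalerBr scalerA mulVf ?gt_eqF// scale1r scalerBr.
by rewrite normrZ ger0_norm// mulrC ler_pdivrMr// mulrC ltW.
Qed.

Lemma cone_decomposition : exists2 C : R, 0 <= C & forall x, exists g h,
  [/\ K g, K h, x = g - h, `|g| <= C * `|x| & `|h| <= C * `|x|].
Proof.
have [c c0 hc] := cone_approx_decomposition.
have [p hp] := choice (fun x => (hc x : exists g, _)).
have [q hq] := choice (fun x => (hp x : exists h, _)).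
exists (2 * c) => [|x]; first by rewrite mulr_ge0// ltW.
pose y k := iter k (fun y => y - (p y - q y)) x.
have yb k : `|y k| <= `|x| * 2^-1 ^+ k.
  elim: k => [|k IH] /=; first by rewrite mulr1.
  have [_ _ _ _ h] := hq (y k); rewrite (le_trans h)//.
  by rewrite exprSr mulrA ler_wpM2r// invr_ge0.
pose G (f : X -> X) n := \sum_(k < n) f (y k).
have Gb f n : (forall z, `|f z| <= c * `|z|) -> `|G f n| <= 2 * c * `|x|.
  move=> fb; suff : `|G f n| <= c * `|x| * (2 - 2 * 2^-1 ^+ n).
    move=> /le_trans; apply; rewrite [2 * c]mulrC mulrAC ler_wpM2r//.
    have : 0 <= 2^-1 ^+ n :> R by rewrite exprn_ge0// invr_ge0.
    by move=> h; rewrite ler_wpM2l ?(ltW c0)//; lra.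
  elim: n => [|n IH]; first by rewrite /G big_ord0 normr0 expr0 mulr1 subrr mulr0.
  rewrite /G big_ord_recr/= (le_trans (ler_normD _ _))//.
  have h1 := fb (y n); have h2 := ler_wpM2l (ltW c0) (yb n).
  have e1 : c * `|x| * (2 - 2 * 2^-1 ^+ n) + c * (`|x| * 2^-1 ^+ n) = c * `|x| * (2 - 2 * 2^-1 ^+ n.+1).
    by rewrite exprS; field.
  rewrite -e1 lerD//; exact: le_trans h1 h2.
have Gcvg f : (forall z, K (f z)) -> (forall z, `|f z| <= c * `|z|) ->
    exists2 l, K l /\ `|l| <= 2 * c * `|x| & G f n @[n --> \oo] --> l.
  move=> Kf fb; have [||l hl] := @incr_cvg (G f) (2 * c * `|x|).
  - by move=> n; rewrite /G big_ord_recr/= addrAC subrr add0r; exact: Kf.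
  - by move=> n; exact: Gb.
  exists l => //; split.
    by apply: cone_lim hl _ => n; apply: cone_sum.
  by apply: cvgn_norm_le hl _ => n; exact: Gb.
have [||g [Kg gb] hg] := Gcvg p.
- by move=> z; have [] := hq z.
- by move=> z; have [] := hq z.
have [||h [Kh hb] hh] := Gcvg q.
- by move=> z; have [] := hq z.
- by move=> z; have [] := hq z.
exists g, h; split => //.
have yE n : x - y n = G p n - G q n.
  elim: n => [|n IH]; first by rewrite /G !big_ord0 !subrr.
  rewrite /G !big_ord_recr/= opprB addrCA [in LHS]addrC.
  rewrite -/(G p n) -/(G q n) (_ : _ + _ - (_ + _) = (G p n - G q n) + (p (y n) - q (y n))).
    by rewrite -IH; lmod R.
  lmod R.
apply: (@cvgn_uniq _ _ (fun n => x - y n)).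
  apply: cvgn_bound (cvg_geometric_half `|x|) => n.
  by rewrite addrC addKr normrN.
under eq_fun do rewrite yE.
exact: cvgB.
Qed.

End state_space.

Section mass.
Context (R : realType) (X : completeNormedModType R) (le : X -> X -> Prop).
Hypothesis ss : state_space le.
Local Notation K := (cone le).
Implicit Types x y z g h : X.

(** The linear extension to [X] of the norm of the cone; it makes total mass a
    functional that commutes with integrals and limits. *)
Definition mass x : R :=
  xget 0 [set r | exists g h, [/\ K g, K h, x = g - h & r = `|g| - `|h| ] ].

Lemma massE g h : K g -> K h -> mass (g - h) = `|g| - `|h|.
Proof.
move=> Kg Kh; rewrite /mass; case: xgetP => [r _ [g' [h' [Kg' Kh' e ->]]]|].
  have e2 : g' + h = g + h'.
    have -> : g = (g - h) + h by lmod R.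
    by rewrite e; lmod R.
  have := congr1 Num.norm e2; rewrite !(ss_additive ss)//; lra.
by move=> /(_ (`|g| - `|h|)) []; exists g, h.
Qed.

Lemma mass_cone g : K g -> mass g = `|g|.
Proof.
by move=> Kg; rewrite -{1}[g]subr0 massE// ?normr0 ?subr0//; exact: cone0.
Qed.

Lemma massD x y : mass (x + y) = mass x + mass y.
Proof.
have [g [h [Kg Kh ->]]] := ss_generating ss x.
have [g' [h' [Kg' Kh' ->]]] := ss_generating ss y.
have -> : g - h + (g' - h') = (g + g') - (h + h') by lmod R.
rewrite !massE ?(ss_additive ss)//; [lra|exact: coneD|exact: coneD].
Qed.

Lemma massN x : mass (- x) = - mass x.
Proof.
have [g [h [Kg Kh ->]]] := ss_generating ss x.
by rewrite opprB !massE// opprB.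
Qed.

Lemma massB x y : mass (x - y) = mass x - mass y.
Proof. by rewrite massD massN. Qed.

Lemma mass0 : mass 0 = 0.
Proof. by rewrite mass_cone ?normr0//; exact: cone0. Qed.

Lemma massZ (a : R) x : mass (a *: x) = a * mass x.
Proof.
have pos (b : R) : 0 <= b -> mass (b *: x) = b * mass x.
  move=> b0; have [g [h [Kg Kh ->]]] := ss_generating ss x.
  rewrite scalerBr !massE ?normrZ ?ger0_norm ?mulrBr//; exact: coneZ.
have [a0|a0] := leP 0 a; first exact: pos.
rewrite -[a]opprK scaleNr massN pos ?oppr_ge0 ?(ltW a0)//; lra.
Qed.

Lemma mass_ge0 g : K g -> 0 <= mass g.
Proof. by move=> Kg; rewrite mass_cone. Qed.

Lemma mass_le x y : K (y - x) -> mass x <= mass y.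
Proof. by move=> /mass_ge0; rewrite massB subr_ge0. Qed.

Lemma mass_bounded : exists2 C : R, 0 <= C & forall x, `|mass x| <= C * `|x|.
Proof.
have [C C0 hC] := cone_decomposition ss; exists (C + C); first exact: addr_ge0.
move=> x; have [g [h [Kg Kh xE gC hC']]] := hC x.
rewrite {1}xE massE// (le_trans (ler_normB _ _))// !normr_id mulrDl.
exact: lerD.
Qed.

Lemma mass_continuous : continuous mass.
Proof.
by have [C _ hC] := mass_bounded; exact: (lin_continuous (W := R^o) massB hC).
Qed.

Lemma mass_cvg (u : nat -> X) (l : X) :
  u n @[n --> \oo] --> l -> mass (u n) @[n --> \oo] --> mass l.
Proof. exact: (cvgn_map (W := R^o) mass_continuous). Qed.

Lemma cone_mass_eq0 g : K g -> mass g = 0 -> g = 0.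
Proof. by move=> Kg; rewrite mass_cone// => /eqP; rewrite normr_eq0 => /eqP. Qed.

Lemma mono_cvg (u : nat -> X) (B : R) : K (u 0%N) ->
  (forall n, K (u n.+1 - u n)) -> (forall n, mass (u n) <= B) ->
  exists2 l, u n @[n --> \oo] --> l & forall n, K (l - u n).
Proof.
move=> u0 uS uB; have [|l ul] := @incr_cvg _ _ _ ss u B uS.
  move=> n; rewrite -mass_cone//.
  have := @incr_cone _ _ _ ss u uS 0%N n (leq0n n) => /(coneD ss u0).
  by rewrite addrC subrK.
by exists l => //; exact: (incr_cone_lim ss).
Qed.

(** Were each [p n] large at some small vector [g n], then the sum of the [g
    n] would lie above every [g n], and monotonicity would make all [p n]
    large at that single vector. *)
Lemma gliding_sum (p : nat -> X -> R) :
  (forall n x y, K x -> K (y - x) -> p n x <= p n y) ->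
  (forall n (a : R) x, 0 <= a -> K x -> p n (a *: x) = a * p n x) ->
  (forall n, exists2 g, K g & n%:R * 2 ^+ n * `|g| < p n g) ->
  exists2 g, K g & forall n, n%:R <= p n g.
Proof.
move=> pmono phom hg.
have gex : forall n, exists g,
    [/\ K g, `|g| <= 2^-1 ^+ n & n%:R <= p n g].
  move=> n; have [h Kh hn] := hg n.
  have h0 : h != 0.
    apply: contraTneq hn => ->; rewrite normr0 mulr0.
    by have := phom n 0 0 (lexx 0) (cone0 ss); rewrite scaler0 mul0r => ->; rewrite ltxx.
  have nh : 0 < `|h| by rewrite normr_gt0.
  have a0 : 0 <= 2^-1 ^+ n / `|h| by rewrite divr_ge0// exprn_ge0.
  exists ((2^-1 ^+ n / `|h|) *: h); split; first exact: coneZ.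
    by rewrite normrZ ger0_norm// divfK// gt_eqF.
  rewrite phom// mulrAC ler_pdivlMr//; apply/ltW.
  by rewrite exprVn -ltr_pdivrMl ?invr_gt0 ?exprn_gt0// invrK mulrCA mulrA.
have [g gP] := choice gex.
pose u n := \sum_(k < n) g k.
have uS n : u n.+1 - u n = g n by rewrite /u big_ord_recr/= addrAC subrr add0r.
have [||n|G uG Gu] := @mono_cvg u 2.
- by rewrite /u big_ord0; exact: cone0.
- by move=> n; rewrite uS; have [] := gP n.
- suff : mass (u n) <= 2 - 2 * 2^-1 ^+ n.
    by move=> /le_trans; apply; rewrite gerBl mulr_ge0// exprn_ge0// invr_ge0.
  elim: n => [|n IH]; first by rewrite /u big_ord0 mass0 expr0 mulr1 subrr.
  rewrite /u big_ord_recr/= massD -/(u n); have [Kg gn _] := gP n.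
  rewrite [mass (g n)]mass_cone// exprS; lra.
exists G => [|n].
  by have := Gu 0%N; rewrite /u big_ord0 subr0.
have [Kg _ pn] := gP n; apply: (le_trans pn); apply: pmono => //.
rewrite -uS (_ : _ - _ = (G - u n.+1) + u n); last by lmod R.
apply: (coneD ss) => //; apply: (cone_sum ss) => k _.
by have [] := gP k.
Qed.

(** A linear functional positive on a closed generating cone is bounded, by a
    gliding sum on the cone and the decomposition of vectors. *)
Lemma positive_functional_bounded (q : X -> R) :
  (forall x y, q (x - y) = q x - q y) ->
  (forall (a : R) x, 0 <= a -> K x -> q (a *: x) = a * q x) ->
  (forall x, K x -> 0 <= q x) ->
  exists2 C : R, 0 <= C & forall x, `|q x| <= C * `|x|.
Proof.
move=> qB qZ q0.
have [C C0 hC] : exists2 C : R, 0 <= C & forall g, K g -> q g <= C * `|g|.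
  apply: contrapT => nC.
  have [n x y Kx Kyx|n|n|g Kg gn] := @gliding_sum (fun=> q).
  - by rewrite -subr_ge0 -qB q0.
  - exact: qZ.
  - apply: contrapT => ng; apply: nC; exists (n%:R * 2 ^+ n).
      by rewrite mulr_ge0// exprn_ge0.
    move=> g Kg; rewrite leNgt; apply/negP => h; apply: ng; by exists g.
  - have := gn (Num.bound (q g)); apply/negP; rewrite -ltNge.
    by have := archi_boundP (q0 _ Kg).
have [c c0 hc] := cone_decomposition ss.
exists (C * c + C * c); first by rewrite addr_ge0// mulr_ge0.
move=> x; have [g [h [Kg Kh xE gC hC']]] := hc x.
rewrite {1}xE qB (le_trans (ler_normB _ _))// !ger0_norm ?q0//.
rewrite mulrDl lerD// -mulrA.
  by rewrite (le_trans (hC _ Kg))// ler_wpM2l.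
by rewrite (le_trans (hC _ Kh))// ler_wpM2l.
Qed.

End mass.

(** * The Bochner integral *)

Section simple_functions.
Context d (T : measurableType d) (R : realType) (mu : {measure set T -> \bar R}).

Definition simple_fun (Y : choiceType) (p : T -> Y) :=
  finite_set (range p) /\ forall y, measurable (p @^-1` [set y]).

Lemma simple_fun_preimage (Y : choiceType) (p : T -> Y) (A : set Y) :
  simple_fun p -> measurable (p @^-1` A).
Proof.
move=> [fp mp].
have -> : p @^-1` A = \bigcup_(y in range p `&` A) (p @^-1` [set y]).
  apply/seteqP; split=> [t At|t [y [_ Ay] /= ->]//].
  by exists (p t) => //; split => //; exists t.
apply: fin_bigcup_measurable => [|y _]; last exact: mp.
exact: finite_setIl.
Qed.

Lemma simple_fun_comp (Y Z : choiceType) (h : Y -> Z) (p : T -> Y) :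
  simple_fun p -> simple_fun (h \o p).
Proof.
move=> sp; split; last first.
  by move=> z; rewrite comp_preimage; exact: simple_fun_preimage.
by rewrite -(image_comp p h); apply: finite_image; case: sp.
Qed.

Lemma simple_fun_pair (Y Z : choiceType) (p : T -> Y) (q : T -> Z) :
  simple_fun p -> simple_fun q -> simple_fun (fun t => (p t, q t)).
Proof.
move=> [fp mp] [fq mq]; split.
  apply: (@sub_finite_set _ _ (range p `*` range q)); last exact: finite_setX.
  by move=> _ [t _ <-]; split => /=; exists t.
move=> [y z].
have -> : (fun t => (p t, q t)) @^-1` [set (y, z)] =
    p @^-1` [set y] `&` q @^-1` [set z].
  by apply/seteqP; split=> [t [<- <-]//|t [/= <- <-]].
exact: measurableI.
Qed.

Lemma simple_fun_measurable (Y : choiceType) (p : T -> Y) (phi : Y -> R) :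
  simple_fun p -> measurable_fun setT (fun t => phi (p t)).
Proof.
by move=> sp _ B mB; rewrite setTI; exact: (@simple_fun_preimage _ p (phi @^-1` B)).
Qed.

Lemma simple_fun_indic (Y : choiceType) (A : set T) (y z : Y) :
  measurable A -> simple_fun (fun t => if t \in A then y else z).
Proof.
move=> mA; split.
  apply: (@sub_finite_set _ _ [set y; z]); last exact: finite_set2.
  by move=> _ [t _ <-]; case: ifP => _; [left|right].
move=> w.
have -> : (fun t => if t \in A then y else z) @^-1` [set w] =
    (if y == w then A else set0) `|` (if z == w then ~` A else set0).
  apply/seteqP; split=> [t /=|t].
    case: ifPn => [/set_mem At ->|/negP nAt ->]; rewrite eqxx; first by left.
    by right => At; apply: nAt; exact: mem_set.
  by case=> /=; case: eqP => // -> At; rewrite ?(mem_set At)// memNset.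
apply: measurableU; case: ifP => // _; exact: measurableC.
Qed.

Variable D : set T.
Hypotheses (mD : measurable D) (fD : (mu D < +oo)%E).

Let wt A := fine (mu (D `&` A)).

Let wtE A : measurable A -> mu (D `&` A) = (wt A)%:E.
Proof.
move=> mA; rewrite /wt fineK// ge0_fin_numE//.
by apply: le_lt_trans fD; apply: le_measure; rewrite ?inE//; exact: measurableI.
Qed.

Let wt_fiber (Y Z : choiceType) (h : Y -> Z) (p : T -> Y) z : simple_fun p ->
  wt ((h \o p) @^-1` [set z]) =
  \sum_(y \in range p) (if h y == z then wt (p @^-1` [set y]) else 0).
Proof.
move=> sp; have [fp mp] := sp; apply: EFin_inj.
rewrite -wtE; last by case: (simple_fun_comp h sp).
pose F y := D `&` p @^-1` [set y].
pose A := range p `&` h @^-1` [set z].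
have -> : D `&` (h \o p) @^-1` [set z] = \big[setU/set0]_(y \in A) F y.
  rewrite fsbig_setU; last exact: finite_setIl.
  apply/seteqP; split=> [t [Dt /= hz]|t [y [_ /= hz] [Dt /= py]]].
    by exists (p t) => //; split => //; exists t.
  by split => //=; rewrite py.
rewrite measure_fsbig; last first.
- by move=> y y' _ _ [t [[_ /= <-] [_ /= <-]]].
- by move=> y _; exact: measurableI.
- exact: finite_setIl.
rewrite /A fsbig_mkcondr !fsbig_finite//= -sumEFin.
apply: eq_bigr => y _; rewrite /F wtE//.
by case: eqP => [hy|hy]; [rewrite mem_set|rewrite memNset].
Qed.

(** The integral of a simple function can be computed over any finer finite
    partition; additivity and all later identities come from this. *)
Lemma simple_integral_comp (X : completeNormedModType R) (Y : choiceType)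
    (h : Y -> X) (p : T -> Y) : simple_fun p ->
  simple_integral mu D (h \o p) =
  \sum_(y \in range p) fine (mu (D `&` p @^-1` [set y])) *: h y.
Proof.
move=> sp; have [fp mp] := sp; have [fhp mhp] := simple_fun_comp h sp.
rewrite /simple_integral -(@fsbig_widen _ _ _ _ (range (h \o p)) setT)//; last first.
  move=> x [_ nx] /=; rewrite preimage10 ?setI0 ?measure0 ?scale0r//.
rewrite !fsbig_finite//=.
under eq_bigr do rewrite -/(wt _) wt_fiber// fsbig_finite//= scaler_suml.
rewrite exchange_big/= [LHS]big_seq [RHS]big_seq; apply: eq_bigr => y.
rewrite in_fset_set// inE => -[t _ <-].
rewrite (bigD1_seq (h (p t)))/= ?finmap.fset_uniq//; last first.
  by rewrite in_fset_set// inE; exists t.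
rewrite eqxx big1 ?addr0// => x; rewrite eq_sym => /negPf ->.
by rewrite scale0r.
Qed.

Lemma simple_integral_real (Y : choiceType) (phi : Y -> R) (p : T -> Y) :
  simple_fun p -> (forall y, 0 <= phi y) ->
  (\int[mu]_(t in D) (phi (p t))%:E)%E =
  (\sum_(y \in range p) fine (mu (D `&` p @^-1` [set y])) * phi y)%:E.
Proof.
move=> sp phi0; have [fp mp] := sp.
pose g y t : \bar R := ((phi y)%:E * (\1_(p @^-1` [set y]) t)%:E)%E.
have gE t : (phi (p t))%:E = (\sum_(y <- finmap.enum_fset (fset_set (range p))) g y t)%R.
  rewrite (bigD1_seq (p t))/= ?finmap.fset_uniq//; last first.
    by rewrite in_fset_set// inE; exists t.
  rewrite big1 ?addr0; first by rewrite /g indicE mem_set// mule1.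
  by move=> y ynt; rewrite /g indicE memNset ?mule0// => /= yE; move: ynt; rewrite -yE eqxx.
have mi y : measurable_fun D (fun t => (\1_(p @^-1` [set y]) t)%:E : \bar R).
  by apply/measurable_EFinP; exact: measurable_indic.
rewrite fsbig_finite//=.
under eq_integral do rewrite gE.
rewrite ge0_integral_sum//; last first.
- by move=> y t _; rewrite /g mule_ge0 ?lee_fin.
- by move=> y; apply: measurable_funeM; exact: mi.
rewrite -sumEFin; apply: eq_bigr => y _.
rewrite /g ge0_integralZl// ?lee_fin//.
by rewrite integral_indic// setIC wtE// mulrC.
Qed.

End simple_functions.

Section lower_integral.
Import HBNNSimple.
Context d (T : measurableType d) (R : realType) (mu : {measure set T -> \bar R}).
Local Open Scope ereal_scope.

(** The integral of a nonnegative function is a supremum over the measurable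
    simple functions below it; hence it ignores null sets without any
    measurability of the function. *)
Lemma ae_le_integral (D : set T) (f g : T -> \bar R) : measurable D ->
  (forall t, 0 <= f t) -> (forall t, 0 <= g t) ->
  (\forall t \ae mu, D t -> f t <= g t) ->
  \int[mu]_(t in D) f t <= \int[mu]_(t in D) g t.
Proof.
move=> mD f0 g0 [N [mN N0 sN]].
have r0 (u : T -> \bar R) : (forall t, 0 <= u t) -> forall t, 0 <= (u \_ D) t.
  by move=> u0 t; rewrite patchE; case: ifP.
rewrite integral_mkcond [leRHS]integral_mkcond !ge0_integralTE; [|exact: r0..].
apply: ge_ereal_sup => _ [h /= hf <-].
pose h' := proj_nnsfun h (measurableC mN).
have h'E t : h' t = (h t * \1_(~` N) t)%R by [].
have -> : sintegral mu h = sintegral mu h'.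
  rewrite -!integralT_nnsfun; apply: ge0_ae_eq_integral => //.
    exact/measurable_EFinP.
    exact/measurable_EFinP.
    by move=> t _; rewrite lee_fin.
    by move=> t _; rewrite h'E lee_fin mulr_ge0.
    exists N; split => // t ht; apply: contrapT => Nt; apply: ht => _.
    by rewrite h'E indicE mem_set// mulr1.
apply: ereal_sup_ubound; exists h'; last by [].
move=> t; rewrite h'E indicE; have := hf t; rewrite !patchE.
case: ifPn => [/set_mem Dt hft|_].
  have [/set_mem Nt|Nt] := boolP (t \in ~` N); last by rewrite mulr0.
  rewrite mulr1 (le_trans hft)//; apply: contrapT => nfg; apply: Nt.
  by apply: sN => /= /(_ Dt).
by rewrite -[point]/(0%E) !lee_fin => h0; rewrite mulr_le0_ge0.
Qed.

Lemma ae_eq_integral_ge0 (D : set T) (f g : T -> \bar R) : measurable D ->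
  (forall t, 0 <= f t) -> (forall t, 0 <= g t) ->
  (\forall t \ae mu, D t -> f t = g t) ->
  \int[mu]_(t in D) f t = \int[mu]_(t in D) g t.
Proof.
move=> mD f0 g0 fg; apply/eqP; rewrite eq_le; apply/andP; split;
  by apply: ae_le_integral => //; apply: filterS fg => t h Dt; rewrite h.
Qed.

End lower_integral.

Section strong_measurability.
Context d (T : measurableType d) (R : realType) (mu : {measure set T -> \bar R}).

(** Pointwise limits of simple functions serve for constructions, functions
    with measurable distances to each point are stable under pointwise limits,
    and the two notions agree in a separable space. *)
Definition simple_limit (X : normedModType R) (f : T -> X) :=
  exists2 s : nat -> T -> X, forall n, simple_fun (s n) &
    forall t, s n t @[n --> \oo] --> f t.

Definition dist_measurable (X : normedModType R) (f : T -> X) :=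
  forall x, measurable_fun setT (fun t => `|f t - x| : R).

Lemma simple_dist_measurable (X : normedModType R) (p : T -> X) :
  simple_fun p -> dist_measurable p.
Proof. by move=> sp x; exact: (simple_fun_measurable (fun y => `|y - x|)). Qed.

Lemma lim_dist_measurable (X : normedModType R) (u : nat -> T -> X) (f : T -> X) :
  (forall n, dist_measurable (u n)) -> (forall t, u n t @[n --> \oo] --> f t) ->
  dist_measurable f.
Proof.
move=> mu_ uf x; apply: (measurable_fun_cvg (h := fun n t => `|u n t - x|)).
  by move=> n; exact: mu_.
by move=> t _; apply: cvg_norm; apply: cvgB (uf t) _; exact: cvg_cst.
Qed.

Lemma simple_limit_dist (X : normedModType R) (f : T -> X) :
  simple_limit f -> dist_measurable f.
Proof.
move=> [s ss sf]; apply: lim_dist_measurable sf => n.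
exact: simple_dist_measurable.
Qed.

Lemma simple_limit_norm (X : normedModType R) (f : T -> X) :
  simple_limit f -> measurable_fun setT (fun t => `|f t| : R).
Proof.
move=> /simple_limit_dist /(_ 0).
by apply: eq_measurable_fun => t _; rewrite subr0.
Qed.

Lemma simple_limit_indic (X : normedModType R) (A : set T) (f : T -> X) :
  measurable A -> simple_limit f ->
  simple_limit (fun t => if t \in A then f t else 0).
Proof.
move=> mA [s ss sf].
exists (fun n t => if t \in A then s n t else 0) => [n|t]; last first.
  by case: ifP => _; [exact: sf|exact: cvg_cst].
rewrite (_ : (fun t => _) =
    (fun p : bool * X => if p.1 then p.2 else 0) \o (fun t => (if t \in A then true else false, s n t))).
  exact/simple_fun_comp/simple_fun_pair/ss/simple_fun_indic.
by apply/funext => t /=; case: ifP.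
Qed.

End strong_measurability.

Section separable.
Context d (T : measurableType d) (R : realType) (mu : {measure set T -> \bar R}).
Context (X : normedModType R).
Hypothesis sepX : exists2 S : set X, countable S & dense S.

Lemma dense_sequence : exists2 e : nat -> X, e 0%N = 0 &
  forall x (eps : R), 0 < eps -> exists k, `|x - e k| < eps.
Proof.
have [S cS dS] := sepX.
have [s0 Ss0] : S !=set0.
  by have [x [_ Sx]] := dS setT (ex_intro _ 0 I) openT; exists x.
have /countable_injP[f injf] := cS.
pose e k := if k is n.+1 then xget s0 [set x | S x /\ f x = n] else 0.
exists e => // x eps eps0.
have [y [yx Sy]] := dS (ball x eps) (ex_intro _ x (ballxx x eps0)) (ball_open x eps).
exists (f y).+1; rewrite /e.
case: xgetP => [z -> [Sz /(injf _ _ (mem_set Sz) (mem_set Sy)) ->]|].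
  by move: yx; rewrite -ball_normE.
by move=> /(_ y) [].
Qed.

(** The nearest point to [f t] among the first terms of a dense sequence is a
    simple function of [t]. *)
Lemma dist_measurable_approx (f : T -> X) : dist_measurable f ->
  exists s : nat -> T -> X, [/\ forall n, simple_fun (s n),
    forall t, s n t @[n --> \oo] --> f t &
    forall n t, `|f t - s n t| <= `|f t| ].
Proof.
move=> mf; have [e e0 de] := dense_sequence.
pose idx := fix idx n t : nat := if n is m.+1 then
  if `|f t - e m.+1| < `|f t - e (idx m t)| then m.+1 else idx m t else 0%N.
pose D n t : R := `|f t - e (idx n t)|.
have DS n t : D n.+1 t = Num.min `|f t - e n.+1| (D n t).
  by rewrite /D /= /Num.min; case: ifP.
have mD n : measurable_fun setT (D n).
  elim: n => [|n IH]; first exact: (mf (e 0%N)).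
  have -> : D n.+1 = (fun t => Num.min `|f t - e n.+1| (D n t)).
    by apply/funext => t; rewrite DS.
  by apply: measurable_minr => //; exact: mf.
have si n : simple_fun (idx n).
  elim: n => [|n IH].
    have := @simple_fun_indic _ T nat setT 0%N 0%N measurableT.
    by congr simple_fun; apply/funext => t /=; case: ifP.
  pose A := [set t | `|f t - e n.+1| < D n t].
  have mA : measurable A.
    have := measurable_fun_ltr (mf (e n.+1)) (mD n) measurableT (Y := [set true]) I.
    by rewrite setTI; congr measurable; apply/seteqP; split=> t /=.
  rewrite (_ : idx n.+1 = (fun p : bool * nat => if p.1 then n.+1 else p.2) \o
     (fun t => (if t \in A then true else false, idx n t))).
    exact/simple_fun_comp/simple_fun_pair/IH/simple_fun_indic.
  apply/funext => t /=; case: ifPn => h; first by rewrite mem_set.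
  by rewrite memNset//; exact/negP.
have Dle n k t : (k <= n)%N -> D n t <= `|f t - e k|.
  elim: n => [|n IH]; first by rewrite leqn0 => /eqP ->.
  rewrite leq_eqVlt DS => /orP[/eqP ->|kn]; first by rewrite ge_min lexx.
  by rewrite ge_min IH ?orbT.
exists (fun n t => e (idx n t)); split => [n|t|n t].
- exact: (simple_fun_comp e (si n)).
- apply/cvgn_distP => eps /(de (f t))[k hk]; exists k => n kn.
  by rewrite distrC; apply: le_lt_trans hk; exact: Dle.
- by have := Dle n 0%N t (leq0n n); rewrite e0 subr0.
Qed.

Lemma dist_measurable_simple_limit (f : T -> X) :
  dist_measurable f -> simple_limit f.
Proof. by move=> /dist_measurable_approx[s [ss sf _]]; exists s. Qed.

End separable.

Section almost_everywhere.
Context d (T : measurableType d) (R : realType) (mu : {measure set T -> \bar R}).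
Implicit Types P Q : T -> Prop.

Lemma ae_imp P Q : (forall t, P t -> Q t) ->
  (\forall t \ae mu, P t) -> \forall t \ae mu, Q t.
Proof. exact: filterS. Qed.

Lemma ae_imp2 P1 P2 Q : (forall t, P1 t -> P2 t -> Q t) ->
  (\forall t \ae mu, P1 t) -> (\forall t \ae mu, P2 t) -> \forall t \ae mu, Q t.
Proof. by move=> h h1 h2; exact: filterS2 h1 h2. Qed.

Lemma ae_all P : (forall t, P t) -> \forall t \ae mu, P t.
Proof. exact: nearW. Qed.

End almost_everywhere.

Section ae_representatives.
Context d (T : measurableType d) (R : realType) (mu : {measure set T -> \bar R}).
Context (D : set T) (mD : measurable D).

Lemma ae_measurable_null (P : T -> Prop) : (\forall t \ae mu, P t) ->
  exists N, [/\ measurable N, mu N = 0 & forall t, ~ N t -> P t].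
Proof.
move=> [N [mN N0 sN]]; exists N; split => // t Nt.
by apply: contrapT => nP; apply: Nt; exact: sN.
Qed.

Lemma ae_null (N : set T) : measurable N -> mu N = 0%E ->
  \forall t \ae mu, ~ N t.
Proof. by move=> mN N0; exists N; split => // t /=; exact: contrapT. Qed.

Lemma strongly_measurableP (X : completeNormedModType R) (f : T -> X) :
  strongly_measurable mu D f <->
  exists2 g, simple_limit g & \forall t \ae mu, D t -> f t = g t.
Proof.
split=> [[s [ss sf]]|[g [s ss sg] fg]]; last first.
  by exists s; split => //; apply: filterS fg => t h Dt; rewrite h.
have [N [mN N0 hN]] := ae_measurable_null sf.
pose A := D `&` ~` N; have mA : measurable A.
  by apply: measurableI => //; exact: measurableC.
exists (fun t => if t \in A then f t else 0).
  exists (fun n t => if t \in A then s n t else 0) => [n|t].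
    rewrite (_ : (fun t => _) = (fun p : bool * X => if p.1 then p.2 else 0) \o
      (fun t => (if t \in A then true else false, s n t))).
      exact/simple_fun_comp/simple_fun_pair/ss/simple_fun_indic.
    by apply/funext => t /=; case: ifP.
  case: ifPn => [/set_mem [Dt Nt]|_]; last exact: cvg_cst.
  exact: hN.
by apply: filterS (ae_null mN N0) => t Nt Dt; rewrite mem_set.
Qed.

Lemma strongly_measurable_lim (X : completeNormedModType R)
    (u : nat -> T -> X) (f : T -> X) :
  (exists2 S : set X, countable S & dense S) ->
  (forall n, strongly_measurable mu D (u n)) ->
  (\forall t \ae mu, D t -> u n t @[n --> \oo] --> f t) ->
  strongly_measurable mu D f.
Proof.
move=> sepX su uf; apply/strongly_measurableP.
have gex n : exists g, simple_limit g /\ \forall t \ae mu, D t -> u n t = g t.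
  by have /strongly_measurableP[g sg ug] := su n; exists g.
have [g gP] := choice gex.
have /ae_foralln ug : forall n, \forall t \ae mu, D t -> u n t = g n t.
  by move=> n; case: (gP n).
have [N [mN N0 hN]] := ae_measurable_null (filterI uf ug).
pose A := D `&` ~` N; have mA : measurable A.
  by apply: measurableI => //; exact: measurableC.
exists (fun t => if t \in A then f t else 0); last first.
  by apply: filterS (ae_null mN N0) => t Nt Dt; rewrite mem_set.
apply: (@dist_measurable_simple_limit _ T R X sepX).
apply: (@lim_dist_measurable _ _ _ _ (fun n t => if t \in A then g n t else 0)).
  move=> n; apply: simple_limit_dist; apply: simple_limit_indic => //.
  by case: (gP n).
move=> t; case: ifPn => [/set_mem [Dt /hN [+ gE]]|_]; last exact: cvg_cst.
move=> /(_ Dt); rewrite (_ : u ^~ t = g ^~ t)//.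
by apply/funext => n; exact: gE.
Qed.

Lemma strongly_measurable_ae (X : completeNormedModType R) (f g : T -> X) :
  (\forall t \ae mu, D t -> f t = g t) -> strongly_measurable mu D g ->
  strongly_measurable mu D f.
Proof.
move=> fg [s [ss sg]]; exists s; split => //.
by apply: filterS2 fg sg => t h1 h2 Dt; rewrite h1//; exact: h2.
Qed.

Lemma strongly_measurable_comp (X Y : completeNormedModType R) (h : X -> Y)
    (f : T -> X) : continuous h -> strongly_measurable mu D f ->
  strongly_measurable mu D (fun t => h (f t)).
Proof.
move=> ch [s [ss sf]]; exists (fun n t => h (s n t)); split => [n|].
  exact: (simple_fun_comp h (ss n)).
by apply: filterS sf => t st Dt; apply: cvgn_map ch _; exact: st.
Qed.

Lemma strongly_measurableD (X : completeNormedModType R) (f g : T -> X) :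
  strongly_measurable mu D f -> strongly_measurable mu D g ->
  strongly_measurable mu D (fun t => f t + g t).
Proof.
move=> [s [ss sf]] [r [sr rg]]; exists (fun n t => s n t + r n t); split => [n|].
  exact: (simple_fun_comp (fun p => p.1 + p.2) (simple_fun_pair (ss n) (sr n))).
by apply: filterS2 sf rg => t st rt Dt; apply: cvgD; [exact: st|exact: rt].
Qed.

Lemma strongly_measurableN (X : completeNormedModType R) (f : T -> X) :
  strongly_measurable mu D f -> strongly_measurable mu D (fun t => - f t).
Proof. exact: strongly_measurable_comp (@oppr_continuous _ _). Qed.

Lemma strongly_measurableB (X : completeNormedModType R) (f g : T -> X) :
  strongly_measurable mu D f -> strongly_measurable mu D g ->
  strongly_measurable mu D (fun t => f t - g t).
Proof.
by move=> mf mg; apply: strongly_measurableD => //; exact: strongly_measurableN.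
Qed.

Lemma strongly_measurableZ (X : completeNormedModType R) (a : T -> R) (f : T -> X) :
  strongly_measurable mu D (a : T -> R^o) -> strongly_measurable mu D f ->
  strongly_measurable mu D (fun t => a t *: f t).
Proof.
move=> [s [ss sf]] [r [sr rg]]; exists (fun n t => s n t *: r n t); split => [n|].
  exact: (simple_fun_comp (fun p : R * X => p.1 *: p.2) (simple_fun_pair (ss n) (sr n))).
by apply: filterS2 sf rg => t st rt Dt; apply: cvgZ; [exact: st|exact: rt].
Qed.

Lemma strongly_measurable_cst (X : completeNormedModType R) (x : X) :
  strongly_measurable mu D (fun=> x).
Proof.
exists (fun _ _ => x); split => [n|]; last first.
  by apply: nearW => t _; exact: cvg_cst.
have := @simple_fun_indic _ T X setT x x measurableT.
by congr simple_fun; apply/funext => t /=; case: ifP.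
Qed.

(** If [s n] are simple functions converging to [f], the functions [phi t (s n
    t)] are measurable piece by piece and converge to [phi t (f t)] by
    continuity. *)
Lemma strongly_measurable_caratheodory (X Y : completeNormedModType R)
    (phi : T -> X -> Y) (f : T -> X) :
  (exists2 S : set Y, countable S & dense S) ->
  (forall x, strongly_measurable mu D (phi ^~ x)) ->
  (forall t, D t -> continuous (phi t)) ->
  strongly_measurable mu D f -> strongly_measurable mu D (fun t => phi t (f t)).
Proof.
move=> sepY mphi cphi [s [ss sf]].
apply: (@strongly_measurable_lim _ (fun n t => phi t (s n t))) => //; last first.
  by apply: filterS sf => t st Dt; apply: cvgn_map (cphi t Dt) _; exact: st.
move=> n; have [fs ms] := ss n.
pose F x t := (if t \in s n @^-1` [set x] then 1 else 0 : R) *: phi t x.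
have mF x : strongly_measurable mu D (F x).
  apply: strongly_measurableZ (mphi x).
  exists (fun _ t => if t \in s n @^-1` [set x] then 1 else 0); split => [_|].
    exact: (@simple_fun_indic _ T R).
  by apply: nearW => t _; exact: cvg_cst.
have -> : (fun t => phi t (s n t)) =
    (fun t => \sum_(x <- finmap.enum_fset (fset_set (range (s n)))) F x t).
  apply/funext => t; rewrite (bigD1_seq (s n t))/= ?finmap.fset_uniq//; last first.
    by rewrite in_fset_set// inE; exists t.
  rewrite {1}/F mem_set// scale1r big1 ?addr0// => x xs.
  by rewrite /F memNset ?scale0r// => /= xE; move: xs; rewrite -xE eqxx.
elim: (finmap.enum_fset _) => [|x r IH].
  under eq_fun do rewrite big_nil; exact: strongly_measurable_cst.
by under eq_fun do rewrite big_cons; exact: strongly_measurableD.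
Qed.

End ae_representatives.

Lemma strongly_measurable_subset d (T : measurableType d) (R : realType)
    (mu : {measure set T -> \bar R}) (X : completeNormedModType R)
    (D D' : set T) (f : T -> X) : D' `<=` D ->
  strongly_measurable mu D f -> strongly_measurable mu D' f.
Proof.
move=> DD' [s [ss sf]]; exists s; split => //.
by apply: filterS sf => t h /DD'.
Qed.

Lemma sum_additive (U V : nmodType) (T : U -> V) (I : Type) (r : seq I) (F : I -> U) :
  T 0 = 0 -> (forall x y, T (x + y) = T x + T y) ->
  T (\sum_(i <- r) F i) = \sum_(i <- r) T (F i).
Proof. by move=> T0 TD; apply: (big_morph T TD T0). Qed.

Record bounded_linear (R : realType) (X Y : normedModType R) (T : X -> Y) : Prop :=
  BoundedLinear {
  bl_sub : forall x y, T (x - y) = T x - T y;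
  bl_scale : forall (a : R) x, T (a *: x) = a *: T x;
  bl_bound : exists2 C : R, 0 <= C & forall x, `|T x| <= C * `|x| }.

Section bounded_linear_theory.
Context (R : realType) (X Y : normedModType R) (T : X -> Y).
Hypothesis blT : bounded_linear T.

Lemma bl0 : T 0 = 0.
Proof. by rewrite -(subrr (0 : X)) (bl_sub blT) subrr. Qed.

Lemma bl_opp x : T (- x) = - T x.
Proof. by rewrite -sub0r (bl_sub blT) bl0 sub0r. Qed.

Lemma bl_add x y : T (x + y) = T x + T y.
Proof. by rewrite -{1}[y]opprK (bl_sub blT) bl_opp opprK. Qed.

Lemma bl_continuous : continuous T.
Proof. by have [C _] := bl_bound blT; exact: lin_continuous (bl_sub blT). Qed.

Lemma bl_cvg (u : nat -> X) (l : X) :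
  u n @[n --> \oo] --> l -> T (u n) @[n --> \oo] --> T l.
Proof. exact: cvgn_map bl_continuous. Qed.

End bounded_linear_theory.

Lemma bounded_linear_comp (R : realType) (X Y Z : normedModType R)
    (T : X -> Y) (S : Y -> Z) :
  bounded_linear T -> bounded_linear S -> bounded_linear (fun x => S (T x)).
Proof.
move=> bT bS; split=> [x y|a x|].
- by rewrite (bl_sub bT) (bl_sub bS).
- by rewrite (bl_scale bT) (bl_scale bS).
- have [C C0 hC] := bl_bound bT; have [C' C'0 hC'] := bl_bound bS.
  exists (C' * C) => [|x]; first exact: mulr_ge0.
  by rewrite (le_trans (hC' _))// -mulrA ler_wpM2l.
Qed.

Section has_integral.
Context d (T : measurableType d) (R : realType) (mu : {measure set T -> \bar R}).
Context (D : set T) (mD : measurable D) (fD : (mu D < +oo)%E).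
Implicit Types X Y : completeNormedModType R.

Definition has_int X (f : T -> X) (I : X) := exists2 s : nat -> T -> X,
  bochner_approx mu D f s & simple_integral mu D (s n) @[n --> \oo] --> I.

Let nint X (f : T -> X) : \bar R := (\int[mu]_(t in D) (`|f t|)%:E)%E.

Lemma nint_ge0 X (f : T -> X) : (0 <= nint f)%E.
Proof. by apply: integral_ge0 => t _; rewrite lee_fin. Qed.

Lemma nint_le X Y (f : T -> X) (g : T -> Y) :
  (\forall t \ae mu, D t -> `|f t| <= `|g t|) -> (nint f <= nint g)%E.
Proof.
by move=> fg; exact: ae_le_integral.
Qed.

Lemma nint_eq X (f g : T -> X) :
  (\forall t \ae mu, D t -> f t = g t) -> nint f = nint g.
Proof.
by move=> fg; apply/eqP; rewrite eq_le; apply/andP; split;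
  apply: nint_le; apply: filterS fg => t h Dt; rewrite h.
Qed.

Lemma nint_triangle X Y (Z : completeNormedModType R) (u : T -> X) (v : T -> Y) (w : T -> Z) :
  strongly_measurable mu D u -> strongly_measurable mu D v ->
  (\forall t \ae mu, D t -> `|w t| <= `|u t| + `|v t|) ->
  (nint w <= nint u + nint v)%E.
Proof.
move=> /(strongly_measurableP mu mD)[u' su' uu'] /(strongly_measurableP mu mD)[v' sv' vv'] wuv.
have mu' : measurable_fun D (fun t => (`|u' t|)%:E).
  by apply/measurable_EFinP; apply: measurable_funTS; exact: simple_limit_norm.
have mv' : measurable_fun D (fun t => (`|v' t|)%:E).
  by apply/measurable_EFinP; apply: measurable_funTS; exact: simple_limit_norm.
rewrite (nint_eq uu') (nint_eq vv') /nint -ge0_integralD//.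
apply: ae_le_integral => // [t|]; first by rewrite -EFinD lee_fin addr_ge0.
apply: filterS3 uu' vv' wuv => t hu hv h Dt.
by rewrite -EFinD lee_fin -hu// -hv//; exact: h.
Qed.

Lemma nint_scale X Y (u : T -> X) (w : T -> Y) (C : R) : 0 <= C ->
  strongly_measurable mu D u ->
  (\forall t \ae mu, D t -> `|w t| <= C * `|u t|) ->
  (nint w <= C%:E * nint u)%E.
Proof.
move=> C0 /(strongly_measurableP mu mD)[u' su' uu'] wu.
have mu' : measurable_fun D (fun t => (`|u' t|)%:E).
  by apply/measurable_EFinP; apply: measurable_funTS; exact: simple_limit_norm.
rewrite (nint_eq uu') /nint -ge0_integralZl//.
apply: ae_le_integral => // [t|]; first by rewrite -EFinM lee_fin mulr_ge0.
apply: filterS2 uu' wu => t hu h Dt.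
by rewrite -EFinM lee_fin -hu//; exact: h.
Qed.

Lemma wt_finite (A : set T) : measurable A -> (mu (D `&` A) < +oo)%E.
Proof.
by move=> mA; apply: le_lt_trans fD; apply: le_measure; rewrite ?inE//; exact: measurableI.
Qed.

Lemma nint_simple X (s : T -> X) : simple_fun s -> (nint s < +oo)%E.
Proof.
move=> ss; rewrite /nint.
by rewrite (simple_integral_real mD fD (phi := fun x : X => `|x|) ss)// ltry.
Qed.

Lemma simple_integralB X (s r : T -> X) : simple_fun s -> simple_fun r ->
  (`|simple_integral mu D s - simple_integral mu D r|%:E <=
    nint (fun t => s t - r t)%R)%E.
Proof.
move=> ss sr; have sp := simple_fun_pair ss sr; have [fp _] := sp.
rewrite /nint (simple_integral_real mD fD (phi := fun p : X * X => `|p.1 - p.2|) sp)//.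
have -> : s = fst \o (fun t => (s t, r t)) by [].
rewrite (simple_integral_comp mD fD _ sp).
have -> : r = snd \o (fun t => (s t, r t)) by [].
rewrite [simple_integral _ _ (snd \o _)](simple_integral_comp mD fD _ sp).
rewrite !fsbig_finite//= -sumrB lee_fin (le_trans (ler_norm_sum _ _ _))//.
apply: ler_sum => p _; rewrite -scalerBr normrZ ger0_norm//.
Qed.

Lemma approx_simple X (f : T -> X) s : bochner_approx mu D f s ->
  forall n, simple_fun (s n).
Proof. by move=> [ss _ _ _]. Qed.

Lemma approx_measurable X (f : T -> X) s : bochner_approx mu D f s ->
  strongly_measurable mu D f.
Proof. by move=> [ss _ sf _]; exists s. Qed.

Lemma simple_measurable X (s : T -> X) : simple_fun s -> strongly_measurable mu D s.
Proof. by move=> ss; exists (fun=> s); split => //; apply: nearW => t _; exact: cvg_cst. Qed.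

Lemma cvg0_small (u : nat -> \bar R) : (forall n, 0 <= u n)%E ->
  u n @[n --> \oo] --> 0%E <->
  (forall eps : R, 0 < eps -> exists N, forall n, (N <= n)%N -> (u n < eps%:E)%E).
Proof.
move=> u0; split=> [/fine_cvgP[[M _ hM] /cvgrPdist_lt h] eps /h[N _ hN]|h].
  exists (maxn M N) => n; rewrite geq_max => /andP[Mn Nn].
  rewrite -(@fineK _ (u n)) ?hM// lte_fin.
  by have := hN n Nn; rewrite /= sub0r normrN; apply: le_lt_trans; exact: ler_norm.
have fu n : (u n < +oo)%E -> u n \is a fin_num by move=> ?; rewrite ge0_fin_numE.
apply/fine_cvgP; split.
  have [N hN] := h 1 ltr01; exists N => // n /hN un.
  by apply: fu; apply: (lt_trans un); rewrite ltry.
apply/cvgrPdist_lt => eps /h[N hN]; exists N => // n /hN un /=.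
have fun_ : u n \is a fin_num by apply: fu; apply: (lt_trans un); rewrite ltry.
by rewrite sub0r normrN ger0_norm ?fine_ge0// -lte_fin fineK.
Qed.

(** On a set of finite measure the condition on the supports holds for every
    simple function. *)
Lemma bochner_approxP X (f : T -> X) s : (forall n, simple_fun (s n)) ->
  (\forall t \ae mu, D t -> s n t @[n --> \oo] --> f t) ->
  (forall eps : R, 0 < eps -> exists N, forall n, (N <= n)%N ->
    (nint (fun t => f t - s n t)%R < eps%:E)%E) ->
  bochner_approx mu D f s.
Proof.
move=> ss sf sm; split => //.
- move=> n x _; apply: wt_finite; by case: (ss n).
- by apply/cvg0_small => // n; exact: nint_ge0.
Qed.

Lemma bochner_approx_small X (f : T -> X) s : bochner_approx mu D f s ->
  forall eps : R, 0 < eps -> exists N, forall n, (N <= n)%N ->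
    (nint (fun t => f t - s n t)%R < eps%:E)%E.
Proof. by move=> [_ _ _ h]; apply/cvg0_small => // n; exact: nint_ge0. Qed.

Lemma has_int_dist X (f g : T -> X) I J : has_int f I -> has_int g J ->
  (`|I - J|%:E <= nint (fun t => f t - g t)%R)%E.
Proof.
move=> [s sa sI] [r ra rJ]; apply/lee_addgt0Pr => eps eps0.
have e4 : 0 < eps / 4 by rewrite divr_gt0.
have [N1 h1] := bochner_approx_small sa e4.
have [N2 h2] := bochner_approx_small ra e4.
have /cvgn_distP/(_ _ e4)[N3 h3] := sI.
have /cvgn_distP/(_ _ e4)[N4 h4] := rJ.
pose n := maxn (maxn N1 N2) (maxn N3 N4).
have n1 : (N1 <= n)%N by rewrite !leq_max leqnn.
have n2 : (N2 <= n)%N by rewrite !leq_max leqnn orbT.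
have n3 : (N3 <= n)%N by rewrite !leq_max leqnn orbT.
have n4 : (N4 <= n)%N by rewrite !leq_max leqnn !orbT.
have {}h1 := h1 n n1; have {}h2 := h2 n n2; have {}h3 := h3 n n3; have {}h4 := h4 n n4.
have ssn : simple_fun (s n) by exact: approx_simple sa _.
have srn : simple_fun (r n) by exact: approx_simple ra _.
have ms := simple_measurable ssn; have mr := simple_measurable srn.
have mf := approx_measurable sa; have mg := approx_measurable ra.
have b1 : (nint (fun t => s n t - r n t)%R <=
    nint (fun t => f t - s n t)%R + nint (fun t => f t - r n t)%R)%E.
  apply: nint_triangle; [exact: strongly_measurableB..|].
  apply: nearW => t _; rewrite (_ : s n t - r n t = - (f t - s n t) + (f t - r n t)).
    by rewrite (le_trans (ler_normD _ _))// normrN.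
  lmod R.
have b2 : (nint (fun t => f t - r n t)%R <=
    nint (fun t => f t - g t)%R + nint (fun t => g t - r n t)%R)%E.
  apply: nint_triangle; [exact: strongly_measurableB..|].
  apply: nearW => t _; rewrite (_ : f t - r n t = (f t - g t) + (g t - r n t)).
    exact: ler_normD.
  lmod R.
have b0 := simple_integralB ssn srn.
set x := simple_integral mu D (s n) in b0 h3.
set y := simple_integral mu D (r n) in b0 h4.
have b3 : `|I - J| <= eps / 4 + `|x - y| + eps / 4.
  rewrite (_ : I - J = - (x - I) + (x - y) + (y - J)); last by lmod R.
  rewrite (le_trans (ler_normD _ _))// lerD//; last exact: ltW.
  by rewrite (le_trans (ler_normD _ _))// lerD// normrN ltW.
apply: (@le_trans _ _ ((eps / 4)%:E + `|x - y|%:E + (eps / 4)%:E)%E).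
  by rewrite -!EFinD lee_fin.
apply: (@le_trans _ _ ((eps / 4)%:E + ((eps / 4)%:E + (nint (fun t => f t - g t)%R + (eps / 4)%:E)) + (eps / 4)%:E)%E).
  apply: leeD => //; apply: leeD => //; apply: (le_trans b0).
  apply: (le_trans b1); apply: leeD; first exact: ltW.
  by apply: (le_trans b2); apply: leeD => //; exact: ltW.
have := nint_ge0 (fun t => f t - g t)%R; case: (nint _) => [z _||//].
  by rewrite -!EFinD lee_fin; lra.
by rewrite leey.
Qed.

Lemma has_int_uniq X (f : T -> X) I J : has_int f I -> has_int f J -> I = J.
Proof.
move=> fI fJ; have := has_int_dist fI fJ.
under [X in (_ <= X)%E]eq_integral do rewrite subrr normr0.
rewrite integral0 lee_fin normr_le0 subr_eq0 => /eqP //.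
Qed.

Lemma has_int_integrable X (f : T -> X) I : has_int f I -> bochner_integrable mu D f.
Proof. by move=> [s sa _]; exists s. Qed.

Lemma has_int_bochner X (f : T -> X) I : has_int f I -> bochner_integral mu D f = I.
Proof.
move=> fI; rewrite /bochner_integral; case: xgetP => [J _ fJ|/(_ I)//].
exact: has_int_uniq fJ fI.
Qed.

Lemma approx_int_cvg X (f : T -> X) s : bochner_approx mu D f s ->
  exists I : X, simple_integral mu D (s n) @[n --> \oo] --> I.
Proof.
move=> sa; apply: cauchy_cvgn => eps eps0.
have e2 : 0 < eps / 2 by rewrite divr_gt0.
have [N h] := bochner_approx_small sa e2; exists N => n Nn.
have ss k : simple_fun (s k) by exact: approx_simple sa _.
have mf := approx_measurable sa.
rewrite -lte_fin (le_lt_trans (simple_integralB (ss n) (ss N)))//.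
apply: (@le_lt_trans _ _ (nint (fun t => f t - s n t)%R + nint (fun t => f t - s N t)%R)%E).
  apply: nint_triangle.
  - by apply: strongly_measurableB => //; exact: simple_measurable.
  - by apply: strongly_measurableB => //; exact: simple_measurable.
  apply: nearW => t _; rewrite (_ : s n t - s N t = - (f t - s n t) + (f t - s N t)).
    by rewrite (le_trans (ler_normD _ _))// normrN.
  lmod R.
by rewrite [eps]splitr EFinD lteD//; exact: h.
Qed.

Lemma integrable_has_int X (f : T -> X) : bochner_integrable mu D f ->
  exists I, has_int f I.
Proof. by move=> [s sa]; have [I sI] := approx_int_cvg sa; exists I, s. Qed.

Lemma has_int_measurable X (f : T -> X) I : has_int f I -> strongly_measurable mu D f.
Proof. by move=> [s sa _]; exact: approx_measurable sa. Qed.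

Lemma has_int_ae X (f g : T -> X) I :
  (\forall t \ae mu, D t -> f t = g t) -> has_int f I -> has_int g I.
Proof.
move=> fg [s sa sI]; exists s => //; apply: bochner_approxP.
- exact: approx_simple sa.
- by case: sa => _ _ sf _; apply: filterS2 fg sf => t h1 h2 Dt; rewrite -h1//; exact: h2.
- move=> eps /(bochner_approx_small sa)[N hN]; exists N => n /hN; apply: le_lt_trans.
  by apply: nint_le; apply: filterS fg => t h Dt; rewrite h.
Qed.

Lemma has_intD X (f g : T -> X) I J : has_int f I -> has_int g J ->
  has_int (fun t => f t + g t) (I + J).
Proof.
move=> [s sa sI] [r ra rJ].
have ss n : simple_fun (s n) by exact: approx_simple sa _.
have sr n : simple_fun (r n) by exact: approx_simple ra _.
have mf := approx_measurable sa; have mg := approx_measurable ra.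
exists (fun n t => s n t + r n t).
  apply: bochner_approxP.
  - move=> n; exact: (simple_fun_comp (fun p => p.1 + p.2) (simple_fun_pair (ss n) (sr n))).
  - case: sa => _ _ sf _; case: ra => _ _ rf _.
    by apply: filterS2 sf rf => t h1 h2 Dt; apply: cvgD; [exact: h1|exact: h2].
  - move=> eps eps0; have e2 : 0 < eps / 2 by rewrite divr_gt0.
    have [N h1] := bochner_approx_small sa e2; have [M h2] := bochner_approx_small ra e2.
    exists (maxn N M) => n; rewrite geq_max => /andP[/h1 {}h1 /h2 {}h2].
    rewrite [eps]splitr EFinD (le_lt_trans _ (lteD h1 h2))//.
    apply: nint_triangle.
    - by apply: strongly_measurableB => //; exact: simple_measurable.
    - by apply: strongly_measurableB => //; exact: simple_measurable.
    apply: nearW => t _; rewrite (_ : f t + g t - _ = (f t - s n t) + (g t - r n t)).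
      exact: ler_normD.
    lmod R.
have SD n : simple_integral mu D (fun t => s n t + r n t) =
    simple_integral mu D (s n) + simple_integral mu D (r n).
  have sp := simple_fun_pair (ss n) (sr n); have [fp _] := sp.
  have := simple_integral_comp mD fD (fun p => p.1 + p.2) sp.
  have := simple_integral_comp mD fD fst sp.
  have := simple_integral_comp mD fD snd sp.
  rewrite !fsbig_finite//= /comp/= => -> -> ->; rewrite -big_split/=.
  by apply: eq_bigr => p _; rewrite scalerDr.
by under eq_fun do rewrite SD; exact: cvgD.
Qed.

Lemma has_int_linear X Y (L : X -> Y) (f : T -> X) I : bounded_linear L ->
  has_int f I -> has_int (fun t => L (f t)) (L I).
Proof.
move=> bL [s sa sI]; have [C C0 hC] := bl_bound bL.
have ss n : simple_fun (s n) by exact: approx_simple sa _.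
have mf := approx_measurable sa.
exists (fun n t => L (s n t)).
  apply: bochner_approxP.
  - by move=> n; exact: (simple_fun_comp L (ss n)).
  - by case: sa => _ _ sf _; apply: filterS sf => t h Dt; apply: bl_cvg => //; exact: h.
  - move=> eps eps0; have e2 : 0 < eps / (C + 1) by rewrite divr_gt0// ltr_wpDl.
    have [N h] := bochner_approx_small sa e2; exists N => n /h {}h.
    apply: (@le_lt_trans _ _ ((C + 1)%:E * nint (fun t => f t - s n t)%R)%E).
      apply: nint_scale; first by rewrite addr_ge0.
        by apply: strongly_measurableB => //; exact: simple_measurable.
      apply: nearW => t _; rewrite -(bl_sub bL) (le_trans (hC _))//.
      by rewrite ler_wpM2r// lerDl.
    rewrite -lte_pdivlMl ?ltr_wpDl//; apply: (lt_le_trans h).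
    by rewrite -EFinM lee_fin mulrC.
have SL n : simple_integral mu D (fun t => L (s n t)) = L (simple_integral mu D (s n)).
  have [fp _] := ss n.
  have := simple_integral_comp mD fD L (ss n).
  have := simple_integral_comp mD fD id (ss n).
  rewrite !fsbig_finite//= /comp/= => -> ->.
  rewrite (sum_additive _ _ (bl0 bL) (bl_add bL)).
  by apply: eq_bigr => p _; rewrite (bl_scale bL).
by under eq_fun do rewrite SL; exact: bl_cvg.
Qed.

Lemma has_intN X (f : T -> X) I : has_int f I -> has_int (fun t => - f t) (- I).
Proof.
apply: (@has_int_linear _ _ -%R); split => [x y|a x|].
- by rewrite opprD.
- by rewrite scalerN.
- by exists 1 => // x; rewrite normrN mul1r.
Qed.

Lemma has_intB X (f g : T -> X) I J : has_int f I -> has_int g J ->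
  has_int (fun t => f t - g t) (I - J).
Proof. by move=> fI gJ; apply: has_intD => //; exact: has_intN. Qed.

Lemma has_intZ X (a : R) (f : T -> X) I : has_int f I ->
  has_int (fun t => a *: f t) (a *: I).
Proof.
apply: (@has_int_linear _ _ ( *:%R a)); split => [x y|b x|].
- by rewrite scalerBr.
- by rewrite !scalerA mulrC.
- by exists `|a| => // x; rewrite normrZ.
Qed.

Lemma has_int_norm X (f : T -> X) I : has_int f I ->
  (`|I|%:E <= \int[mu]_(t in D) (`|f t|)%:E)%E.
Proof.
move=> fI; have f0 : has_int (fun t => 0 : X) 0.
  have := has_intB fI fI; rewrite subrr; apply: has_int_ae.
  by apply: nearW => t _; rewrite subrr.
have := has_int_dist fI f0; rewrite subr0.
rewrite (_ : nint (fun t => f t - 0)%R = nint f)//.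
by apply: nint_eq; apply: nearW => t _; rewrite subr0.
Qed.

Lemma has_int_finite X (f : T -> X) I : has_int f I ->
  (\int[mu]_(t in D) (`|f t|)%:E < +oo)%E.
Proof.
move=> [s sa sI]; have [N /(_ N (leqnn N)) hN] := bochner_approx_small sa ltr01.
have ss n : simple_fun (s n) by exact: approx_simple sa _.
apply: (@le_lt_trans _ _ (nint (fun t => f t - s N t)%R + nint (s N))%E).
  apply: nint_triangle; last first.
  - by apply: nearW => t _; rewrite -{1}(subrK (s N t) (f t)) ler_normD.
  - exact: simple_measurable.
  apply: strongly_measurableB; first exact: approx_measurable sa.
  exact: simple_measurable.
apply: lte_add_pinfty; [exact: lt_trans hN (ltry _)|exact: nint_simple].
Qed.

End has_integral.

Section has_integral_limits.
Context d (T : measurableType d) (R : realType) (mu : {measure set T -> \bar R}).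
Context (D : set T) (mD : measurable D) (fD : (mu D < +oo)%E).
Context (X : completeNormedModType R).
Hypothesis sepX : exists2 S : set X, countable S & dense S.
Implicit Types (f g : T -> X) (I J : X).

Local Notation nint f := (\int[mu]_(t in D) (`|f t|)%:E)%E.

(** Replacing each value of the approximating simple functions by an almost
    nearest point of the cone at most triples the error, and the simple
    integrals so obtained lie in the cone. *)
Lemma has_int_cone (K : set X) f I : closed K -> K 0 ->
  (forall x y, K x -> K y -> K (x + y)) ->
  (forall (a : R) x, 0 <= a -> K x -> K (a *: x)) ->
  (\forall t \ae mu, D t -> K (f t)) -> has_int mu D f I -> K I.
Proof.
move=> cK K0 KD KZ Kf [s sa sI].
have near_point x : exists y, K y /\ forall z, K z -> `|x - y| <= 2 * `|x - z|.
  have [Kx|nKx] := pselect (K x).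
    by exists x; split => // z _; rewrite subrr normr0 mulr_ge0.
  pose A := [set `|x - z| | z in K].
  have hA : has_inf A.
    split; first by exists `|x - 0|; exists 0.
    by exists 0 => _ [z _ <-].
  have i0 : 0 < inf A.
    rewrite lt_neqAle lb_le_inf//; last 2 first.
    - by exists `|x - 0|; exists 0.
    - by move=> _ [z _ <-].
    rewrite andbT; apply: contra_notN nKx => /eqP i0; apply: cK.
    move=> B /nbhs_ballP[eps /= eps0 xB].
    have [_ [z Kz <-]] := inf_adherent eps0 hA.
    by rewrite -i0 add0r => xz; exists z; split => //; apply: xB; rewrite -ball_normE.
  have [_ [y Ky <-] xy] := inf_adherent i0 hA.
  exists y; split => // z Kz; apply: (le_trans (ltW xy)).
  rewrite mulr2n mulrDl mul1r.
  have h : inf A <= `|x - z| by apply: ge_inf; [by case: hA|exists z].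
  by rewrite lerD.
have [k kP] := choice near_point.
have ss n : simple_fun (s n) by exact: approx_simple sa n.
have sk n : simple_fun (fun t => k (s n t)) by exact: (simple_fun_comp k (ss n)).
have mf := approx_measurable sa.
have skI : simple_integral mu D (fun t => k (s n t)) @[n --> \oo] --> I.
  apply/cvgn_distP => eps eps0; have e4 : 0 < eps / 4 by rewrite divr_gt0.
  have [N1 h1] := bochner_approx_small sa e4.
  have /cvgn_distP/(_ _ e4)[N2 h2] := sI.
  exists (maxn N1 N2) => n; rewrite geq_max => /andP[/h1 {}h1 /h2 {}h2].
  have h3 := simple_integralB mD fD (sk n) (ss n).
  have h4 : (nint (fun t => k (s n t) - s n t)%R <= 2%:E * nint (fun t => f t - s n t)%R)%E.
    apply: (@nint_scale _ _ _ mu D mD) => //.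
      by apply: strongly_measurableB => //; exact: simple_measurable.
    apply: filterS Kf => t h Dt; have [_ kz] := kP (s n t).
    by rewrite distrC [`|f t - _|]distrC kz//; exact: h.
  have h5 : `|simple_integral mu D (fun t => k (s n t)) - simple_integral mu D (s n)| < eps / 2.
    rewrite -lte_fin; apply: (le_lt_trans h3); apply: (le_lt_trans h4).
    rewrite -lte_pdivlMl//; apply: (lt_le_trans h1).
    by rewrite -EFinM lee_fin; lra.
  rewrite (_ : _ - I = (simple_integral mu D (fun t => k (s n t)) - simple_integral mu D (s n)) +
     (simple_integral mu D (s n) - I)); last by lmod R.
  by apply: (le_lt_trans (ler_normD _ _)); lra.
apply: (closed_cvg _ cK) skI; apply: nearW => n.
rewrite (simple_integral_comp mD fD k (ss n)); have [fs _] := ss n.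
rewrite fsbig_finite//=; apply: big_ind => // x _.
by apply: KZ; [exact: fine_ge0|case: (kP x)].
Qed.

(** Dominated convergence of the norms of the values, after passing to
    measurable representatives. *)
Lemma mean_cvg0 (Y : completeNormedModType R) (v : nat -> T -> X) (g : T -> Y) :
  (forall n, strongly_measurable mu D (v n)) -> strongly_measurable mu D g ->
  (nint g < +oo)%E ->
  (\forall t \ae mu, D t -> v n t @[n --> \oo] --> (0 : X)) ->
  (\forall t \ae mu, forall n, D t -> `|v n t| <= `|g t|) ->
  forall eps : R, 0 < eps -> exists N, forall n, (N <= n)%N -> (nint (v n) < eps%:E)%E.
Proof.
move=> mv mg gint v0 vg.
have wex n : exists w, simple_limit w /\ \forall t \ae mu, D t -> v n t = w t.
  by have /(strongly_measurableP mu mD)[w sw vw] := mv n; exists w.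
have [w wP] := choice wex.
have /ae_foralln vw : forall n, \forall t \ae mu, D t -> v n t = w n t.
  by move=> n; case: (wP n).
have [g' sg' gg'] := (strongly_measurableP mu mD g).1 mg.
have mw n : measurable_fun D (fun t => (`|w n t|)%:E : \bar R).
  by apply/measurable_EFinP; apply: measurable_funTS; apply: simple_limit_norm; case: (wP n).
have mg' : measurable_fun D (fun t => (`|g' t|)%:E : \bar R).
  by apply/measurable_EFinP; apply: measurable_funTS; exact: simple_limit_norm.
have ig : mu.-integrable D (fun t => (`|g' t|)%:E).
  apply/integrableP; split => //.
  under eq_integral do rewrite gee0_abs ?lee_fin//.
  by rewrite -(nint_eq mD gg').
have [] := @dominated_convergence _ _ _ mu D mD
  (fun n t => (`|w n t|)%:E) (fun=> 0%E) (fun t => (`|g' t|)%:E) mw _ _ ig _.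
- exact: measurable_cst.
- apply: filterS2 v0 vw => t h hw Dt; apply: cvg_EFin; first exact: nearW.
  move: (h Dt) => /cvg_norm; rewrite normr0.
  rewrite (_ : (fun n => `|v n t|) = fine \o (fun n => (`|w n t|)%:E))//.
  by apply/funext => n /=; rewrite -hw.
- apply: filterS3 vg vw gg' => t h hw hg n Dt.
  by rewrite gee0_abs ?lee_fin// -hw// -hg//; exact: h.
move=> _ _; rewrite integral0 => cv.
apply/(@cvg0_small _ (fun n => nint (v n))) => [n|].
  by apply: integral_ge0 => t _; rewrite lee_fin.
rewrite (_ : (fun n => _) = fun n => \int[mu]_(t in D) (`|w n t|)%:E)%E//.
by apply/funext => n; apply: (nint_eq mD); case: (wP n).
Qed.

Lemma has_int_exists f : strongly_measurable mu D f -> (nint f < +oo)%E ->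
  exists I, has_int mu D f I.
Proof.
move=> mf fint; have /(strongly_measurableP mu mD)[g sg fg] := mf.
have [s [ss sg' sb]] := dist_measurable_approx sepX (simple_limit_dist sg).
have sf : \forall t \ae mu, D t -> s n t @[n --> \oo] --> f t.
  by apply: filterS fg => t h Dt; rewrite h.
apply: (integrable_has_int mD fD); exists s; apply: bochner_approxP => //.
apply: (@mean_cvg0 _ (fun n t => f t - s n t) f) => //.
- by move=> n; apply: strongly_measurableB => //; exact: simple_measurable.
- apply: filterS sf => t h Dt; rewrite -(subrr (f t)).
  by apply: cvgB; [exact: cvg_cst|exact: h].
- by apply: filterS fg => t h n Dt; rewrite h.
Qed.

Lemma has_int_dominated (Y : completeNormedModType R) f (g : T -> Y) (J : Y) :
  strongly_measurable mu D f -> has_int mu D g J ->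
  (\forall t \ae mu, D t -> `|f t| <= `|g t|) -> exists I, has_int mu D f I.
Proof.
move=> mf gJ fg; apply: has_int_exists => //.
by apply: (le_lt_trans (nint_le mD fg)); exact: has_int_finite gJ.
Qed.

Lemma has_int_bounded f (C : R) : strongly_measurable mu D f ->
  (\forall t \ae mu, D t -> `|f t| <= C) -> exists I, has_int mu D f I.
Proof.
move=> mf fC; apply: has_int_exists => //.
have mc : (\int[mu]_(t in D) (`|C|)%:E < +oo)%E.
  by rewrite integral_cst// lte_mul_pinfty// lee_fin.
apply: le_lt_trans mc; apply: ae_le_integral => //.
apply: filterS fC => t h Dt; rewrite lee_fin (le_trans (h Dt))//.
exact: ler_norm.
Qed.

Lemma has_int_bounded_norm f (C : R) I : has_int mu D f I -> 0 <= C ->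
  (\forall t \ae mu, D t -> `|f t| <= C) -> `|I| <= C * fine (mu D).
Proof.
move=> fI C0 fC; rewrite -lee_fin (le_trans (has_int_norm mD fD fI))//.
apply: (@le_trans _ _ (\int[mu]_(t in D) C%:E)%E).
  by apply: ae_le_integral => //; apply: filterS fC.
by rewrite integral_cst// EFinM fineK// ge0_fin_numE.
Qed.

(** Bounded convergence: the limit function is integrable and the differences
    tend to zero in mean, so that the integrals converge. *)
Lemma has_int_lim (u : nat -> T -> X) f (I_ : nat -> X) (C : R) :
  (forall n, has_int mu D (u n) (I_ n)) ->
  (\forall t \ae mu, D t -> u n t @[n --> \oo] --> f t) ->
  (\forall t \ae mu, forall n, D t -> `|u n t| <= C) ->
  exists2 I, has_int mu D f I & I_ n @[n --> \oo] --> I.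
Proof.
move=> uI uf uC.
have mu_ n := has_int_measurable (uI n).
have mf : strongly_measurable mu D f by exact: strongly_measurable_lim uf.
have fC : \forall t \ae mu, D t -> `|f t| <= C.
  apply: filterS2 uf uC => t h1 h2 Dt.
  by apply: cvgn_norm_le (h1 Dt) _ => n; exact: h2.
have [I fI] := has_int_bounded mf fC.
exists I => //; apply/cvgn_distP => eps eps0.
have [] := @mean_cvg0 R^o (fun n t => u n t - f t) (fun=> C + C) _ _ _ _ _ eps eps0.
- by move=> n; exact: strongly_measurableB.
- exact: strongly_measurable_cst.
- by rewrite integral_cst// lte_mul_pinfty// lee_fin.
- apply: filterS uf => t h Dt; rewrite -(subrr (f t)).
  by apply: cvgB; [exact: h|exact: cvg_cst].
- apply: filterS2 uC fC => t h1 h2 n Dt.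
  rewrite (le_trans (ler_normB _ _))// (le_trans _ (ler_norm _))//.
  by rewrite lerD//; [exact: h1|exact: h2].
move=> N hN; exists N => n /hN h; rewrite -lte_fin; apply: le_lt_trans h.
exact: has_int_dist.
Qed.

End has_integral_limits.

Section has_integral_domain.
Context d (T : measurableType d) (R : realType) (mu : {measure set T -> \bar R}).
Context (X : completeNormedModType R).
Implicit Types (f : T -> X) (I : X).

(** The zero function is a representative. *)
Lemma has_int_null (D : set T) f : measurable D -> mu D = 0%E -> has_int mu D f 0.
Proof.
move=> mD D0.
have fD : (mu D < +oo)%E by rewrite D0.
have ss : simple_fun (fun _ : T => 0 : X).
  have := @simple_fun_indic _ T X setT 0 0 measurableT.
  by congr simple_fun; apply/funext => t /=; case: ifP.
have nD : \forall t \ae mu, D t -> f t = 0.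
  by apply: filterS (ae_null mD D0) => t.
apply: (@has_int_ae _ _ _ mu D mD fD _ (fun=> 0)).
  by apply: filterS nD => t h Dt; rewrite h.
exists (fun _ _ => 0).
  apply: bochner_approxP => //; first by apply: nearW => t _; exact: cvg_cst.
  move=> eps eps0; exists 0%N => n _.
  by under eq_integral do rewrite subrr normr0; rewrite integral0.
rewrite (_ : (fun n => _) = fun=> 0); first exact: cvg_cst.
by apply/funext => n; rewrite /simple_integral fsbig1// => x _;
  have [->|x0] := eqVneq x 0; rewrite ?scaler0// preimage_cst memNset ?setI0 ?measure0 ?scale0r//= => /esym/eqP; rewrite (negPf x0).
Qed.

(** The same simple functions approximate in mean on both pieces. *)
Lemma has_int_split (D D1 D2 : set T) f I : measurable D1 -> measurable D2 ->
  (mu D < +oo)%E -> D = D1 `|` D2 -> D1 `&` D2 = set0 ->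
  has_int mu D f I -> exists I1 I2,
  [/\ has_int mu D1 f I1, has_int mu D2 f I2 & I = I1 + I2].
Proof.
move=> mD1 mD2 fD DE dis.
have mD : measurable D by rewrite DE; exact: measurableU.
have sub1 : D1 `<=` D by rewrite DE; exact: subsetUl.
have sub2 : D2 `<=` D by rewrite DE; exact: subsetUr.
have f1 : (mu D1 < +oo)%E by apply: le_lt_trans fD; apply: le_measure; rewrite ?inE.
have f2 : (mu D2 < +oo)%E by apply: le_lt_trans fD; apply: le_measure; rewrite ?inE.
move=> [s sa sI].
have ss n : simple_fun (s n) by exact: approx_simple sa n.
have ms := approx_measurable sa.
have sub (E : set T) : measurable E -> (mu E < +oo)%E -> E `<=` D -> bochner_approx mu E f s.
  move=> mE fE ED; apply: bochner_approxP => //.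
    by case: sa => _ _ sf _; apply: filterS sf => t h /ED.
  move=> eps /(bochner_approx_small sa)[N hN]; exists N => n /hN; apply: le_lt_trans.
  rewrite integral_mkcond [leRHS]integral_mkcond; apply: ae_le_integral => //.
  - by move=> t; rewrite patchE; case: ifP => // _; rewrite lee_fin.
  - by move=> t; rewrite patchE; case: ifP => // _; rewrite lee_fin.
  apply: nearW => t _; rewrite !patchE; case: ifPn => [/set_mem/ED Dt|_].
    by rewrite mem_set.
  by case: ifP => // _; rewrite lee_fin.
have [s1 s2] := (sub D1 mD1 f1 sub1, sub D2 mD2 f2 sub2).
have [I1 hI1] := integrable_has_int mD1 f1 (ex_intro _ s s1).
have [I2 hI2] := integrable_has_int mD2 f2 (ex_intro _ s s2).
exists I1, I2; split => //.
have cv (E : set T) J : measurable E -> (mu E < +oo)%E -> bochner_approx mu E f s ->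
    has_int mu E f J -> simple_integral mu E (s n) @[n --> \oo] --> J.
  move=> mE fE sE [r rE rJ].
  have [J' hJ'] := approx_int_cvg mE fE sE.
  have fJ' : has_int mu E f J' by exists s.
  have fJ : has_int mu E f J by exists r.
  by rewrite (has_int_uniq mE fE fJ fJ').
apply: (cvgn_uniq sI).
have SE n : simple_integral mu D (s n) =
    simple_integral mu D1 (s n) + simple_integral mu D2 (s n).
  have [fs mS] := ss n.
  rewrite !(simple_integral_comp _ _ id (ss n))// !fsbig_finite//= -big_split/=.
  apply: eq_bigr => x _; rewrite -scalerDl; congr (_ *: _).
  have m1 : measurable (D1 `&` s n @^-1` [set x]) by exact: measurableI.
  have m2 : measurable (D2 `&` s n @^-1` [set x]) by exact: measurableI.
  rewrite -fineD ?ge0_fin_numE ?wt_finite//; congr fine.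
  by rewrite DE setIUl measureU// setIACA dis set0I.
by under eq_fun do rewrite SE; apply: cvgD; exact: cv.
Qed.

End has_integral_domain.

Section real_integral.
Context d (T : measurableType d) (R : realType) (mu : {measure set T -> \bar R}).
Context (D : set T) (mD : measurable D) (fD : (mu D < +oo)%E).

Lemma simple_integral_lebesgue (s : T -> R^o) : simple_fun s ->
  (\int[mu]_(t in D) (s t)%:E)%E = (simple_integral mu D s)%:E.
Proof.
move=> ss; rewrite integralE.
have pE t : ((fun t => (s t)%:E) ^\+ t)%E = (Num.max (s t) 0)%:E.
  by rewrite funeposE EFin_max.
have nE t : ((fun t => (s t)%:E) ^\- t)%E = (Num.max (- s t) 0)%:E.
  by rewrite funenegE -EFinN EFin_max.
under eq_integral do rewrite pE.
under [X in (_ - X)%E]eq_integral do rewrite nE.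
rewrite (simple_integral_real mD fD (phi := fun y : R => Num.max y 0) ss); last first.
  by move=> y; rewrite le_max lexx orbT.
rewrite (simple_integral_real mD fD (phi := fun y : R => Num.max (- y) 0) ss); last first.
  by move=> y; rewrite le_max lexx orbT.
have := simple_integral_comp mD fD (X := R^o) id ss; rewrite /comp/= => ->.
have [fs _] := ss; rewrite !fsbig_finite//= -EFinB; congr EFin.
rewrite -sumrB; apply: eq_bigr => y _; rewrite -mulrBr; congr (_ * _).
by have [y0|y0] := leP 0 y; [rewrite max_r ?oppr_le0// subr0|
  rewrite max_l ?oppr_ge0 ?(ltW y0)// sub0r opprK].
Qed.

(** Both integrals agree on simple functions and are continuous for
    convergence in mean. *)
Lemma has_int_lebesgue (g : T -> R^o) (I : R) : has_int mu D g I ->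
  (\int[mu]_(t in D) (g t)%:E)%E = I%:E.
Proof.
move=> gI; have mg := has_int_measurable gI; have gfin := has_int_finite mD fD gI.
have /(strongly_measurableP mu mD)[h sh gh] := mg.
have -> : (\int[mu]_(t in D) (g t)%:E = \int[mu]_(t in D) (h t)%:E)%E.
  rewrite integralE [RHS]integralE; congr (_ - _)%E.
    by apply: ae_eq_integral_ge0 => //; apply: filterS gh => t gt Dt; rewrite !funeposE gt.
  by apply: ae_eq_integral_ge0 => //; apply: filterS gh => t gt Dt; rewrite !funenegE gt.
have hI : has_int mu D h I by exact: has_int_ae gh gI.
have mh : measurable_fun D (fun t => (h t)%:E : \bar R).
  apply/measurable_EFinP; apply: measurable_funTS.
  have [s ss sth] := sh; apply: (measurable_fun_cvg (h := s)); last by move=> t _; exact: sth.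
  by move=> n; exact: (simple_fun_measurable id (ss n)).
have ih : mu.-integrable D (fun t => (h t)%:E).
  by apply/integrableP; split => //; rewrite -(nint_eq mD gh).
have [s sa sI] := hI; have ss n : simple_fun (s n) by exact: approx_simple sa n.
have is_ n : mu.-integrable D (fun t => (s n t)%:E).
  apply/integrableP; split; last exact: nint_simple.
  apply/measurable_EFinP; apply: measurable_funTS.
  exact: (simple_fun_measurable id (ss n)).
have fh := integrable_fin_num mD ih.
rewrite -(fineK fh); congr EFin; apply: (@cvgn_uniq R R^o _ _ _ _ sI).
apply/cvgn_distP => eps eps0; have [N hN] := bochner_approx_small sa eps0.
exists N => n /hN h1; rewrite -lte_fin; apply: le_lt_trans h1; rewrite distrC.
have -> (x y : R) : (`|x - y|%:E = `|x%:E - y%:E|)%E by [].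
rewrite fineK// -simple_integral_lebesgue//.
rewrite -integralB//; apply: (le_trans (le_abse_integral _ _ _)) => //.
by apply: emeasurable_funB; [exact: mh|case/integrableP: (is_ n)].
Qed.

Lemma has_int_real_ge0 (g : T -> R^o) (I : R) : has_int mu D g I ->
  (\forall t \ae mu, D t -> 0 <= g t) -> 0 <= I.
Proof.
move=> gI g0; have cl : closed ([set x : R | 0 <= x] : set R^o) := @closed_ge R 0.
apply: (@has_int_cone _ _ _ mu D mD fD R^o _ _ _ cl) gI => //.
- exact: lexx.
- by move=> x y; exact: (@addr_ge0 R).
- by move=> a x a0 x0; exact: (mulr_ge0 a0 x0).
Qed.

End real_integral.

(** * Integrals over intervals of the real line *)

Lemma at_right_distP (R : realType) (V : normedModType R) (F : R -> V) (l : V) :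
  F h @[h --> 0^'+] --> l <->
  forall eps : R, 0 < eps -> exists2 del : R, 0 < del &
    forall h, 0 < h -> h < del -> `|F h - l| < eps.
Proof.
split=> [/cvgrPdist_lt H eps /H /nbhs_ballP[del /= del0 hd]|H].
  exists del => // h h0 hdel; rewrite distrC; apply: hd => //.
  by rewrite -ball_normE /= sub0r normrN gtr0_norm.
apply/cvgrPdist_lt => eps /H[del del0 hd].
apply/nbhs_ballP; exists del => // h; rewrite -ball_normE /= sub0r normrN => hdel h0.
by rewrite distrC; apply: hd => //; apply: le_lt_trans hdel; exact: ler_norm.
Qed.

Section small_increments.
Context (R : realType) (X : normedModType R).

(** Cutting [[0, T]] into many equal steps, the errors add up to an
    arbitrarily small total. With [P = [set 0]] this says that a vanishing
    derivative makes a path constant; with a cone, that a nonnegative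
    derivative makes it increase. *)
Lemma small_increments (P : set X) (z : R -> X) (T : R) : closed P -> P 0 ->
  (forall x y, P x -> P y -> P (x + y)) -> 0 <= T ->
  (forall eps : R, 0 < eps -> exists2 del : R, 0 < del & forall s k, 0 <= s -> 0 < k ->
    k < del -> s + k <= T -> exists2 p, P p & `|z (s + k) - z s - p| <= eps * k) ->
  P (z T - z 0).
Proof.
move=> cP P0 PD; rewrite le_eqVlt => /orP[/eqP <- _|T0 H].
  by rewrite subrr.
apply: cP => B /nbhs_ballP[eps /= eps0 zB].
have e2 : 0 < eps / 2 / T by rewrite !divr_gt0.
have [del del0 hdel] := H _ e2.
pose N := (Num.bound (T / del)).+1.
have N0 : 0 < N%:R :> R by rewrite ltr0n.
pose k := T / N%:R.
have k0 : 0 < k by rewrite divr_gt0.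
have kdel : k < del.
  rewrite ltr_pdivrMr// mulrC -ltr_pdivrMr//.
  apply: (lt_le_trans (archi_boundP _)); first by rewrite divr_ge0// ltW.
  by rewrite ler_nat.
have step n : (n <= N)%N -> exists2 p, P p &
    `|z (n%:R * k) - z 0 - p| <= eps / 2 / T * k * n%:R.
  elim: n => [_|n IH nN].
    by exists 0 => //; rewrite mul0r subrr subr0 normr0 mulr0.
  have [p Pp hp] := IH (ltnW nN).
  have skT : n%:R * k + k <= T.
    have : n.+1%:R * k <= N%:R * k by rewrite ler_wpM2r ?ler_nat// ltW.
    rewrite -natr1 mulrDl mul1r => /le_trans; apply.
    by rewrite /k mulrC divfK ?gt_eqF.
  have nk0 : 0 <= n%:R * k by rewrite mulr_ge0// ltW.
  have [q Pq hq] := hdel _ _ nk0 k0 kdel skT.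
  exists (p + q); first exact: PD.
  rewrite -natr1 mulrDl mul1r.
  have -> : z (n%:R * k + k) - z 0 - (p + q) =
     (z (n%:R * k) - z 0 - p) + (z (n%:R * k + k) - z (n%:R * k) - q) by lmod R.
  by rewrite (le_trans (ler_normD _ _))// mulrDr mulr1 lerD.
have [p Pp] := step N (leqnn N).
have NkT : N%:R * k = T by rewrite /k mulrC divfK ?gt_eqF.
rewrite NkT -mulrA [k * _]mulrC NkT divfK ?gt_eqF// => hp.
exists p; split => //; apply: zB; rewrite -ball_normE /=.
by apply: (le_lt_trans hp); rewrite ltr_pdivrMr// ltr_pMr// ltr1n.
Qed.

End small_increments.

Section intervals.
Context (R : realType) (X : completeNormedModType R).
Local Notation mu := (@lebesgue_measure R).
Implicit Types (a b c t : R) (f g : R -> X).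

Lemma interval_finite a b : (mu `[a, b]%classic < +oo)%E.
Proof.
by rewrite lebesgue_measure_itv/=; case: ifP => _; rewrite ?ltry// -EFinB ltry.
Qed.

Lemma interval_length a b : a <= b -> fine (mu `[a, b]%classic) = b - a.
Proof.
move=> ab; rewrite lebesgue_measure_itv/= lte_fin; case: ltP => [//|ba].
by have /eqP -> : b == a by [rewrite eq_le ab ba]; rewrite subrr.
Qed.

Lemma has_int_itv_split a b c f I : a <= b -> b <= c ->
  has_int mu `[a, c]%classic f I -> exists I1 I2,
  [/\ has_int mu `[a, b]%classic f I1, has_int mu `[b, c]%classic f I2 & I = I1 + I2].
Proof.
move=> ab bc fI.
have E1 : `[a, c]%classic = `[a, b]%classic `|` `]b, c]%classic.
  apply/seteqP; split=> x; rewrite /= !in_itv/=.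
    by move=> /andP[ax xc]; have [xb|bx] := leP x b; [left|right]; rewrite ?ax ?xb ?xc.
  by case=> /andP[h1 h2]; rewrite ?h1 ?h2 ?(le_trans h2) ?(ltW (le_lt_trans ab h1)).
have E2 : `[a, c]%classic = `[a, b[%classic `|` `[b, c]%classic.
  apply/seteqP; split=> x; rewrite /= !in_itv/=.
    by move=> /andP[ax xc]; have [xb|bx] := ltP x b; [left|right]; rewrite ?ax ?xb ?xc.
  by case=> /andP[h1 h2]; rewrite ?h1 ?h2 ?(le_trans ab) ?(ltW (lt_le_trans h2 bc)).
have E3 : `[b, c]%classic = [set b] `|` `]b, c]%classic.
  apply/seteqP; split=> x; rewrite /= !in_itv/=.
    by rewrite le_eqVlt => /andP[/orP[/eqP ->|->] ->]; [left|right].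
  by case=> [->|/andP[/ltW -> ->]//]; rewrite lexx.
have D1 : `[a, b]%classic `&` `]b, c]%classic = set0 :> set R.
  by rewrite -subset0 => x; rewrite /= !in_itv/= => -[/andP[_ xb] /andP[]]; rewrite ltNge xb.
have D2 : `[a, b[%classic `&` `[b, c]%classic = set0 :> set R.
  by rewrite -subset0 => x; rewrite /= !in_itv/= => -[/andP[_ xb] /andP[]]; rewrite leNgt xb.
have D3 : [set b] `&` `]b, c]%classic = set0.
  by rewrite -subset0 => x; rewrite /= !in_itv/= => -[-> /andP[]]; rewrite ltxx.
have [I1 [I2 [h1 h2 ->]]] := has_int_split (mu := mu) (measurable_itv _) (measurable_itv _)
  (interval_finite _ _) E1 D1 fI.
have [J1 [J2 [_ h3 _]]] := has_int_split (mu := mu) (measurable_itv _) (measurable_itv _)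
  (interval_finite _ _) E2 D2 fI.
have [K1 [K2 [h4 h5 JE]]] := has_int_split (mu := mu) (measurable_set1 b) (measurable_itv _)
  (interval_finite _ _) E3 D3 h3.
exists I1, J2; split => //; congr (_ + _).
have mb := lebesgue_measure_set1 b.
have -> : J2 = K2.
  rewrite JE (has_int_uniq (mu := mu) (measurable_set1 b) _ h4 (has_int_null (mu := mu) f (measurable_set1 b) mb)) ?add0r//.
  by rewrite (_ : _ [set b] = 0%E)//; exact: mb.
have fbc : (mu `]b, c]%classic < +oo)%E.
  by rewrite lebesgue_measure_itv/=; case: ifP => _; rewrite ?ltry// -EFinB ltry.
exact: (has_int_uniq (mu := mu) (measurable_itv _) fbc h2 h5).
Qed.

Lemma has_int_cst a b (x : X) : a <= b ->
  has_int mu `[a, b]%classic (fun=> x) ((b - a) *: x).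
Proof.
move=> ab; have ss : simple_fun (fun _ : R => x).
  have := @simple_fun_indic _ R X setT x x measurableT.
  by congr simple_fun; apply/funext => t /=; case: ifP.
exists (fun _ _ => x).
  apply: bochner_approxP => //; first exact: interval_finite.
    by apply: nearW => t _; exact: cvg_cst.
  move=> eps eps0; exists 0%N => n _.
  by under eq_integral do rewrite subrr normr0; rewrite integral0.
have := simple_integral_comp (mu := mu) (measurable_itv `[a, b]) (interval_finite a b) id ss.
have -> : range (fun _ : R => x) = [set x].
  by apply/seteqP; split=> [_ [_ _ <-]//|_ ->]; exists 0.
rewrite fsbig_set1 /comp /= preimage_cst mem_set// setIT interval_length// => ->.
exact: cvg_cst.
Qed.

Lemma has_int_near_cst a b f I (x : X) (eps : R) : a <= b ->
  has_int mu `[a, b]%classic f I -> 0 <= eps ->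
  (forall t, a <= t -> t <= b -> `|f t - x| <= eps) ->
  `|I - (b - a) *: x| <= eps * (b - a).
Proof.
move=> ab fI eps0 fx; have mab := measurable_itv `[a, b].
have fab := interval_finite a b.
have := has_int_bounded_norm (mu := mu) mab fab (has_intB (mu := mu) mab fab fI (has_int_cst x ab)) eps0.
rewrite interval_length//; apply; apply: nearW => t /=.
by rewrite in_itv/= => /andP[ta tb]; exact: fx.
Qed.

End intervals.

Section half_line.
Context (R : realType) (X : completeNormedModType R).
Hypothesis sepX : exists2 S : set X, countable S & dense S.
Local Notation mu := (@lebesgue_measure R).
Local Notation Rplus := (`[0, +oo[%classic : set R).

Lemma half_line_measurable_sub (f : R -> X) (a b : R) : 0 <= a ->
  strongly_measurable mu Rplus f -> strongly_measurable mu `[a, b]%classic f.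
Proof.
move=> a0; apply: strongly_measurable_subset => t /=.
by rewrite !in_itv/= andbT => /andP[at_ _]; exact: le_trans at_.
Qed.

(** Continuity is only assumed on the half line, so the representative is [f]
    at the positive part of [t]. *)
Lemma continuous_strongly_measurable (f : R -> X) :
  (forall t, 0 <= t -> forall eps : R, 0 < eps -> exists2 del : R, 0 < del &
     forall s, 0 <= s -> `|s - t| < del -> `|f s - f t| < eps) ->
  strongly_measurable mu Rplus f.
Proof.
move=> cf; apply/strongly_measurableP; first exact: measurable_itv.
exists (fun t => f (Num.max t 0)); last first.
  by apply: nearW => t /=; rewrite in_itv/= andbT => t0; rewrite max_l.
apply: (dist_measurable_simple_limit sepX) => x.
apply: continuous_measurable_fun => t.
apply: (@continuous_comp R X R (fun t => f (Num.max t 0) - x) (fun y => `|y|)); last exact: norm_continuous.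
apply: cvgB; last exact: cvg_cst.
have m0 : 0 <= Num.max t 0 by rewrite le_max lexx orbT.
apply/cvgrPdist_lt => eps /(cf _ m0)[del del0 hd].
apply/nbhs_ballP; exists del => // s /= ts.
rewrite distrC; apply: hd; first by rewrite le_max lexx orbT.
rewrite distrC; apply: le_lt_trans ts.
have mx (u v : R) : u <= v -> `|Num.max u 0 - Num.max v 0| <= `|u - v|.
  move=> uv; rewrite distrC [leRHS]distrC [leRHS]ger0_norm ?subr_ge0//.
  have [u0|u0] := leP 0 u; first by rewrite max_l ?(le_trans u0) ?ger0_norm ?subr_ge0.
  have [v0|v0] := leP 0 v; first by rewrite ger0_norm; lra.
  by rewrite subrr normr0; lra.
have [ts'|st] := leP t s; first exact: mx.
by rewrite distrC [leRHS]distrC; apply: mx; exact: ltW.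
Qed.

End half_line.

Section interval_integral.
Context (R : realType).
Local Notation mu := (@lebesgue_measure R).
Implicit Types (X Y : completeNormedModType R) (a b t : R).

Definition itv_int X a b (f : R -> X) (I : X) := has_int mu `[a, b]%classic f I.

Lemma itv_ae (P : R -> Prop) a b : (\forall t \ae mu, 0 <= t -> P t) -> 0 <= a ->
  \forall t \ae mu, `[a, b]%classic t -> P t.
Proof.
move=> h a0; apply: ae_imp h => t h; rewrite /= in_itv/= => /andP[at_ _].
by apply: h; exact: le_trans at_.
Qed.

Lemma itv_intD X a b (f g : R -> X) I J : itv_int a b f I -> itv_int a b g J ->
  itv_int a b (fun t => f t + g t) (I + J).
Proof. exact: (has_intD (mu := mu) (measurable_itv _) (interval_finite _ _)). Qed.

Lemma itv_intB X a b (f g : R -> X) I J : itv_int a b f I -> itv_int a b g J ->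
  itv_int a b (fun t => f t - g t) (I - J).
Proof. exact: (has_intB (mu := mu) (measurable_itv _) (interval_finite _ _)). Qed.

Lemma itv_intZ X a b (k : R) (f : R -> X) I : itv_int a b f I ->
  itv_int a b (fun t => k *: f t) (k *: I).
Proof. exact: (has_intZ (mu := mu) (measurable_itv _) (interval_finite _ _)). Qed.

Lemma itv_int_linear X Y a b (T : X -> Y) (f : R -> X) I : bounded_linear T ->
  itv_int a b f I -> itv_int a b (fun t => T (f t)) (T I).
Proof. by move=> bT; exact: (has_int_linear (mu := mu) (measurable_itv _) (interval_finite _ _) bT). Qed.

Lemma itv_int_uniq X a b (f : R -> X) I J :
  itv_int a b f I -> itv_int a b f J -> I = J.
Proof. exact: (has_int_uniq (mu := mu) (measurable_itv _) (interval_finite _ _)). Qed.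

Lemma itv_int_ae X a b (f g : R -> X) I :
  (\forall t \ae mu, `[a, b]%classic t -> f t = g t) -> itv_int a b f I ->
  itv_int a b g I.
Proof. exact: (has_int_ae (mu := mu) (measurable_itv _) (interval_finite _ _)). Qed.

Lemma itv_int_eq X a b (f g : R -> X) I :
  (forall t, a <= t -> t <= b -> f t = g t) -> itv_int a b f I -> itv_int a b g I.
Proof.
move=> fg; apply: itv_int_ae; apply: nearW => t /=.
by rewrite in_itv/= => /andP[at_ tb]; exact: fg.
Qed.

Lemma itv_int_split X a b c (f : R -> X) I : a <= b -> b <= c -> itv_int a c f I ->
  exists I1 I2, [/\ itv_int a b f I1, itv_int b c f I2 & I = I1 + I2].
Proof. exact: has_int_itv_split. Qed.

Lemma itv_int_point X a (f : R -> X) : itv_int a a f 0.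
Proof.
have m0 : mu `[a, a]%classic = 0%E by rewrite lebesgue_measure_itv/= lte_fin ltxx.
exact: (has_int_null (mu := mu) f (measurable_itv _) m0).
Qed.

Lemma itv_int_cone X a b (K : set X) (f : R -> X) I : closed K -> K 0 ->
  (forall x y, K x -> K y -> K (x + y)) ->
  (forall (k : R) x, 0 <= k -> K x -> K (k *: x)) ->
  (\forall t \ae mu, `[a, b]%classic t -> K (f t)) -> itv_int a b f I -> K I.
Proof. exact: (has_int_cone (mu := mu) (measurable_itv _) (interval_finite _ _)). Qed.

Lemma itv_int_bochner X a b (f : R -> X) I : itv_int a b f I ->
  bochner_integrable mu `[a, b] f /\ bochner_integral mu `[a, b] f = I.
Proof.
move=> fI; split; first exact: has_int_integrable fI.
exact: (has_int_bochner (mu := mu) (measurable_itv _) (interval_finite _ _) fI).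
Qed.

Lemma itv_int_of_bochner X a b (f : R -> X) : bochner_integrable mu `[a, b] f ->
  itv_int a b f (bochner_integral mu `[a, b] f).
Proof.
move=> fi; have [I fI] := integrable_has_int (mu := mu) (measurable_itv _) (interval_finite _ _) fi.
by have [_ ->] := itv_int_bochner fI.
Qed.

Lemma itv_int_norm_le X a b (f : R -> X) I (C : R) : a <= b -> itv_int a b f I ->
  0 <= C -> (\forall t \ae mu, `[a, b]%classic t -> `|f t| <= C) ->
  `|I| <= C * (b - a).
Proof.
move=> ab fI C0 fC; rewrite -(interval_length ab).
exact: (has_int_bounded_norm (mu := mu) (measurable_itv _) (interval_finite _ _) fI).
Qed.

Section separable.
Context X (sepX : exists2 S : set X, countable S & dense S).

Lemma itv_int_bounded a b (f : R -> X) (C : R) : 0 <= a ->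
  strongly_measurable mu `[0, +oo[%classic f ->
  (\forall t \ae mu, `[a, b]%classic t -> `|f t| <= C) -> exists I, itv_int a b f I.
Proof.
move=> a0 /(half_line_measurable_sub b a0) mf.
exact: (has_int_bounded (mu := mu) (measurable_itv _) (interval_finite _ _) sepX mf).
Qed.

Lemma itv_int_dominated Y a b (f : R -> X) (g : R -> Y) (J : Y) : 0 <= a ->
  strongly_measurable mu `[0, +oo[%classic f -> itv_int a b g J ->
  (\forall t \ae mu, `[a, b]%classic t -> `|f t| <= `|g t|) -> exists I, itv_int a b f I.
Proof.
move=> a0 /(half_line_measurable_sub b a0) mf.
exact: (has_int_dominated (mu := mu) (measurable_itv _) (interval_finite _ _) sepX mf).
Qed.

Lemma itv_int_lim a b (u : nat -> R -> X) (f : R -> X) (I_ : nat -> X) (C : R) :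
  (forall n, itv_int a b (u n) (I_ n)) ->
  (\forall t \ae mu, `[a, b]%classic t -> u n t @[n --> \oo] --> f t) ->
  (\forall t \ae mu, forall n, `[a, b]%classic t -> `|u n t| <= C) ->
  exists2 I, itv_int a b f I & I_ n @[n --> \oo] --> I.
Proof. exact: (has_int_lim (mu := mu) (measurable_itv _) (interval_finite _ _) sepX). Qed.

End separable.

End interval_integral.

(** * The semigroup and the inverse of its generator *)

Definition op_inv (R : realType) (X : completeNormedModType R) (L : operator X) (x : X) : X :=
  xget 0 [set u | domain L u /\ L u = x].

(** What the evolution problem uses of an operator [L] with [- L] generating a
    positive semigroup [S] and [L >= l0 > 0] on the positive part of its domain:
    [L] has a bounded positive inverse [J], the orbits decrease, their decay is
    controlled to first order, and the image of the cone under [J] is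
    hereditary. *)
Record generator_data (R : realType) (X : completeNormedModType R)
    (le : X -> X -> Prop) (L : operator X) (J : X -> X) (S : R -> X -> X) : Prop :=
  GeneratorData {
  gd_J : bounded_linear J;
  gd_JK : forall x, domain L (J x) /\ L (J x) = x;
  gd_LK : forall g, domain L g -> J (L g) = g;
  gd_J_pos : forall x, cone le x -> cone le (J x);
  gd_L_pos : forall g, domain L g -> cone le g -> cone le (L g);
  gd_S : forall t, 0 <= t -> bounded_linear (S t);
  gd_S_pos : forall t g, 0 <= t -> cone le g -> cone le (S t g);
  gd_S0 : forall x, S 0 x = x;
  gd_SD : forall s t x, 0 <= s -> 0 <= t -> S (s + t) x = S s (S t x);
  gd_S_decr : forall t g, 0 <= t -> cone le g -> cone le (g - S t g);
  gd_JS : forall t x, 0 <= t -> J (S t x) = S t (J x);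
  gd_upper : forall t x, 0 <= t -> cone le x -> cone le (t *: x - (J x - S t (J x)));
  gd_lower : forall t x, 0 <= t -> cone le x -> cone le (J x - S t (J x) - t *: S t x);
  gd_saturated : forall g x, cone le g -> cone le (J x - g) ->
    exists2 y, cone le y & g = J y;
  gd_cont : forall x (eps : R), 0 < eps -> exists2 del : R, 0 < del &
    forall s t, 0 <= s -> s <= t -> t - s < del -> `|S t x - S s x| < eps }.

Section semigroup.
Context (R : realType) (X : completeNormedModType R) (le : X -> X -> Prop).
Hypothesis ss : state_space le.
Context (S : R -> X -> X) (L : operator X).
Hypotheses (C0S : C0_semigroup S)
  (S_pos : forall t g, 0 <= t -> cone le g -> cone le (S t g))
  (S_gen : semigroup_generator S (opp_operator L)).
Hypothesis L_linear : linear_operator L.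
Hypothesis L_bound : lower_bound_assumption le L.
Local Notation K := (cone le).
Local Notation mass := (mass le).
Implicit Types (x y g : X) (t s h : R).

Let sepX := ss_separable ss.

Let SB t x y : 0 <= t -> S t (x - y) = S t x - S t y.
Proof.
move=> t0; have -> : x - y = -1 *: y + x by lmod R.
by rewrite (sg_linear C0S t0) scaleN1r addrC.
Qed.

Let S0r t : 0 <= t -> S t 0 = 0.
Proof. by move=> t0; have := SB 0 0 t0; rewrite !subrr. Qed.

Let SZ t (a : R) x : 0 <= t -> S t (a *: x) = a *: S t x.
Proof.
by move=> t0; rewrite -[a *: x]addr0 (sg_linear C0S t0) S0r// addr0.
Qed.

Let S_right x (eps : R) : 0 < eps ->
  exists2 del : R, 0 < del & forall h, 0 <= h -> h < del -> `|S h x - x| < eps.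
Proof.
move=> eps0; have /at_right_distP/(_ _ eps0)[del del0 H] := @sg_cont _ _ _ C0S x.
exists del => // h; rewrite le_eqVlt => /orP[/eqP <- _|]; last exact: H.
by rewrite (sg_0 C0S) subrr normr0.
Qed.

(** If the [S t] were unbounded for [t] near [0], a gliding sum would produce
    a single vector whose orbit is unbounded near [0], against strong
    continuity there. *)
Lemma semigroup_bounded_near0 : exists del M : R,
  [/\ 0 < del, 1 <= M & forall t x, 0 <= t -> t <= del -> `|S t x| <= M * `|x| ].
Proof.
have [del [M [del0 M0 H]]] : exists del M : R, [/\ 0 < del, 0 <= M &
    forall t g, 0 <= t -> t <= del -> K g -> `|S t g| <= M * `|g| ].
  apply: contrapT => nH.
  have ex n : exists t : R, [/\ 0 <= t, t <= n.+1%:R^-1 &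
      exists2 g, K g & n%:R * 2 ^+ n * `|g| < `|S t g| ].
    apply: contrapT => nt; apply: nH; exists n.+1%:R^-1, (n%:R * 2 ^+ n).
    split => [||t g t0 tn Kg]; first by rewrite invr_gt0.
      by rewrite mulr_ge0// exprn_ge0.
    rewrite leNgt; apply/negP => h; apply: nt; exists t; split => //; by exists g.
  have [t tP] := choice ex.
  have [n x y Kx Kyx|n a x a0 Kx|n|G KG Gn] := @gliding_sum _ _ _ ss (fun n g => `|S (t n) g|).
  - have [t0 _ _] := tP n; apply: (cone_norm_le ss); first exact: S_pos.
    by rewrite -SB//; exact: S_pos.
  - by have [t0 _ _] := tP n; rewrite SZ// normrZ ger0_norm.
  - by have [_ _] := tP n.
  have [del del0 hd] := S_right G ltr01.
  pose n := maxn (Num.bound (del^-1)) (Num.bound (`|G| + 1)).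
  have [t0 tn _] := tP n.
  have tdel : t n < del.
    apply: (le_lt_trans tn); rewrite -[del]invrK ltf_pV2 ?posrE ?invr_gt0//.
    apply: (lt_le_trans (archi_boundP _)); first by rewrite invr_ge0 ltW.
    by rewrite ler_nat (leq_trans (leq_maxl _ _) (leqnSn _)).
  have := Gn n; apply/negP; rewrite -ltNge.
  have := hd _ t0 tdel => h.
  apply: (@lt_le_trans _ _ (`|G| + 1)).
    rewrite -{1}(subrK G (S (t n) G)) (le_lt_trans (ler_normD _ _))// addrC.
    by rewrite ltrD2l.
  apply/ltW/(lt_le_trans (archi_boundP _)); first by rewrite addr_ge0.
  by rewrite ler_nat leq_maxr.
have [C C0 hC] := cone_decomposition ss.
exists del, (M * C + M * C + 1); split => //; first by rewrite lerDr addr_ge0// mulr_ge0.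
move=> t x t0 tdel; have [g [g' [Kg Kg' xE gC gC']]] := hC x.
rewrite {1}xE SB// (le_trans (ler_normB _ _))// mulrDl.
apply: (@le_trans _ _ ((M * C + M * C) * `|x|)); last by rewrite lerDl mulr_ge0.
rewrite mulrDl lerD// -mulrA.
  by rewrite (le_trans (H t g t0 tdel Kg))// ler_wpM2l.
by rewrite (le_trans (H t g' t0 tdel Kg'))// ler_wpM2l.
Qed.

Lemma semigroup_bounded T : exists2 M : R, 0 < M &
  forall t x, 0 <= t -> t <= T -> `|S t x| <= M * `|x|.
Proof.
have [del [M [del0 M1 H]]] := semigroup_bounded_near0.
have M0 : 0 < M by exact: lt_le_trans M1.
have bnd n t x : 0 <= t -> t <= n%:R * del -> `|S t x| <= M ^+ n * `|x|.
  elim: n t x => [|n IH] t x t0.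
    rewrite mul0r => tle; have -> : t = 0 by apply/eqP; rewrite eq_le tle t0.
    by rewrite (sg_0 C0S) expr0 mul1r.
  rewrite -natr1 mulrDl mul1r => tle.
  have [td|dt] := leP t del.
    rewrite (le_trans (H t x t0 td))// ler_wpM2r// exprS ler_peMr ?(ltW M0)//.
    exact: exprn_ege1.
  have td0 : 0 <= t - del by rewrite subr_ge0 ltW.
  have -> : t = del + (t - del) by lra.
  rewrite (sg_add C0S)// ?(ltW del0)// (le_trans (H _ _ _ _)) ?(ltW del0)//.
  by rewrite exprS -mulrA ler_wpM2l ?(ltW M0)// IH//; lra.
exists (M ^+ Num.bound (T / del)) => [|t x t0 tT]; first exact: exprn_gt0.
apply: bnd => //; rewrite -ler_pdivrMr//; apply: (@le_trans _ _ (T / del)).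
  by rewrite ler_pM2r// invr_gt0.
have [T0|T0] := leP 0 T; last by have := le_trans t0 tT; rewrite leNgt T0.
by apply/ltW/archi_boundP; rewrite divr_ge0// ltW.
Qed.

Lemma semigroup_uniform_continuity T x (eps : R) : 0 < eps ->
  exists2 del : R, 0 < del & forall s t, 0 <= s -> s <= t -> t <= T -> t - s < del ->
    `|S t x - S s x| < eps.
Proof.
move=> eps0; have [M M0 hM] := semigroup_bounded T.
have [|del del0 hd] := S_right x (eps := eps / M); first exact: divr_gt0.
exists del => // s t s0 st tT tsd.
have ts0 : 0 <= t - s by rewrite subr_ge0.
have {1}-> : t = s + (t - s) by rewrite addrC subrK.
rewrite (sg_add C0S)// -SB// (le_lt_trans (hM _ _ _ _))//; first exact: le_trans tT.
by rewrite mulrC -ltr_pdivlMr//; exact: hd.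
Qed.

Lemma orbit_measurable x :
  strongly_measurable (@lebesgue_measure R) `[0, +oo[%classic (S ^~ x).
Proof.
apply: (continuous_strongly_measurable sepX) => t t0 eps eps0.
have [del del0 hd] := semigroup_uniform_continuity (t + 1) x eps0.
exists (Num.min del 1) => [|s s0]; first by rewrite lt_min del0 ltr01.
rewrite lt_min => /andP[h1 h2]; have [st|ts] := leP s t.
  rewrite distrC; apply: hd => //; first by rewrite lerDl.
  by apply: le_lt_trans h1; rewrite distrC ler_norm.
apply: hd => //; first exact: ltW.
  by rewrite -lerBlDl (le_trans (ler_norm _))// ltW.
by apply: le_lt_trans h1; rewrite ler_norm.
Qed.

Lemma orbit_integral x a b : 0 <= a -> exists I, itv_int a b (S ^~ x) I.
Proof.
move=> a0; have [M M0 hM] := semigroup_bounded b.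
apply: (@itv_int_bounded _ _ sepX _ _ _ (M * `|x|)) => //; first exact: orbit_measurable.
apply: ae_all => t /=; rewrite in_itv/= => /andP[at_ tb].
by apply: hM => //; exact: le_trans at_.
Qed.

Let G t x : X := bochner_integral (@lebesgue_measure R) `[0, t] (S ^~ x).

Let G_int t x : itv_int 0 t (S ^~ x) (G t x).
Proof.
have [I hI] := orbit_integral x t (lexx 0).
by apply: itv_int_of_bochner; have [] := itv_int_bochner hI.
Qed.

Let blS t : 0 <= t -> bounded_linear (S t).
Proof.
move=> t0; split=> [x y|a x|]; [exact: SB|exact: SZ|].
by have [M M0 hM] := semigroup_bounded t; exists M => [|x]; [exact: ltW|exact: hM].
Qed.

(** [int_0^s S (h + r) x dr = int_h^(s + h) S r x dr], because both sides have
    the derivative [S (s + h) x]. *)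
Lemma orbit_integral_shift h t x : 0 <= h -> 0 <= t ->
  S h (G t x) + G h x = G (t + h) x.
Proof.
move=> h0 t0; pose z s := S h (G s x) - (G (s + h) x - G h x).
have G0 : G 0 x = 0 by exact: itv_int_uniq (G_int 0 x) (itv_int_point _ _).
suff : z t - z 0 = 0.
  have -> : z 0 = 0 by rewrite /z G0 S0r// (add0r h) subrr subr0.
  by rewrite subr0 /z => /eqP; rewrite subr_eq0 => /eqP ->; rewrite subrK.
apply: (@small_increments _ _ [set 0]) => //.
- exact: (accessible_closed_set1 (hausdorff_accessible (@norm_hausdorff _ X))).
- by move=> u v -> ->; rewrite addr0.
move=> eps eps0; have eps2 : 0 < eps / 2 by rewrite divr_gt0.
have [del del0 hd] := semigroup_uniform_continuity (t + h) x eps2.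
exists del => // s k s0 k0 kd skt; exists 0 => //; rewrite subr0.
have sk0 : 0 <= s + k by rewrite addr_ge0// ltW.
have ssk : s <= s + k by rewrite lerDl ltW.
have [I1 [I2 [i1 i2 E1]]] := itv_int_split s0 ssk (G_int (s + k) x).
have sh0 : 0 <= s + h by rewrite addr_ge0.
have shk : s + h <= s + k + h by rewrite lerD2r.
have [J1 [J2 [j1 j2 E2]]] := itv_int_split sh0 shk (G_int (s + k + h) x).
have {}i1 := itv_int_uniq i1 (G_int s x); have {}j1 := itv_int_uniq j1 (G_int (s + h) x).
have -> : z (s + k) - z s = S h I2 - J2.
  have -> : z (s + k) = S h I1 + S h I2 - (J1 + J2 - G h x).
    by rewrite /z E1 E2 (bl_add (blS h0)).
  have -> : z s = S h I1 - (J1 - G h x) by rewrite i1 j1.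
  lmod R.
have ek : 0 <= eps / 2 by exact: ltW.
have d1 : `|S h I2 - k *: S (s + h) x| <= eps / 2 * k.
  have := itv_int_linear (blS h0) i2; move=> i2'.
  have := has_int_near_cst (x := S (s + h) x) ssk i2' ek.
  rewrite addrAC subrr add0r; apply=> r sr rk.
  rewrite -(sg_add C0S)//; last exact: le_trans sr.
  apply/ltW/hd => //.
  - by rewrite addrC lerD2l.
  - by rewrite addrC lerD2r (le_trans rk).
  - by lra.
have d2 : `|J2 - k *: S (s + h) x| <= eps / 2 * k.
  have := has_int_near_cst (x := S (s + h) x) shk j2 ek.
  have -> : s + k + h - (s + h) = k by lra.
  apply=> r sr rk; apply/ltW/hd => //; last by lra.
  by rewrite (le_trans rk)// lerD2r.
have -> : S h I2 - J2 = (S h I2 - k *: S (s + h) x) - (J2 - k *: S (s + h) x) by lmod R.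
by rewrite (le_trans (ler_normB _ _))//; lra.
Qed.

Let G_linear t : 0 <= t -> bounded_linear (G t).
Proof.
move=> t0; split=> [x y|a x|].
- apply: (itv_int_uniq (G_int t (x - y))).
  apply: itv_int_eq (itv_intB (G_int t x) (G_int t y)) => r r0 _.
  by rewrite SB.
- apply: (itv_int_uniq (G_int t (a *: x))).
  by apply: itv_int_eq (itv_intZ a (G_int t x)) => r r0 _; rewrite SZ.
- have [M M0 hM] := semigroup_bounded t; exists (M * t) => [|x].
    by rewrite mulr_ge0// ltW.
  rewrite mulrAC -[X in _ * X](subr0 t); apply: (itv_int_norm_le t0 (G_int t x)).
    by rewrite mulr_ge0// ltW.
  by apply: ae_all => r /=; rewrite in_itv/= => /andP[r0 rt]; exact: hM.
Qed.

Let G_pos t g : K g -> K (G t g).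
Proof.
move=> Kg; apply: (itv_int_cone (ss_closed ss)) (G_int t g).
- exact: cone0.
- by move=> x y; exact: coneD.
- by move=> a x; exact: coneZ.
- by apply: ae_all => r /=; rewrite in_itv/= => /andP[r0 _]; exact: S_pos.
Qed.

Let G_mean x (eps : R) : 0 < eps ->
  exists2 del : R, 0 < del & forall h, 0 < h -> h < del -> `|h^-1 *: G h x - x| <= eps.
Proof.
move=> eps0; have [del del0 hd] := S_right x eps0; exists del => // h h0 hdel.
have -> : h^-1 *: G h x - x = h^-1 *: (G h x - (h - 0) *: x).
  by rewrite subr0 scalerBr scalerA mulVf ?gt_eqF// scale1r.
rewrite normrZ gtr0_norm ?invr_gt0// ler_pdivrMl// mulrC -[X in _ * X]subr0.
apply: has_int_near_cst (G_int h x) _ _; [exact: ltW|exact: ltW|].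
by move=> r r0 rh; apply/ltW/hd => //; exact: le_lt_trans hdel.
Qed.

Let gen x (l : X) : (domain L x /\ L x = l) <->
  h^-1 *: (x - S h x) @[h --> 0^'+] --> l.
Proof.
have E : (fun h => h^-1 *: (x - S h x)) = (fun h => - (h^-1 *: (S h x - x))).
  by apply/funext => h; rewrite -scalerN opprB.
have := S_gen x (- l) => -[h1 h2]; split.
  move=> [Dx Lx]; rewrite E -[l]opprK; apply: cvgN; apply: h1; split => //.
  by rewrite /opp_operator/= Lx.
rewrite E => h; have [|Dx /= /eqP] := h2.
  rewrite (_ : (fun h => h^-1 *: (S h x - x)) = (fun h => - - (h^-1 *: (S h x - x)))).
    exact: cvgN h.
  by apply/funext => k; rewrite opprK.
by rewrite eqr_opp => /eqP.
Qed.

Let gen_uniq (F : R -> X) (l l' : X) : F h @[h --> 0^'+] --> l -> F h @[h --> 0^'+] --> l' -> l = l'.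
Proof. exact: (@cvg_unique _ (@norm_hausdorff _ X)). Qed.

(** The integral of an orbit is in the domain, because its difference
    quotients are means of the orbit near both ends. *)
Lemma orbit_integral_generator t x : 0 <= t ->
  domain L (G t x) /\ L (G t x) = x - S t x.
Proof.
move=> t0; apply/gen/at_right_distP => eps eps0.
have [M M0 hM] := semigroup_bounded t.
have e1 : 0 < eps / (2 * (M + 1)) by rewrite divr_gt0// mulr_gt0// ltr_wpDl// ltW.
have [del del0 hd] := G_mean x e1; exists del => // h h0 hdel.
have {}hd := hd h h0 hdel.
have h0' := ltW h0.
have -> : h^-1 *: (G t x - S h (G t x)) - (x - S t x) =
   (h^-1 *: G h x - x) - S t (h^-1 *: G h x - x).
  have e2 : S h (G t x) = S t (G h x) + G t x - G h x.
    apply/(addIr (G h x)); rewrite subrK (orbit_integral_shift x h0' t0).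
    by rewrite (orbit_integral_shift x t0 h0') addrC.
  by rewrite e2 SB// SZ//; lmod R.
rewrite (le_lt_trans (ler_normB _ _))//.
have h2 := hM t (h^-1 *: G h x - x) t0 (lexx t).
have h3 : M * `|h^-1 *: G h x - x| <= M * (eps / (2 * (M + 1))) by rewrite ler_wpM2l// ltW.
apply: (le_lt_trans (lerD hd (le_trans h2 h3))).
rewrite (_ : _ + _ = eps / 2); last by field; rewrite gt_eqF// ltr_wpDl// ltW.
by rewrite ltr_pdivrMr// ltr_pMr// ltr1n.
Qed.

(** [G t] commutes with the difference quotients, so that their limits give [L
    (G t x) = G t (L x)]. *)
Lemma generator_orbit_integral t x : 0 <= t -> domain L x ->
  x - S t x = G t (L x).
Proof.
move=> t0 Dx; have [DG <-] := orbit_integral_generator x t0.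
have h1 := (gen (G t x) (L (G t x))).1 (conj DG erefl).
have h2 := (gen x (L x)).1 (conj Dx erefl).
apply: gen_uniq h1 _; have blG := G_linear t0.
have : G t (h^-1 *: (x - S h x)) @[h --> 0^'+] --> G t (L x).
  exact: (cvg_comp _ _ h2 (@bl_continuous _ _ _ _ blG (L x))).
apply: cvg_trans; apply: near_eq_cvg; near=> h.
have h0 : 0 <= h by apply: ltW; near: h; exact: nbhs_right_gt.
rewrite (bl_scale blG) (bl_sub blG); congr (_ *: (_ - _)).
apply: (itv_int_uniq (G_int t (S h x))).
apply: itv_int_eq (itv_int_linear (blS h0) (G_int t x)) => r r0 _.
by rewrite -!(sg_add C0S)// addrC.
Unshelve. all: end_near. Qed.

Let L_pos g : domain L g -> K g -> K (L g).
Proof.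
move=> Dg Kg; have [l0 l00 hl] := L_bound.
have : le (l0 *: g) (L g) by apply: hl; split.
move=> /(le_coneB ss) h; rewrite -(subrK (l0 *: g) (L g)).
by apply: coneD => //; apply: coneZ => //; exact: ltW.
Qed.

(** On the positive domain [g - S t g] is the integral of the positive orbit
    of [L g]; means over short times approximate any positive vector by the
    domain. *)
Lemma semigroup_decreasing t g : 0 <= t -> K g -> K (g - S t g).
Proof.
move=> t0 Kg.
have c n : 0 < n.+1%:R^-1 :> R by rewrite invr_gt0.
pose u n := n.+1%:R *: G n.+1%:R^-1 g.
have ug : u n @[n --> \oo] --> g.
  apply/cvgn_distP => eps eps0; have e2 : 0 < eps / 2 by rewrite divr_gt0.
  have [del del0 hd] := G_mean g e2; exists (Num.bound del^-1) => n hn.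
  have := hd _ (c n); rewrite invrK => /(_ _)/le_lt_trans; apply; last first.
    by rewrite ltr_pdivrMr// ltr_pMr// ltr1n.
  rewrite -[del]invrK ltf_pV2 ?posrE ?invr_gt0//.
  apply: (lt_le_trans (archi_boundP _)); first by rewrite invr_ge0 ltW.
  by rewrite ler_nat (leq_trans hn).
have bS := blS t0.
apply: (cone_lim ss (u := fun n => u n - S t (u n))).
  by apply: cvgB => //; exact: bl_cvg.
move=> n; have [DG LG] := orbit_integral_generator g (ltW (c n)).
have : K (G n.+1%:R^-1 g - S t (G n.+1%:R^-1 g)).
  rewrite generator_orbit_integral//; apply: G_pos; apply: L_pos => //.
  exact: G_pos.
by rewrite /u SZ// -scalerBr; exact: coneZ.
Qed.

(** The identity [x - S h x = G h (L x)] passes to the limit, and the means [G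
    h y / h] converge to [y]. *)
Lemma generator_closed (u : nat -> X) (x y : X) : (forall n, domain L (u n)) ->
  u n @[n --> \oo] --> x -> L (u n) @[n --> \oo] --> y -> domain L x /\ L x = y.
Proof.
move=> Du ux Ly; apply/gen/at_right_distP => eps eps0.
have e2 : 0 < eps / 2 by rewrite divr_gt0.
have [del del0 hd] := G_mean y e2; exists del => // h h0 hdel.
have -> : x - S h x = G h y.
  apply: (@cvgn_uniq _ _ (fun n => u n - S h (u n))).
    by apply: cvgB => //; apply: (bl_cvg (blS (ltW h0))).
  rewrite (_ : (fun n => _) = fun n => G h (L (u n))).
    by apply: (bl_cvg (G_linear (ltW h0))).
  by apply/funext => n; rewrite generator_orbit_integral// ltW.
apply: (le_lt_trans (hd h h0 hdel)).
by rewrite ltr_pdivrMr// ltr_pMr// ltr1n.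
Qed.

Let L_bound_mass : exists2 C : R, 0 <= C & forall g, domain L g -> K g ->
  mass g <= C * mass (L g).
Proof.
have [l0 l00 hl] := L_bound; exists l0^-1; first by rewrite invr_ge0 ltW.
move=> g Dg Kg; rewrite -ler_pdivrMl ?invr_gt0// invrK -(massZ ss).
by apply: (mass_le ss); apply: (le_coneB ss _ _).1; apply: hl.
Qed.

(** The increasing integrals of the orbit of [g] are bounded by the lower bound
    on [L], which makes them converge, and the decreasing orbit vanish. *)
Lemma generator_cone_surjective g : K g ->
  (exists u, [/\ K u, domain L u & L u = g]) /\ S n%:R g @[n --> \oo] --> (0 : X).
Proof.
move=> Kg; pose u (n : nat) := G n%:R g.
have n0 n : 0 <= n%:R :> R by [].
have Du n : domain L (u n) /\ L (u n) = g - S n%:R g by exact: orbit_integral_generator.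
have Ku n : K (u n) by exact: G_pos.
have [C C0 hC] := L_bound_mass.
have ub n : mass (u n) <= C * mass g.
  have [Dun Lun] := Du n; apply: (le_trans (hC _ Dun (Ku n))).
  rewrite ler_wpM2l// Lun (mass_le ss)// opprB addrC subrK.
  by apply: S_pos.
have uS n : K (u n.+1 - u n).
  rewrite /u -natr1 [_ + 1]addrC -(orbit_integral_shift g (n0 n) (ler01)).
  by rewrite addrK; apply: S_pos => //; exact: G_pos.
have [|v uv _] := mono_cvg ss (u := u) _ uS ub; first exact: Ku.
have S0' : S n%:R g @[n --> \oo] --> (0 : X).
  have nS (n : nat) : n%:R * mass (S n%:R g) <= C * mass g.
    apply: le_trans (ub n); rewrite -(massZ ss); apply: (mass_le ss).
    suff : K (u n - (n%:R - 0) *: S n%:R g) by rewrite subr0.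
    have := itv_intB (G_int n%:R g) (has_int_cst (S n%:R g) (n0 n)).
    apply: (itv_int_cone (ss_closed ss)); [exact: cone0|by move=> x y; exact: coneD|
      by move=> a x; exact: coneZ|].
    apply: ae_all => r /=; rewrite in_itv/= => /andP[r0 rn].
    have -> : n%:R = (n%:R - r) + r by rewrite subrK.
    rewrite (sg_add C0S) ?subr_ge0//; apply: semigroup_decreasing; last exact: S_pos.
    by rewrite subr_ge0.
  apply: (@cvgn_bound _ _ _ _ (fun n => C * mass g * n%:R^-1 *+ (n != 0%N) + `|g| *+ (n == 0%N))).
    case=> [|n] /=; first by rewrite subr0 mulr0n add0r mulr1n (sg_0 C0S).
    rewrite mulr1n mulr0n addr0 subr0 -(mass_cone ss); last exact: S_pos.
    by rewrite ler_pdivlMr ?ltr0n// mulrC; exact: nS.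
  apply/(@cvgn_distP R R^o) => eps eps0.
  exists (Num.bound (C * mass g / eps)).+1 => -[//|n] hn.
  have Cm : 0 <= C * mass g by rewrite mulr_ge0// (mass_ge0 ss).
  rewrite subr0 mulr0n addr0 mulr1n ger0_norm ?divr_ge0// ltr_pdivrMr ?ltr0n//.
  rewrite [eps * _]mulrC -ltr_pdivrMr//; apply: (lt_le_trans (archi_boundP _)).
    by rewrite divr_ge0// ltW.
  by rewrite ler_nat; exact: ltnW.
split => //; exists v.
have [] := @generator_closed u v g _ uv _; [by move=> n; case: (Du n)| |].
  rewrite (_ : (fun n => L (u n)) = fun n => g - S n%:R g); last first.
    by apply/funext => n; case: (Du n).
  by rewrite -[X in _ --> X]subr0; apply: cvgB => //; exact: cvg_cst.
by move=> Dv Lv; split => //; exact: (cone_lim ss uv).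
Qed.

(** A null vector of [L] has a constant orbit, while all orbits tend to [0].
    *)
Lemma generator_injective x : domain L x -> L x = 0 -> x = 0.
Proof.
move=> Dx Lx.
have Sx n : S n%:R x = x.
  have := generator_orbit_integral (ler0n _ n) Dx.
  by rewrite Lx (bl0 (G_linear (ler0n _ n))) => /eqP; rewrite subr_eq0 => /eqP <-.
have [g [g' [Kg Kg' xE]]] := ss_generating ss x.
have [_ h1] := generator_cone_surjective Kg.
have [_ h2] := generator_cone_surjective Kg'.
apply: (@cvgn_uniq _ _ (fun n : nat => S n%:R x)).
  by under eq_fun do rewrite Sx; exact: cvg_cst.
rewrite xE -[X in _ --> X]subr0.
by under eq_fun do rewrite SB//; exact: cvgB.
Qed.

Let L_lin (a : R) x y : domain L x -> domain L y ->
  domain L (a *: x + y) /\ L (a *: x + y) = a *: L x + L y.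
Proof. by case: L_linear => _; apply. Qed.

Let L_inj x y : domain L x -> domain L y -> L x = L y -> x = y.
Proof.
move=> Dx Dy E; apply/eqP; rewrite -subr_eq0; apply/eqP.
have -> : x - y = -1 *: y + x by lmod R.
have [D1 L1] := L_lin (-1) Dy Dx.
by apply: generator_injective => //; rewrite L1 E; lmod R.
Qed.

Local Notation J := (op_inv L).

Let JP x : domain L (J x) /\ L (J x) = x.
Proof.
rewrite /op_inv; case: xgetP => [u _ //|nu]; exfalso.
have [g [g' [Kg Kg' xE]]] := ss_generating ss x.
have [[u [_ Du Lu]] _] := generator_cone_surjective Kg.
have [[v [_ Dv Lv]] _] := generator_cone_surjective Kg'.
have [D1 L1] := L_lin (-1) Dv Du.
by apply: (nu (-1 *: v + u)); split => //; rewrite L1 Lu Lv xE; lmod R.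
Qed.

Let JL g : domain L g -> J (L g) = g.
Proof. by move=> Dg; have [D1 L1] := JP (L g); exact: L_inj. Qed.

Let J_pos x : K x -> K (J x).
Proof.
move=> /generator_cone_surjective[[u [Ku Du <-]] _].
by rewrite JL.
Qed.

Let blJ : bounded_linear J.
Proof.
have Jlin (a : R) x y : J (a *: x + y) = a *: J x + J y.
  have [Dx Lx] := JP x; have [Dy Ly] := JP y.
  have [D1 L1] := L_lin a Dx Dy; have [D2 L2] := JP (a *: x + y).
  by apply: L_inj => //; rewrite L1 L2 Lx Ly.
have J0 : J 0 = 0 by have := Jlin 1 0 0; rewrite !scale1r addr0 -{1}[J 0]addr0 => /addrI.
have JB x y : J (x - y) = J x - J y.
  have -> : x - y = -1 *: y + x by lmod R.
  by rewrite Jlin; lmod R.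
split => // [a x|]; first by rewrite -[a *: x]addr0 Jlin J0 addr0.
have [C C0 hC] := L_bound_mass; have [c c0 hc] := cone_decomposition ss.
exists (C * c + C * c) => [|x]; first by rewrite addr_ge0// mulr_ge0.
have [g [g' [Kg Kg' xE gC gC']]] := hc x.
have JC y : K y -> `|J y| <= C * `|y|.
  move=> Ky; have [Dy Ly] := JP y.
  by rewrite -!(mass_cone ss) ?(le_trans (hC _ Dy _))// ?Ly//; exact: J_pos.
rewrite {1}xE JB (le_trans (ler_normB _ _))// mulrDl lerD// -mulrA.
  by rewrite (le_trans (JC _ Kg))// ler_wpM2l.
by rewrite (le_trans (JC _ Kg'))// ler_wpM2l.
Qed.

Let JG t x : 0 <= t -> J (x - S t x) = G t x.
Proof. by move=> t0; have [DG <-] := orbit_integral_generator x t0; exact: JL. Qed.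

Let J_diff t x : 0 <= t -> J x - S t (J x) = G t x.
Proof.
by move=> t0; have [D1 L1] := JP x; rewrite generator_orbit_integral// L1.
Qed.

Let J_S t x : 0 <= t -> J (S t x) = S t (J x).
Proof.
move=> t0; have := JG x t0; rewrite (bl_sub blJ) -J_diff// => /addrI.
exact: oppr_inj.
Qed.

(** The dyadic difference quotients of an orbit increase; below an element of
    the domain they are bounded, hence they converge. *)
Lemma generator_domain_saturated g x : K g -> K (J x - g) -> exists2 y, K y & g = J y.
Proof.
move=> Kg Kxg; have Kx : K x.
  have [Dx <-] := JP x; apply: L_pos => //; rewrite -(subrK g (J x)).
  exact: coneD.
pose h n : R := 2^-1 ^+ n; have h0 n : 0 < h n by rewrite exprn_gt0// invr_gt0.
have h0' n : 0 <= h n by exact: ltW.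
pose q n := (h n)^-1 *: (g - S (h n) g).
have hS n : h n = h n.+1 + h n.+1 by rewrite /h exprS; field.
have hi n : 0 <= (h n)^-1 by rewrite invr_ge0.
have Kq n : K (q n) by apply: coneZ => //; exact: semigroup_decreasing.
have qS n : K (q n.+1 - q n).
  have -> : q n.+1 - q n = (h n)^-1 *: ((g - S (h n.+1) g) - S (h n.+1) (g - S (h n.+1) g)).
    rewrite /q SB// -(sg_add C0S)// -hS.
    have -> : (h n.+1)^-1 = 2 * (h n)^-1.
      have -> : h n.+1 = h n / 2 by rewrite (hS n); field.
      by field; rewrite gt_eqF.
    lmod R.
  by apply: coneZ => //; apply: semigroup_decreasing => //; exact: semigroup_decreasing.
have qb n : mass (q n) <= mass x.
  apply: (mass_le ss); have -> : x - q n = (h n)^-1 *: (h n *: x - (g - S (h n) g)).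
    by rewrite scalerBr scalerA mulVf ?gt_eqF// scale1r.
  apply: coneZ => //.
  have -> : h n *: x - (g - S (h n) g) = (h n *: x - G (h n) x) +
     ((J x - g) - S (h n) (J x - g)) by rewrite -J_diff// SB//; lmod R.
  apply: coneD => //; last exact: semigroup_decreasing.
  suff : K ((h n - 0) *: x - G (h n) x) by rewrite subr0.
  have := itv_intB (has_int_cst x (h0' n)) (G_int (h n) x).
  apply: (itv_int_cone (ss_closed ss)); [exact: cone0|by move=> u v; exact: coneD|
    by move=> a u; exact: coneZ|].
  apply: ae_all => r /=; rewrite in_itv/= => /andP[r0 rn].
  exact: semigroup_decreasing.
have [y qy _] := mono_cvg ss (Kq 0%N) qS qb.
exists y; first exact: (cone_lim ss qy).
apply: (@cvgn_uniq _ _ (fun n => J (q n))); last exact: bl_cvg.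
apply/cvgn_distP => eps eps0; have e2 : 0 < eps / 2 by rewrite divr_gt0.
have [del del0 hd] := G_mean g e2.
have /cvgn_distP/(_ _ del0)[N hN] := @cvg_geometric_half R 1.
exists N => n /hN; rewrite subr0 mul1r -/(h n) gtr0_norm// => hdel.
rewrite /q (bl_scale blJ) JG//; apply: (le_lt_trans (hd _ (h0 n) hdel)).
by rewrite ltr_pdivrMr// ltr_pMr// ltr1n.
Qed.

(** The first-order bounds hold because [J x - S t (J x)] is the integral of
    the decreasing orbit of [x] over [[0, t]]. *)
Lemma generator_dataP : generator_data le L J S.
Proof.
split => //.
- exact: sg_0 C0S.
- by move=> s t x s0 t0; exact: (sg_add C0S).
- exact: semigroup_decreasing.
- move=> t x t0 Kx; rewrite J_diff//.
  suff : K ((t - 0) *: x - G t x) by rewrite subr0.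
  have := itv_intB (has_int_cst x t0) (G_int t x).
  apply: (itv_int_cone (ss_closed ss)); [exact: cone0|by move=> u v; exact: coneD|
    by move=> a u; exact: coneZ|].
  apply: ae_all => r /=; rewrite in_itv/= => /andP[r0 rn].
  exact: semigroup_decreasing.
- move=> t x t0 Kx; rewrite J_diff//.
  suff : K (G t x - (t - 0) *: S t x) by rewrite subr0.
  have := itv_intB (G_int t x) (has_int_cst (S t x) t0).
  apply: (itv_int_cone (ss_closed ss)); [exact: cone0|by move=> u v; exact: coneD|
    by move=> a u; exact: coneZ|].
  apply: ae_all => r /=; rewrite in_itv/= => /andP[r0 rt].
  have -> : t = (t - r) + r by rewrite subrK.
  rewrite (sg_add C0S) ?subr_ge0//; apply: semigroup_decreasing; last exact: S_pos.
  by rewrite subr_ge0.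
- exact: generator_domain_saturated.
- move=> x eps eps0; have [C C0 hC] := cone_decomposition ss.
  have SC t y : 0 <= t -> `|S t y| <= (C + C) * `|y|.
    move=> t0; have [g [g' [Kg Kg' yE gC gC']]] := hC y.
    have Sg z : K z -> `|S t z| <= `|z|.
      by move=> Kz; apply: (cone_norm_le ss); [exact: S_pos|exact: semigroup_decreasing].
    rewrite {1}yE SB// (le_trans (ler_normB _ _))// mulrDl.
    by rewrite lerD// (le_trans (Sg _ _)).
  have C1 : 0 < C + C + 1 by rewrite ltr_wpDl// addr_ge0.
  have [|del del0 hd] := S_right x (eps := eps / (C + C + 1)); first exact: divr_gt0.
  exists del => // s t s0 st std; have ts0 : 0 <= t - s by rewrite subr_ge0.
  have {1}-> : t = s + (t - s) by rewrite addrC subrK.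
  rewrite (sg_add C0S)// -SB// (le_lt_trans (SC _ _ _))//.
  apply: (@le_lt_trans _ _ ((C + C + 1) * `|S (t - s) x - x|)).
    by rewrite ler_wpM2r// lerDl.
  by rewrite mulrC -ltr_pdivlMr//; exact: hd.
Qed.

End semigroup.

(** * The positive parts of the domains of the powers *)

Section domain_powers.
Context (R : realType) (X : completeNormedModType R) (le : X -> X -> Prop).
Hypothesis ss : state_space le.
Context (L : operator X) (J : X -> X) (S : R -> X -> X).
Hypothesis gd : generator_data le L J S.
Local Notation K := (cone le).
Local Notation mass := (mass le).
Local Notation DP := (domain_pos le L).
Implicit Types (x y g h : X) (t s : R) (k : nat).

Let blJ := gd_J gd.

Lemma L_linearity (a : R) x y : domain L x -> domain L y ->
  domain L (a *: x + y) /\ L (a *: x + y) = a *: L x + L y.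
Proof.
move=> Dx Dy; have -> : a *: x + y = J (a *: L x + L y).
  by rewrite (bl_add blJ) (bl_scale blJ) !(gd_LK gd).
exact: (gd_JK gd).
Qed.

Lemma L_add x y : domain L x -> domain L y -> domain L (x + y) /\ L (x + y) = L x + L y.
Proof. by move=> Dx Dy; have := L_linearity 1 Dx Dy; rewrite !scale1r. Qed.

Lemma L_sub x y : domain L x -> domain L y -> domain L (x - y) /\ L (x - y) = L x - L y.
Proof.
move=> Dx Dy; have := L_linearity (-1) Dy Dx; rewrite !scaleN1r => -[].
by rewrite ![- _ + _]addrC.
Qed.

Lemma L_0 : domain L 0 /\ L 0 = 0.
Proof. by have := gd_JK gd 0; rewrite (bl0 blJ). Qed.

Lemma L_scale (a : R) x : domain L x -> domain L (a *: x) /\ L (a *: x) = a *: L x.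
Proof.
by have [D0 L0] := L_0 => Dx; have := L_linearity a Dx D0; rewrite L0 !addr0.
Qed.

Lemma L_isotone x y : domain L x -> domain L y -> K (y - x) -> K (L y - L x).
Proof.
by move=> Dx Dy Kyx; have [D1 <-] := L_sub Dy Dx; exact: (gd_L_pos gd).
Qed.

Lemma J_reflect x : K (J x) -> K x.
Proof. by have [D1 L1] := gd_JK gd x => /(gd_L_pos gd D1); rewrite L1. Qed.

Lemma iterJ_pos k y : K y -> K (iter k J y).
Proof. by move=> Ky; elim: k => //= k; exact: (gd_J_pos gd). Qed.

Lemma iterLJ k y : iter k L (iter k J y) = y.
Proof.
elim: k y => // k IH y; rewrite iterSr [iter k.+1 J y]/=.
by have [_ ->] := gd_JK gd (iter k J y).
Qed.

(** Positivity passes to the preimages under [J], since [L] is positive. *)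
Lemma domain_posP k g : DP k g <-> exists2 y, K y & g = iter k J y.
Proof.
split=> [[Dg Kg]|[y Ky ->]].
  suff [E Ky] : g = iter k J (iter k L g) /\ K (iter k L g) by exists (iter k L g).
  elim: k Dg => // k IH [/IH[E Ky] Dk]; split; last exact: (gd_L_pos gd).
  by rewrite iterSr [iter k.+1 L g]/= (gd_LK gd Dk).
split; last exact: iterJ_pos.
elim: k y Ky => // k IH y Ky; split; last first.
  by rewrite iterSr iterLJ; case: (gd_JK gd y).
by rewrite iterSr; apply: IH; exact: (gd_J_pos gd).
Qed.

Lemma domain_pos_cone k g : DP k g -> K g. Proof. by case. Qed.

Lemma domain_pos1 g : DP 1 g -> domain L g. Proof. by case=> -[]. Qed.

Lemma domain_pos_J k g : DP k g -> DP k.+1 (J g).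
Proof. by move=> /domain_posP[y Ky ->]; apply/domain_posP; exists y. Qed.

Lemma domain_posS k g : DP k.+1 g -> [/\ domain L g, DP k (L g) & J (L g) = g].
Proof.
move=> /domain_posP[y Ky ->]; rewrite [iter k.+1 J y]/=.
have [D1 L1] := gd_JK gd (iter k J y); split => //; last by rewrite (gd_LK gd D1).
by rewrite L1; apply/domain_posP; exists y.
Qed.

Lemma domain_pos_dom k g : DP k.+1 g -> domain L g.
Proof. by case/domain_posS. Qed.

Lemma domain_pos_L k g : DP k.+1 g -> DP k (L g).
Proof. by case/domain_posS. Qed.

Lemma domain_pos_lower m k g : (m <= k)%N -> DP k g -> DP m g.
Proof.
move=> /subnK <-; elim: (k - m)%N => // j IH; rewrite addSn => -[[Dg _] Kg].
by apply: IH; split.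
Qed.

Lemma domain_pos_iterL j k g : DP (j + k) g -> DP k (iter j L g).
Proof. by elim: j g => // j IH g; rewrite addSn iterSr => /domain_pos_L/IH. Qed.

Lemma domain_pos_add k g h : DP k g -> DP k h -> DP k (g + h).
Proof.
move=> /domain_posP[y Ky ->] /domain_posP[z Kz ->].
apply/domain_posP; exists (y + z); first exact: coneD.
by elim: k => //= k <-; rewrite (bl_add blJ).
Qed.

Lemma domain_pos_scale k (a : R) g : 0 <= a -> DP k g -> DP k (a *: g).
Proof.
move=> a0 /domain_posP[y Ky ->]; apply/domain_posP; exists (a *: y); first exact: coneZ.
by elim: k => //= k <-; rewrite (bl_scale blJ).
Qed.

Lemma domain_pos_0 k : DP k 0.
Proof.
apply/domain_posP; exists 0; first exact: cone0.
by elim: k => //= k <-; rewrite (bl0 blJ).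
Qed.

(** The heredity of the image of the cone under [J], iterated. *)
Lemma domain_pos_saturated k g h : DP k h -> K g -> K (h - g) -> DP k g.
Proof.
elim: k g h => // k IH g h /domain_posS[Dh DLh hE] Kg Khg.
rewrite -hE in Khg; have [y Ky gE] := gd_saturated gd Kg Khg.
rewrite gE; apply: domain_pos_J; apply: (IH _ (L h)) => //.
by apply: J_reflect; rewrite (bl_sub blJ) -gE.
Qed.

Lemma domain_pos_S t k g : 0 <= t -> DP k g -> DP k (S t g).
Proof.
move=> t0 /domain_posP[y Ky ->]; apply/domain_posP; exists (S t y).
  exact: (gd_S_pos gd).
by elim: k => //= k <-; rewrite (gd_JS gd).
Qed.

Lemma L_S t g : 0 <= t -> domain L g -> L (S t g) = S t (L g).
Proof.
move=> t0 Dg; rewrite -{1}(gd_LK gd Dg) -(gd_JS gd)//.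
by case: (gd_JK gd (S t (L g))).
Qed.

Lemma mass_J : exists2 C : R, 0 <= C & forall g, DP 1 g -> mass g <= C * mass (L g).
Proof.
have [C C0 hC] := bl_bound blJ; exists C => // g Dg.
have [D1 [_ KLg] E] := domain_posS Dg.
by rewrite !(mass_cone ss)//; [rewrite -{1}E|exact: domain_pos_cone Dg].
Qed.

(** The images increase with bounded norms, hence converge, and [J] carries
    their limit back. *)
Lemma domain_pos_mono_cvg (u : nat -> X) (B : R) : (forall n, DP 1 (u n)) ->
  (forall n, K (u n.+1 - u n)) -> (forall n, mass (L (u n)) <= B) ->
  exists x, [/\ DP 1 x, u n @[n --> \oo] --> x, L (u n) @[n --> \oo] --> L x &
    forall n, K (x - u n)].
Proof.
move=> Du uS LB; have Dn n := domain_pos_dom (Du n).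
have LS n : K (L (u n.+1) - L (u n)) by exact: L_isotone.
have [|y Ly _] := mono_cvg ss _ LS LB; first by case: (domain_pos_L (Du 0%N)).
have uE : u = fun n => J (L (u n)) by apply/funext => n; rewrite (gd_LK gd).
have ux : u n @[n --> \oo] --> J y by rewrite uE; exact: bl_cvg.
have [DJ LJ] := gd_JK gd y.
exists (J y); split => //; last 2 first.
- by rewrite LJ.
- exact: (incr_cone_lim ss uS ux).
apply: domain_pos_J; split => //; apply: (cone_lim ss Ly) => n.
by case: (domain_pos_L (Du n)).
Qed.

Lemma domain_pos_ooP g : domain_pos_oo le L g <-> forall k, DP k g.
Proof.
split=> [h [|k]|h k _]; [|exact: h|exact: h].
by have [_ Kg] := h 1%N erefl.
Qed.

(** The mean [A e x = (1/e) int_0^e S r x dr], computed from the inverse [J]. *)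
Let A (e : R) x := e^-1 *: J (x - S e x).

Let A_bl e : 0 < e -> bounded_linear (A e).
Proof.
move=> e0; have bS := gd_S gd (ltW e0).
have b1 : bounded_linear (fun x => x - S e x).
  split=> [x y|a x|].
  - by rewrite (bl_sub bS); lmod R.
  - by rewrite (bl_scale bS) scalerBr.
  - have [C C0 hC] := bl_bound bS; exists (1 + C) => [|x]; first exact: addr_ge0.
    by rewrite (le_trans (ler_normB _ _))// mulrDl mul1r lerD2l.
have b2 : bounded_linear ( *:%R e^-1 : X -> X).
  split=> [x y|a x|]; rewrite ?scalerBr ?scalerA 1?mulrC//.
  by exists `|e^-1| => // x; rewrite normrZ.
exact: bounded_linear_comp (bounded_linear_comp b1 blJ) b2.
Qed.

Let A_pos e x : 0 < e -> K x -> K (A e x).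
Proof.
move=> e0 Kx; apply: coneZ => //; first by rewrite invr_ge0 ltW.
by apply: (gd_J_pos gd); apply: (gd_S_decr gd) => //; exact: ltW.
Qed.

Let A_decr e x : 0 < e -> K x -> K (x - A e x).
Proof.
move=> e0 Kx; have -> : x - A e x = e^-1 *: (e *: x - (J x - S e (J x))).
  rewrite /A (bl_sub blJ) (gd_JS gd) ?ltW//; lmod R.
  by field; rewrite gt_eqF.
apply: coneZ => //; first by rewrite invr_ge0 ltW.
by apply: (gd_upper gd) => //; exact: ltW.
Qed.

Let A_near e y : 0 < e -> K y -> K (e *: y - (J y - A e (J y))).
Proof.
move=> e0 Ky; have e0' := ltW e0; have KJy := gd_J_pos gd Ky.
have -> : e *: y - (J y - A e (J y)) = (e *: y - (J y - S e (J y))) +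
    e^-1 *: (J (J y) - S e (J (J y)) - e *: S e (J y)).
  rewrite /A (bl_sub blJ) (gd_JS gd)//; lmod R.
  by field; rewrite gt_eqF.
apply: coneD => //; first exact: (gd_upper gd).
apply: coneZ => //; first by rewrite invr_ge0.
exact: (gd_lower gd).
Qed.

Let A_smooth e k x : 0 < e -> DP k x -> DP k.+1 (A e x).
Proof.
move=> e0 /domain_posP[y Ky ->]; have e0' := ltW e0.
have -> : A e (iter k J y) = J (iter k J (e^-1 *: (y - S e y))).
  rewrite /A -(bl_scale blJ); congr J; elim: k => //= k <-.
  by rewrite (bl_scale blJ) (bl_sub blJ) (gd_JS gd).
apply/domain_pos_J/domain_posP; eexists; last reflexivity.
apply: coneZ => //; first by rewrite invr_ge0.
exact: (gd_S_decr gd).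
Qed.

(** Infinite products of means at the scales [1/2^n, 1/2^(n+1), ...]: the limit
    exists because means decrease, it absorbs one more mean on the left at each
    scale and hence lies in every domain, and removing a mean increases it. *)
Lemma domain_pos_oo_approx f : DP 1 f -> exists u : nat -> X,
  [/\ forall n, domain_pos_oo le L (u n), forall n, K (u n.+1 - u n),
      forall n, K (f - u n) & u n @[n --> \oo] --> f].
Proof.
move=> Df; have Kf := domain_pos_cone Df.
pose e (n : nat) : R := 2^-1 ^+ n.
have e0 n : 0 < e n by rewrite exprn_gt0// invr_gt0.
pose T := fix T m n := if m is j.+1 then A (e n) (T j n.+1) else f.
have TK m n : K (T m n) by elim: m n => [|m IH] n //=; exact: A_pos.
have TS m n : K (T m n - T m.+1 n).
  elim: m n => [|m IH] n; first exact: A_decr.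
  have -> : T m.+1 n - T m.+2 n = A (e n) (T m n.+1 - T m.+1 n.+1).
    by rewrite (bl_sub (A_bl (e0 n))).
  exact: A_pos.
have ex n : exists p, [/\ K p, K (f - p) & T m n @[m --> \oo] --> p].
  have [||m|q uq Kq] := @mono_cvg _ _ _ ss (fun m => f - T m n) (mass f).
  - by rewrite subrr; exact: cone0.
  - move=> m; have -> : f - T m.+1 n - (f - T m n) = T m n - T m.+1 n by lmod R.
    exact: TS.
  - by apply: (mass_le ss); have -> : f - (f - T m n) = T m n by lmod R.
  have Tc : T m n @[m --> \oo] --> f - q.
    rewrite (_ : (fun m => T m n) = fun m => f - (f - T m n)).
      by apply: cvgB => //; exact: cvg_cst.
    by apply/funext => m; lmod R.
  exists (f - q); split => //; first exact: (cone_lim ss Tc).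
  have -> : f - (f - q) = q - (f - T 0 n) by rewrite /= ; lmod R.
  exact: Kq.
have [p pP] := choice ex.
have pA n : p n = A (e n) (p n.+1).
  have [_ _ h] := pP n; have [_ _ h'] := pP n.+1.
  apply: (cvgn_uniq (cvgn_succ h)); rewrite /=.
  exact: (bl_cvg (A_bl (e0 n))).
exists p; split.
- move=> n; apply/domain_pos_ooP => k; elim: k n => [|k IH] n.
    by case: (pP n).
  by rewrite pA; exact: A_smooth.
- by move=> n; rewrite [p n]pA; apply: A_decr => //; case: (pP n.+1).
- by move=> n; case: (pP n).
have [Df1 [_ KLf] fE] := domain_posS Df.
have Tnear m n : K ((2 * e n - 2 * e (n + m)%N) *: L f - (f - T m n)).
  elim: m n => [|m IH] n.
    by rewrite addn0 !subrr scale0r subrr; exact: cone0.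
  have E : 2 * e n - 2 * e (n + m.+1)%N = e n + (2 * e n.+1 - 2 * e (n.+1 + m)%N).
    rewrite addnS addSn; have -> : e n.+1 = e n / 2 by rewrite /e exprS mulrC.
    by field.
  set sg := 2 * e n.+1 - _ in E; rewrite E.
  have sg0 : 0 <= sg.
    rewrite /sg subr_ge0 ler_wpM2l// /e exprD ler_piMr ?exprn_ge0 ?invr_ge0//.
    by rewrite exprn_ile1 ?invr_ge0// invf_le1// ler1n.
  have -> : (e n + sg) *: L f - (f - T m.+1 n) = (e n *: L f - (f - A (e n) f)) +
     sg *: (L f - A (e n) (L f)) + A (e n) (sg *: L f - (f - T m n.+1)).
    have bA := A_bl (e0 n); rewrite !(bl_sub bA) (bl_scale bA) /=; lmod R.
  apply: coneD => //; first apply: coneD => //.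
  - by rewrite -fE; have := A_near (e0 n) KLf; rewrite fE.
  - by apply: coneZ => //; exact: A_decr.
  - by apply: A_pos => //; exact: IH.
apply: (cvgn_bound (b := fun n => 2 * mass (L f) * e n)); last first.
  exact: cvg_geometric_half.
move=> n; have [_ Kfp h] := pP n; rewrite distrC -(mass_cone ss)//.
apply: (@le_trans _ _ (mass ((2 * e n) *: L f))); last first.
  by rewrite (massZ ss) mulrAC.
apply: (mass_le ss).
apply: (cone_lim ss (u := fun m => (2 * e n) *: L f - (f - T m n))).
  by apply: cvgB; [exact: cvg_cst|apply: cvgB => //; exact: cvg_cst].
move=> m; have -> : (2 * e n) *: L f - (f - T m n) =
  ((2 * e n - 2 * e (n + m)%N) *: L f - (f - T m n)) + (2 * e (n + m)%N) *: L f by lmod R.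
by apply: coneD => //; apply: coneZ => //; rewrite mulr_ge0// ltW.
Qed.

End domain_powers.

(** * Measurability and integration through the unbounded operator *)

Section unbounded_operator.
Context (R : realType) (X : completeNormedModType R) (le : X -> X -> Prop).
Hypothesis ss : state_space le.
Context (L : operator X) (J : X -> X) (S : R -> X -> X).
Hypothesis gd : generator_data le L J S.
Local Notation K := (cone le).
Local Notation mass := (mass le).
Local Notation DP := (domain_pos le L).
Local Notation mu := (@lebesgue_measure R).
Local Notation Rplus := (`[0, +oo[%classic : set R).
Implicit Types (x y g h : X) (t s : R).

Lemma semigroup_contraction t x : 0 <= t -> K x -> `|S t x| <= `|x|.
Proof.
move=> t0 Kx; apply: (cone_norm_le ss); first exact: (gd_S_pos gd).
exact: (gd_S_decr gd).
Qed.

Lemma semigroup_uniform_bound : exists2 C : R, 0 <= C &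
  forall t x, 0 <= t -> `|S t x| <= C * `|x|.
Proof.
have [C C0 hC] := cone_decomposition ss.
exists (C + C) => [|t x t0]; first exact: addr_ge0.
have [g [g' [Kg Kg' xE gC gC']]] := hC x.
rewrite {1}xE (bl_sub (gd_S gd t0)) (le_trans (ler_normB _ _))// mulrDl.
by rewrite lerD// (le_trans (semigroup_contraction _ _)).
Qed.

Lemma semigroup_taylor1 t x : 0 <= t -> DP 1 x -> `|x - S t x| <= t * mass (L x).
Proof.
move=> t0 Dx; have [D1 [_ KLx] E] := domain_posS gd Dx.
rewrite -(mass_cone ss); last by apply: (gd_S_decr gd) => //; case: Dx.
rewrite -(massZ ss); apply: (mass_le ss).
by have := gd_upper gd t0 KLx; rewrite E.
Qed.

(** [x - S t x] lies between [t S t (L x)] and [t L x], and these differ by at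
    most [t^2 L (L x)]. *)
Lemma semigroup_taylor2 t x : 0 <= t -> DP 2 x ->
  `|x - S t x - t *: L x| <= t ^+ 2 * mass (L (L x)).
Proof.
move=> t0 Dx; have [D1 DLx E] := domain_posS gd Dx.
have [D2 [_ KLLx] E2] := domain_posS gd DLx; have KLx := domain_pos_cone DLx.
rewrite distrC -(massZ ss) -(mass_cone ss); last first.
  by have := gd_upper gd t0 KLx; rewrite E.
apply: (mass_le ss).
have -> : t ^+ 2 *: L (L x) - (t *: L x - (x - S t x)) =
   t *: (t *: L (L x) - (L x - S t (L x))) + (x - S t x - t *: S t (L x)) by lmod R.
apply: coneD => //; last by have := gd_lower gd t0 KLx; rewrite E.
by apply: coneZ => //; have := gd_upper gd t0 KLLx; rewrite E2.
Qed.

(** [L v] is the limit of the difference quotients [n (v - S (1/n) v)], each a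
    continuous function of [v]. *)
Lemma L_measurable (v : R -> X) : strongly_measurable mu Rplus v ->
  (forall t, 0 <= t -> DP 1 (v t)) -> strongly_measurable mu Rplus (fun t => L (v t)).
Proof.
move=> mv Dv; have h0 n : 0 < n.+1%:R^-1 :> R by rewrite invr_gt0.
have h0' n : 0 <= n.+1%:R^-1 :> R by exact: ltW.
apply: (strongly_measurable_lim (mu := mu) (measurable_itv _) (u := fun n t => n.+1%:R *: (v t - S n.+1%:R^-1 (v t)))) => //.
- exact: (ss_separable ss).
- move=> n; apply: (strongly_measurable_comp (mu := mu)
    (h := fun x : X => n.+1%:R *: (x - S n.+1%:R^-1 x))) => //.
  have bS := gd_S gd (h0' n).
  move=> x; apply: cvgZr; apply: cvgB; first exact: cvg_id.
  exact: (bl_continuous bS).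
apply: ae_all => t; rewrite /= in_itv/= andbT => t0.
have [D1 [_ KL] E] := domain_posS gd (Dv t t0).
apply/cvgn_distP => eps eps0; have [del del0 hd] := gd_cont gd (L (v t)) eps0.
exists (Num.bound del^-1) => n hn.
have hdel : n.+1%:R^-1 < del.
  rewrite -[del]invrK ltf_pV2 ?posrE ?invr_gt0//.
  apply: (lt_le_trans (archi_boundP _)); first by rewrite invr_ge0 ltW.
  by rewrite ler_nat (leq_trans hn).
have := hd 0 n.+1%:R^-1 (lexx _) (h0' n); rewrite subr0 => /(_ hdel).
rewrite (gd_S0 gd); apply: le_lt_trans; rewrite distrC [leRHS]distrC.
have n0 : 0 <= n.+1%:R :> R by [].
have nK (x : X) : n.+1%:R *: (n.+1%:R^-1 *: x) = x.
  by rewrite scalerA mulfV ?scale1r// pnatr_eq0.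
apply: (cone_norm_le ss).
- have := coneZ ss n0 (gd_upper gd (h0' n) KL).
  by rewrite E scalerBr nK.
- have := coneZ ss n0 (gd_lower gd (h0' n) KL).
  rewrite E scalerBr nK.
  set p := S _ (v t); set q := S _ (L (v t)).
  by have -> : L (v t) - q - (L (v t) - n.+1%:R *: (v t - p)) = n.+1%:R *: (v t - p) - q by lmod R.
Qed.

(** Integration commutes with the closed operator [L] in the form given by its
    bounded inverse. *)
Lemma itv_int_J a b (v : R -> X) I : (forall t, a <= t -> t <= b -> domain L (v t)) ->
  itv_int a b (fun t => L (v t)) I -> itv_int a b v (J I).
Proof.
move=> Dv /(itv_int_linear (gd_J gd)); apply: itv_int_eq => t at_ tb.
by rewrite (gd_LK gd (Dv t at_ tb)).
Qed.

Lemma semigroup_convolution_measurable (c t : R) (v : R -> X) : 0 <= c ->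
  strongly_measurable mu Rplus v ->
  strongly_measurable mu Rplus (fun s => S (c * Num.max (t - s) 0) (v s)).
Proof.
move=> c0 mv; have m0 (s : R) : 0 <= c * Num.max (t - s) 0.
  by rewrite mulr_ge0// le_max lexx orbT.
apply: (strongly_measurable_caratheodory (mu := mu) (measurable_itv _)
  (phi := fun s x => S (c * Num.max (t - s) 0) x)) => //.
- exact: (ss_separable ss).
- move=> x; apply: (continuous_strongly_measurable (ss_separable ss)) => s _ eps eps0.
  have [del del0 hd] := gd_cont gd x eps0.
  have c1 : 0 < c + 1 by rewrite ltr_wpDl.
  exists (del / (c + 1)) => [|r r0]; first exact: divr_gt0.
  rewrite ltr_pdivlMr// => rs.
  have key p q : `|p - q| * (c + 1) < del -> p <= q ->
     `|c * Num.max (t - p) 0 - c * Num.max (t - q) 0| < del /\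
     c * Num.max (t - q) 0 <= c * Num.max (t - p) 0.
    move=> pq le_pq; have h : Num.max (t - q) 0 <= Num.max (t - p) 0.
      by rewrite ge_max !le_max lexx !orbT lerB// lexx.
    split; last by rewrite ler_wpM2l.
    rewrite -mulrBr ger0_norm ?mulr_ge0 ?subr_ge0//.
    apply: le_lt_trans pq; rewrite mulrC ler_pM ?subr_ge0 ?lerDl//.
    rewrite distrC ger0_norm ?subr_ge0//.
    have [h1|h1] := leP 0 (t - p); have [h2|h2] := leP 0 (t - q); lra.
  have [sr|rs'] := leP s r.
    rewrite distrC in rs; have [h1 h2] := key s r rs sr.
    by rewrite distrC; apply: hd => //; rewrite ger0_norm ?subr_ge0// in h1.
  have [h1 h2] := key r s rs (ltW rs').
  by apply: hd => //; rewrite ger0_norm ?subr_ge0// in h1.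
- by move=> s _; exact: (bl_continuous (gd_S gd (m0 s))).
Qed.

End unbounded_operator.

(** * The linear problem with a source *)

Lemma lipschitz_measurable (R : realType) (X : completeNormedModType R)
    (sepX : exists2 S : set X, countable S & dense S) (g : R -> X) :
  (forall T : R, exists C : R, forall s t, 0 <= s -> s <= t -> t <= T ->
     `|g t - g s| <= C * (t - s)) ->
  strongly_measurable (@lebesgue_measure R) `[0, +oo[%classic g.
Proof.
move=> gL; apply: (continuous_strongly_measurable sepX) => t t0 eps eps0.
have [C hC] := gL (t + 1).
have C1 : 0 < `|C| + 1 by rewrite ltr_wpDl.
have key p q : 0 <= p -> p <= q -> q <= t + 1 -> (q - p) * (`|C| + 1) < eps ->
    `|g q - g p| < eps.
  move=> p0 pq qt; apply: le_lt_trans; apply: (le_trans (hC p q p0 pq qt)).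
  rewrite [leRHS]mulrC ler_wpM2r ?subr_ge0//.
  by rewrite (le_trans (ler_norm _))// lerDl.
exists (Num.min 1 (eps / (`|C| + 1))) => [|s s0].
  by rewrite lt_min ltr01 divr_gt0.
rewrite lt_min => /andP[s1]; rewrite ltr_pdivlMr// => st.
have [ts|ts] := leP t s.
  rewrite ger0_norm ?subr_ge0// in s1 st.
  by apply: key => //; rewrite -lerBlDl ltW.
rewrite distrC; rewrite distrC gtr0_norm ?subr_gt0// in s1 st.
by apply: key => //; [exact: ltW|rewrite lerDl].
Qed.

Section linear_problem.
Context (R : realType) (X : completeNormedModType R) (le : X -> X -> Prop).
Hypothesis ss : state_space le.
Context (L : operator X) (J : X -> X) (S : R -> X -> X).
Hypothesis gd : generator_data le L J S.
Context (c : R) (c0 : 0 <= c).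
Local Notation K := (cone le).
Local Notation mass := (mass le).
Local Notation DP := (domain_pos le L).
Local Notation mu := (@lebesgue_measure R).
Local Notation Rplus := (`[0, +oo[%classic : set R).
Implicit Types (x y g h : X) (t s : R).

(** Solutions of [w' + c L w = b], [w 0 = w0], in integrated form. The bounds
    on [L^2 w] and on the increments of [L w] make the increments of [w]
    explicit up to second order. *)
Definition linear_solution (w0 : X) (b w : R -> X) : Prop :=
  [/\ forall t, 0 <= t -> DP 2 (w t),
      forall T, exists C : R, forall t, 0 <= t -> t <= T -> mass (L (L (w t))) <= C,
      forall T, exists C : R, forall s t, 0 <= s -> s <= t -> t <= T ->
        `|L (w t) - L (w s)| <= C * (t - s) &
      forall t, 0 <= t -> exists I1 I2, [/\ itv_int 0 t (fun s => L (w s)) I1,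
        itv_int 0 t b I2 & w t + c *: I1 = w0 + I2] ].

Lemma linear_solution_0 w0 b w : linear_solution w0 b w -> w 0 = w0.
Proof.
case=> _ _ _ /(_ 0 (lexx 0))[I1 [I2 [h1 h2]]].
rewrite (itv_int_uniq h1 (itv_int_point _ _)) (itv_int_uniq h2 (itv_int_point _ _)).
by rewrite scaler0 !addr0.
Qed.

Lemma linear_solution_increment w0 b w : linear_solution w0 b w -> forall T,
  exists2 C : R, 0 <= C & forall s k, 0 <= s -> 0 <= k -> s + k <= T ->
    exists2 B, itv_int s (s + k) b B &
      `|w (s + k) - S (c * k) (w s) - B| <= C * k ^+ 2.
Proof.
case=> Dw Lw2 LwL weq T; have [C1 hC1] := Lw2 T; have [C2 hC2] := LwL T.
exists (c ^+ 2 * `|C1| + c * `|C2|) => [|s k s0 k0 skT].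
  by rewrite addr_ge0// mulr_ge0// exprn_ge0.
have sk : s <= s + k by rewrite lerDl.
have sk0 := le_trans s0 sk; have sT := le_trans sk skT.
have [I1 [I2 [h1 h2 E]]] := weq _ s0.
have [I1' [I2' [h1' h2' E']]] := weq _ sk0.
have [A1 [J1 [hA1 hJ1 EA]]] := itv_int_split s0 sk h1'.
have [A2 [B [hA2 hB EB]]] := itv_int_split s0 sk h2'.
rewrite (itv_int_uniq hA1 h1) in EA; rewrite (itv_int_uniq hA2 h2) in EB.
exists B => //; have ck := mulr_ge0 c0 k0.
have -> : w (s + k) - S (c * k) (w s) - B =
   (w s - S (c * k) (w s) - (c * k) *: L (w s)) - c *: (J1 - k *: L (w s)).
  have -> : w (s + k) = w s + B - c *: J1.
    apply: (addIr (c *: (I1 + J1))); rewrite -EA E' EB addrA -E EA; lmod R.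
  by lmod R.
apply: (le_trans (ler_normB _ _)); rewrite mulrDl; apply: lerD.
  apply: (le_trans (semigroup_taylor2 ss gd ck (Dw s s0))).
  rewrite exprMn mulrAC ler_wpM2r ?exprn_ge0// ler_wpM2l ?exprn_ge0//.
  by apply: le_trans (ler_norm _); exact: hC1.
rewrite normrZ ger0_norm// -mulrA ler_wpM2l//.
have -> : k *: L (w s) = (s + k - s) *: L (w s) by rewrite addrAC subrr add0r.
have Ck : 0 <= `|C2| * k by exact: mulr_ge0.
apply: (le_trans (has_int_near_cst sk hJ1 Ck _)) => [t st tk|].
  apply: (le_trans (hC2 s t s0 st (le_trans tk skT))).
  apply: (@le_trans _ _ (`|C2| * (t - s))); last by rewrite ler_wpM2l// lerBlDl.
  by rewrite ler_wpM2r ?subr_ge0// ler_norm.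
by rewrite addrAC subrr add0r expr2 mulrA.
Qed.

(** Transporting the difference of two solutions by the semigroup up to a final
    time, its increments are those of the difference of the sources, up to
    second order. *)
Lemma linear_solution_comparison w0 w0' b b' w w' :
  linear_solution w0 b w -> linear_solution w0' b' w' -> K (w0' - w0) ->
  (forall s, 0 <= s -> K (b' s - b s)) -> forall t, 0 <= t -> K (w' t - w t).
Proof.
move=> sw sw' Kw0 Kb T T0.
have [C1 C10 h1] := linear_solution_increment sw T.
have [C2 C20 h2] := linear_solution_increment sw' T.
have [Cs Cs0 hCs] := semigroup_uniform_bound ss gd.
pose u s := w' s - w s; pose z s := S (c * (T - s)) (u s).
have zT : z T = u T by rewrite /z subrr mulr0 (gd_S0 gd).
have Kz0 : K (z 0).
  rewrite /z /u (linear_solution_0 sw) (linear_solution_0 sw').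
  by apply: (gd_S_pos gd) => //; rewrite mulr_ge0// subr0.
suff : K (z T - z 0) by rewrite zT => h; rewrite -(subrK (z 0) (w' T - w T)); exact: coneD.
apply: small_increments => //; [exact: (ss_closed ss)|exact: cone0|by move=> x y; exact: coneD|].
move=> eps eps0; have Cp : 0 < Cs * (C1 + C2) + 1 by rewrite ltr_wpDl// mulr_ge0// addr_ge0.
exists (eps / (Cs * (C1 + C2) + 1)) => [|s k s0 k0 kd skT]; first exact: divr_gt0.
have [B hB eB] := h1 s k s0 (ltW k0) skT.
have [B' hB' eB'] := h2 s k s0 (ltW k0) skT.
have r0 : 0 <= c * (T - (s + k)) by rewrite mulr_ge0// subr_ge0.
have ck : 0 <= c * k by rewrite mulr_ge0// ltW.
have bS := gd_S gd r0; have bS' := gd_S gd ck.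
exists (S (c * (T - (s + k))) (B' - B)).
  apply: (gd_S_pos gd) => //; apply: (itv_int_cone (ss_closed ss)) (itv_intB hB' hB).
  - exact: cone0.
  - by move=> x y; exact: coneD.
  - by move=> a x; exact: coneZ.
  - apply: ae_all => t; rewrite /= in_itv/= => /andP[st _]; apply: Kb; exact: le_trans st.
have -> : z (s + k) - z s - S (c * (T - (s + k))) (B' - B) =
   S (c * (T - (s + k))) ((w' (s + k) - S (c * k) (w' s) - B') -
      (w (s + k) - S (c * k) (w s) - B)).
  have -> : z s = S (c * (T - (s + k))) (S (c * k) (u s)).
    by rewrite -(gd_SD gd)// /z; congr (S _ _); ring.
  by rewrite /z /u -!(bl_sub bS) (bl_sub bS'); congr (S _ _); lmod R.
apply: (le_trans (hCs _ _ r0)).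
apply: (@le_trans _ _ (Cs * ((C2 + C1) * k ^+ 2))).
  by rewrite ler_wpM2l// (le_trans (ler_normB _ _))// mulrDl lerD.
rewrite ltr_pdivlMr// in kd; rewrite addrC expr2 !mulrA ler_pM2r//.
apply: le_trans (ltW kd); rewrite [leRHS]mulrC ler_pM2r// lerDl//.
Qed.

(** The variation of constants formula defines [w]. It is positive and below
    [w0 + int b], which puts it in the domain of [L^2]; the integrated
    equation holds because its defect has increments of second order. *)
Lemma linear_solution_exists w0 b : DP 2 w0 -> strongly_measurable mu Rplus b ->
  (forall t, 0 <= t -> DP 1 (b t)) ->
  (forall T, exists C : R, forall t, 0 <= t -> t <= T -> mass (L (b t)) <= C) ->
  (forall T, 0 <= T -> exists2 F, DP 2 F &
     forall I, itv_int 0 T b I -> K (F - (w0 + I))) ->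
  exists2 w, linear_solution w0 b w &
    forall t, 0 <= t -> exists2 I, itv_int 0 t b I & K (w0 + I - w t).
Proof.
move=> Dw0 mb Db Lb hF; have sepX := ss_separable ss.
have [CJ CJ0 hCJ] := mass_J ss gd.
have Kb t : 0 <= t -> K (b t) by move=> /Db; case.
have DLb t : 0 <= t -> domain L (b t) by move=> /Db; exact: (domain_pos_dom gd).
have KLb t : 0 <= t -> K (L (b t)) by move=> /Db/(domain_pos_L gd)[].
have bnd T : exists2 C : R, 0 <= C & forall t, 0 <= t -> t <= T ->
    `|L (b t)| <= C /\ `|b t| <= C.
  have [C hC] := Lb T; exists ((CJ + 1) * `|C|) => [|t t0 tT].
    by rewrite mulr_ge0// addr_ge0.
  have h := hC t t0 tT; have h' := le_trans h (ler_norm _).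
  rewrite -(mass_cone ss (KLb t t0)) -(mass_cone ss (Kb t t0)) mulrDl mul1r; split.
    by rewrite ler_wpDl// mulr_ge0.
  by rewrite ler_wpDr// (le_trans (hCJ _ (Db t t0)))// ler_wpM2l.
have mx0 (t s : R) : 0 <= c * Num.max (t - s) 0 by rewrite mulr_ge0// le_max lexx orbT.
have conv v a t : 0 <= a -> strongly_measurable mu Rplus v ->
    (forall s, 0 <= s -> K (v s)) ->
    (exists2 C : R, 0 <= C & forall s, 0 <= s -> s <= t -> `|v s| <= C) ->
    exists I, itv_int a t (fun s => S (c * Num.max (t - s) 0) (v s)) I.
  move=> a0 mv Kv [C _ hC]; apply: (itv_int_bounded sepX (C := C)) => //.
    exact: (semigroup_convolution_measurable ss gd).
  apply: ae_all => s; rewrite /= in_itv/= => /andP[as_ st].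
  have s0 := le_trans a0 as_.
  by apply: le_trans (hC s s0 st); apply: (semigroup_contraction ss gd) => //; exact: Kv.
have bI a t : 0 <= a -> exists I, itv_int a t b I.
  move=> a0; have [C _ hC] := bnd t.
  apply: (itv_int_bounded sepX (C := C)) => //; apply: ae_all => s.
  by rewrite /= in_itv/= => /andP[as_ st]; have [] := hC s (le_trans a0 as_) st.
pose conv_b t s := S (c * Num.max (t - s) 0) (b s).
have bconv a t : 0 <= a -> exists I, itv_int a t (conv_b t) I.
  by move=> a0; apply: conv => //; have [C C0 hC] := bnd t; exists C => // s s0 st;
    have [] := hC s s0 st.
have [W hW] := choice (fun t => bconv 0 t (lexx 0)).
have int_pos a t v I : 0 <= a -> (forall s, a <= s -> s <= t -> K (v s)) ->
    itv_int a t v I -> K I.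
  move=> a0 Kv; apply: (itv_int_cone (ss_closed ss)).
  - exact: cone0.
  - by move=> x y; exact: coneD.
  - by move=> k x; exact: coneZ.
  - by apply: ae_all => s; rewrite /= in_itv/= => /andP[as_ st]; exact: Kv.
pose w t := S (c * t) w0 + W t.
have Kw0 := domain_pos_cone Dw0.
have Kw t : 0 <= t -> K (w t).
  move=> t0; apply: coneD => //; first by apply: (gd_S_pos gd) => //; exact: mulr_ge0.
  apply: int_pos (hW t) => // s s0 _; apply: (gd_S_pos gd) => //; exact: Kb.
have upper t I : 0 <= t -> itv_int 0 t b I -> K (w0 + I - w t).
  move=> t0 hI; have -> : w0 + I - w t = (w0 - S (c * t) w0) + (I - W t).
    by rewrite /w; lmod R.
  apply: coneD => //; first by apply: (gd_S_decr gd) => //; exact: mulr_ge0.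
  apply: (int_pos 0 t _ _ _ _ (itv_intB hI (hW t))) => // s s0 st.
  by apply: (gd_S_decr gd) => //; exact: Kb.
have dom T : 0 <= T -> exists2 F, DP 2 F & forall t, 0 <= t -> t <= T -> K (F - w t).
  move=> T0; have [F DF hFI] := hF T T0; have [I hI] := bI 0 T (lexx 0).
  exists F => // t t0 tT; have [I1 [I2 [h1 h2 IE]]] := itv_int_split t0 tT hI.
  have -> : F - w t = (F - (w0 + I)) + (w0 + I1 - w t) + I2 by rewrite IE; lmod R.
  apply: coneD => //; first by apply: coneD => //; [exact: hFI|exact: upper].
  by apply: int_pos h2 => // s ts _; apply: Kb; exact: le_trans ts.
have Dw t : 0 <= t -> DP 2 (w t).
  move=> t0; have [F DF hFt] := dom t t0.
  by apply: (domain_pos_saturated gd DF); [exact: Kw|exact: hFt].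
have Lw2 T : exists2 C : R, 0 <= C & forall t, 0 <= t -> t <= T -> mass (L (L (w t))) <= C.
  have [T0|T0] := leP 0 T; last first.
    by exists 0 => // t t0 /le_lt_trans/(_ T0)/(le_lt_trans t0); rewrite ltxx.
  have [F DF hFt] := dom T T0; exists (mass (L (L F))) => [|t t0 tT].
    by apply: (mass_ge0 ss); case: (domain_pos_L gd (domain_pos_L gd DF)).
  have [D1 D2 _] := domain_posS gd DF; have [D3 D4 _] := domain_posS gd (Dw t t0).
  apply: (mass_le ss); apply: (L_isotone gd);
    [exact: (domain_pos_dom gd D4)|exact: (domain_pos_dom gd D2)|].
  by apply: (L_isotone gd) => //; exact: hFt.
have flow t k : 0 <= t -> 0 <= k -> exists E, itv_int t (t + k) (conv_b (t + k)) E /\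
    w (t + k) = S (c * k) (w t) + E.
  move=> t0 k0; have tk : t <= t + k by rewrite lerDl.
  have [A [E [hA hE AE]]] := itv_int_split t0 tk (hW (t + k)).
  exists E; split => //; have ck := mulr_ge0 c0 k0; have bS := gd_S gd ck.
  rewrite /w AE (bl_add bS) -(gd_SD gd) ?mulr_ge0// -mulrDr [k + t]addrC -!addrA.
  congr (_ + (_ + _)); apply: (itv_int_uniq hA).
  apply: itv_int_eq (itv_int_linear bS (hW t)) => s s0 st.
  rewrite /conv_b -(gd_SD gd)// -mulrDr; congr (S (c * _) _).
  rewrite !max_l ?subr_ge0//; last exact: le_trans tk.
  by rewrite addrA [k + t]addrC.
have mLb := L_measurable ss gd mb Db.
have source T : exists2 C : R, 0 <= C & forall t k E, 0 <= t -> 0 <= k -> t + k <= T ->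
    itv_int t (t + k) (conv_b (t + k)) E ->
    [/\ domain L E, `|L E| <= C * k & forall B, itv_int t (t + k) b B ->
        `|E - B| <= c * C * k ^+ 2].
  have [C C0 hC] := bnd T; exists C => // t k E t0 k0 tkT hE.
  have tk : t <= t + k by rewrite lerDl.
  have [|E' hE'] := conv (fun s => L (b s)) t (t + k) t0 mLb KLb.
    by exists C => // s s0 st; have [] := hC s s0 (le_trans st tkT).
  have EE : E = J E'.
    apply: (itv_int_uniq hE); apply: itv_int_eq (itv_int_linear (gd_J gd) hE') => s ts st.
    by rewrite (gd_JS gd)// (gd_LK gd)//; apply: DLb; exact: le_trans ts.
  have [DE LE] := gd_JK gd E'; rewrite EE LE; split => //.
    have := itv_int_norm_le tk hE' C0; rewrite [t + k]addrC addrK; apply.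
    apply: ae_all => s; rewrite /= in_itv/= => /andP[ts st].
    have s0 := le_trans t0 ts; have {}st : s <= t + k by rewrite (le_trans st)// addrC.
    have [h _] := hC s s0 (le_trans st tkT).
    by apply: le_trans h; apply: (semigroup_contraction ss gd) => //; exact: KLb.
  move=> B hB; rewrite -EE; have ckC : 0 <= c * k * C by rewrite !mulr_ge0.
  have := itv_int_norm_le tk (itv_intB hE hB) ckC; rewrite [t + k]addrC addrK.
  rewrite (_ : c * k * C * k = c * C * k ^+ 2); last by ring.
  apply; apply: ae_all => s; rewrite /= in_itv/= => /andP[ts st].
  have s0 := le_trans t0 ts; have {}st : s <= t + k by rewrite (le_trans st)// addrC.
  have [h _] := hC s s0 (le_trans st tkT).
  rewrite distrC; apply: (le_trans (semigroup_taylor1 ss gd (mx0 _ _) (Db s s0))).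
  rewrite (mass_cone ss (KLb s s0)); apply: ler_pM => //.
  by rewrite ler_wpM2l// ge_max k0 andbT lerBlDl addrC lerD2r.
have LwL T : exists2 C : R, 0 <= C & forall s t, 0 <= s -> s <= t -> t <= T ->
    `|L (w t) - L (w s)| <= C * (t - s).
  have [C1 C10 h1] := Lw2 T; have [C2 C20 h2] := source T.
  exists (c * C1 + C2) => [|s t s0 st tT]; first by rewrite addr_ge0// mulr_ge0.
  have k0 : 0 <= t - s by rewrite subr_ge0.
  have [E []] := flow s (t - s) s0 k0; rewrite [s + _]addrC subrK => hE wE.
  have := h2 s (t - s) E s0 k0; rewrite [s + _]addrC subrK => /(_ tT hE)[DE LE _].
  have ck := mulr_ge0 c0 k0; have Dws := Dw s s0; have [D1 D2 _] := domain_posS gd Dws.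
  have [_ ->] : domain L (w t) /\ L (w t) = S (c * (t - s)) (L (w s)) + L E.
    rewrite wE -(L_S gd ck D1); apply: (L_add gd) => //.
    exact: (domain_pos_dom gd (domain_pos_S gd ck Dws)).
  rewrite addrAC (le_trans (ler_normD _ _))// mulrDl lerD// distrC.
  apply: (le_trans (semigroup_taylor1 ss gd ck D2)).
  by rewrite mulrAC ler_wpM2r// ler_wpM2l// h1// (le_trans st).
have mLw : strongly_measurable mu Rplus (fun t => L (w t)).
  by apply: lipschitz_measurable => // T; have [C _ hC] := LwL T; exists C.
have LwI t : 0 <= t -> exists I, itv_int 0 t (fun s => L (w s)) I.
  move=> t0; have [C C0 hC] := LwL t.
  apply: (itv_int_bounded sepX (C := `|L (w 0)| + C * t)) => //.
  apply: ae_all => s; rewrite /= in_itv/= => /andP[s0 st].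
  rewrite -(subrK (L (w 0)) (L (w s))) (le_trans (ler_normD _ _))// addrC lerD2l.
  by rewrite (le_trans (hC _ _ (lexx 0) s0 st))// subr0 ler_wpM2l.
have /choice[I1 hI1] (t : R) : exists I, 0 <= t -> itv_int 0 t (fun s => L (w s)) I.
  by have [/LwI[I hI]|h] := leP 0 t; [exists I|exists 0 => t0].
have [I2 hI2] := choice (fun t => bI 0 t (lexx 0)).
exists w; last by move=> t t0; exists (I2 t) => //; exact: upper.
split => //.
- by move=> T; have [C _ hC] := Lw2 T; exists C.
- by move=> T; have [C _ hC] := LwL T; exists C.
move=> T T0; exists (I1 T), (I2 T); split => //; first exact: hI1.
pose z t := w t + c *: I1 t - I2 t.
have z0 : z 0 = w0.
  rewrite /z /w (itv_int_uniq (hI1 0 (lexx 0)) (itv_int_point _ _)).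
  rewrite (itv_int_uniq (hI2 0) (itv_int_point _ _)) (itv_int_uniq (hW 0) (itv_int_point _ _)).
  by rewrite mulr0 (gd_S0 gd) scaler0 subr0 !addr0.
suff : [set 0] (z T - z 0).
  by rewrite /= z0 /z => h; apply/eqP; rewrite -subr_eq0; apply/eqP; rewrite -[RHS]h; lmod R.
apply: small_increments => //; [exact: accessible_closed_set1 (hausdorff_accessible (@norm_hausdorff _ _)) _|by move=> x y -> ->; rewrite addr0|].
have [C1 C10 h1] := Lw2 T; have [C2 C20 h2] := source T; have [C3 C30 h3] := LwL T.
pose C := c ^+ 2 * C1 + c * C2 + c * C3.
have C0 : 0 <= C by rewrite /C !addr_ge0// mulr_ge0// exprn_ge0.
move=> eps eps0; exists (eps / (C + 1)) => [|t k t0 k0 kd tkT].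
  by rewrite divr_gt0// ltr_wpDl.
exists 0 => //; rewrite subr0; have k0' := ltW k0; have tk : t <= t + k by rewrite lerDl.
have tk0 := le_trans t0 tk.
have [E [hE wE]] := flow t k t0 k0'; have [_ _ hEB] := h2 t k E t0 k0' tkT hE.
have [A1 [J1 [hA1 hJ1 EA]]] := itv_int_split t0 tk (hI1 _ tk0).
have [A2 [B [hA2 hB EB]]] := itv_int_split t0 tk (hI2 (t + k)).
rewrite (itv_int_uniq hA1 (hI1 t t0)) in EA; rewrite (itv_int_uniq hA2 (hI2 t)) in EB.
have ck := mulr_ge0 c0 k0'.
have -> : z (t + k) - z t = - (w t - S (c * k) (w t) - (c * k) *: L (w t)) + (E - B) +
   c *: (J1 - k *: L (w t)) by rewrite /z wE EA EB; lmod R.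
apply: (@le_trans _ _ (C * k ^+ 2)); last first.
  rewrite expr2 mulrA ler_pM2r//; rewrite ltr_pdivlMr ?ltr_wpDl// in kd.
  by apply: le_trans (ltW kd); rewrite mulrC ler_pM2l// lerDl.
rewrite /C !mulrDl; apply: (le_trans (ler_normD _ _)); apply: lerD.
  apply: (le_trans (ler_normD _ _)); apply: lerD; last exact: hEB.
  rewrite normrN; apply: (le_trans (semigroup_taylor2 ss gd ck (Dw t t0))).
  rewrite exprMn mulrAC ler_wpM2r ?exprn_ge0// ler_wpM2l ?exprn_ge0//.
  by apply: h1 => //; exact: le_trans tkT.
rewrite normrZ ger0_norm// -mulrA ler_wpM2l//.
have -> : k *: L (w t) = (t + k - t) *: L (w t) by rewrite addrAC subrr add0r.
have Ck : 0 <= C3 * k by exact: mulr_ge0.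
apply: (le_trans (has_int_near_cst tk hJ1 Ck _)) => [s ts st|].
  apply: (le_trans (h3 t s t0 ts (le_trans st tkT))).
  by rewrite ler_wpM2l// lerBlDl.
by rewrite addrAC subrr add0r expr2 mulrA.
Qed.

End linear_problem.

(** * Smooth positive paths *)

Section smooth_paths.
Context (R : realType) (X : completeNormedModType R) (le : X -> X -> Prop).
Hypothesis ss : state_space le.
Context (L : operator X) (J : X -> X) (S : R -> X -> X).
Hypothesis gd : generator_data le L J S.
Local Notation K := (cone le).
Local Notation mass := (mass le).
Local Notation DP := (domain_pos le L).
Local Notation DPoo := (domain_pos_oo le L).
Local Notation mu := (@lebesgue_measure R).
Local Notation Rplus := (`[0, +oo[%classic : set R).
Implicit Types (x y g h : X) (t s : R) (k : nat).

Lemma mass_bounded_linear : bounded_linear (mass : X -> R^o).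
Proof.
split; [exact: (massB ss)|exact: (massZ ss)|].
by have [C C0 hC] := mass_bounded ss; exists C.
Qed.

Lemma itv_int_pos a b (f : R -> X) I : 0 <= a -> (forall t, 0 <= t -> K (f t)) ->
  itv_int a b f I -> K I.
Proof.
move=> a0 Kf; apply: (itv_int_cone (ss_closed ss)); [exact: cone0|
  by move=> x y; exact: coneD|by move=> k x; exact: coneZ|].
by apply: ae_all => t; rewrite /= in_itv/= => /andP[at_ _]; apply: Kf; exact: le_trans at_.
Qed.

Lemma domain_pos_iterJK k x : DP k x -> iter k J (iter k L x) = x.
Proof. by move=> /(domain_posP gd)[y _ ->]; rewrite (iterLJ gd). Qed.

Lemma iterJ_bounded_linear k : bounded_linear (iter k J).
Proof.
elim: k => [|k IH]; last exact: bounded_linear_comp IH (gd_J gd).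
by split=> //; exists 1 => // x; rewrite mul1r.
Qed.

Lemma iterJ_reflect k x : K (iter k J x) -> K x.
Proof. by elim: k => // k IH /(J_reflect gd)/IH. Qed.

Lemma iterL_isotone k x y : DP k x -> DP k y -> K (y - x) ->
  K (iter k L y - iter k L x).
Proof.
move=> Dx Dy Kyx; apply: (@iterJ_reflect k).
by rewrite (bl_sub (iterJ_bounded_linear k)) !domain_pos_iterJK.
Qed.

Lemma iterL_add k x y : DP k x -> DP k y -> iter k L (x + y) = iter k L x + iter k L y.
Proof.
move=> Dx Dy; rewrite -{1}(domain_pos_iterJK Dx) -{1}(domain_pos_iterJK Dy).
by rewrite -(bl_add (iterJ_bounded_linear k)) (iterLJ gd).
Qed.

Lemma iterL_scale k (a : R) x : DP k x -> iter k L (a *: x) = a *: iter k L x.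
Proof.
move=> Dx; rewrite -{1}(domain_pos_iterJK Dx).
by rewrite -(bl_scale (iterJ_bounded_linear k)) (iterLJ gd).
Qed.

Lemma domain_pos_oo_cone x : DPoo x -> K x.
Proof. by move=> /(domain_pos_ooP le L)/(_ 0%N)[]. Qed.

Lemma domain_pos_oo_k k x : DPoo x -> DP k x.
Proof. by move=> /(domain_pos_ooP le L)/(_ k). Qed.

Lemma domain_pos_oo_L x : DPoo x -> DPoo (L x).
Proof.
move=> /(domain_pos_ooP le L) h; apply/(domain_pos_ooP le L) => k.
exact: (domain_pos_L gd (h k.+1)).
Qed.

Lemma domain_pos_oo_add x y : DPoo x -> DPoo y -> DPoo (x + y).
Proof. by move=> hx hy k k0; apply: (domain_pos_add ss gd); [exact: hx|exact: hy]. Qed.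

Lemma domain_pos_oo_scale (a : R) x : 0 <= a -> DPoo x -> DPoo (a *: x).
Proof. by move=> a0 hx k k0; apply: (domain_pos_scale ss gd) => //; exact: hx. Qed.

Lemma domain_pos_oo_saturated g h : DPoo h -> K g -> K (h - g) -> DPoo g.
Proof. by move=> hh Kg Khg k k0; apply: (domain_pos_saturated gd (hh k k0)). Qed.

(** The regularity needed to integrate every power of [L] along a path; it is
    inherited by smaller positive paths. *)
Definition smooth_path (g : R -> X) : Prop :=
  [/\ strongly_measurable mu Rplus g, forall t, 0 <= t -> DPoo (g t) &
    forall k T, 0 <= T -> exists I, itv_int 0 T (fun s => iter k L (g s)) I].

Lemma iterL_measurable k (g : R -> X) : strongly_measurable mu Rplus g ->
  (forall t, 0 <= t -> DPoo (g t)) -> strongly_measurable mu Rplus (fun s => iter k L (g s)).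
Proof.
move=> mg Dg; elim: k => // k IH; apply: (L_measurable ss gd IH) => t t0.
apply: (domain_pos_iterL gd); rewrite addn1; exact: domain_pos_oo_k (Dg t t0).
Qed.

(** Domains are hereditary and the powers of [L] isotone, so every [L^k g] is
    dominated in norm by [L^k h]. *)
Lemma smooth_path_dominated (g : R -> X) : strongly_measurable mu Rplus g ->
  (forall t, 0 <= t -> K (g t)) ->
  (forall T, 0 <= T -> exists2 h, smooth_path h &
     forall t, 0 <= t -> t <= T -> K (h t - g t)) -> smooth_path g.
Proof.
move=> mg Kg H; have Dg t : 0 <= t -> DPoo (g t).
  move=> t0; have [h [_ Dh _] hg] := H t t0.
  by apply: (domain_pos_oo_saturated (Dh t t0)); [exact: Kg|exact: hg].
split => // k T T0; have [h [_ Dh Ih] hg] := H T T0; have [I hI] := Ih k T T0.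
apply: (itv_int_dominated (ss_separable ss) _ _ hI) => //; first exact: iterL_measurable.
apply: ae_all => t; rewrite /= in_itv/= => /andP[t0 tT].
have D1 := domain_pos_oo_k k (Dg t t0); have D2 := domain_pos_oo_k k (Dh t t0).
apply: (cone_norm_le ss); last by apply: iterL_isotone => //; exact: hg.
have := domain_pos_oo_k (k + 0) (Dg t t0).
by move=> /(domain_pos_iterL gd)[].
Qed.

Lemma smooth_path_add (g h : R -> X) : smooth_path g -> smooth_path h ->
  smooth_path (fun t => g t + h t).
Proof.
move=> [mg Dg Ig] [mh Dh Ih]; split.
- exact: strongly_measurableD.
- by move=> t t0; apply: domain_pos_oo_add; [exact: Dg|exact: Dh].
move=> k T T0; have [I hI] := Ig k T T0; have [I' hI'] := Ih k T T0.
exists (I + I'); apply: itv_int_eq (itv_intD hI hI') => t t0 _.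
by rewrite iterL_add//; apply: domain_pos_oo_k; [exact: Dg|exact: Dh].
Qed.

Lemma smooth_path_cst x : DPoo x -> smooth_path (fun=> x).
Proof.
move=> Dx; split => // [|k T T0]; first exact: strongly_measurable_cst.
by exists ((T - 0) *: iter k L x); exact: has_int_cst.
Qed.

Lemma smooth_path_int (g : R -> X) T k I Ik : smooth_path g ->
  itv_int 0 T g I -> itv_int 0 T (fun s => iter k L (g s)) Ik ->
  I = iter k J Ik.
Proof.
move=> [_ Dg _] hI hIk; apply: (itv_int_uniq hI).
apply: itv_int_eq (itv_int_linear (iterJ_bounded_linear k) hIk) => t t0 _.
by rewrite domain_pos_iterJK//; apply: domain_pos_oo_k; exact: Dg.
Qed.

Lemma smooth_path_int_oo (g : R -> X) T I : smooth_path g -> 0 <= T ->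
  itv_int 0 T g I -> DPoo I.
Proof.
move=> sg T0 hI; apply/(domain_pos_ooP le L) => k.
have [_ Dg Ig] := sg; have [Ik hIk] := Ig k T T0.
apply/(domain_posP gd); exists Ik; last exact: (smooth_path_int sg hI).
apply: itv_int_pos hIk => // t t0; have := domain_pos_oo_k (k + 0) (Dg t t0).
by move=> /(domain_pos_iterL gd)[].
Qed.

(** The iterates stay in this class, which is what keeps all their moments
    finite. *)
Definition tame (f : R -> X) : Prop :=
  [/\ strongly_measurable mu Rplus f, forall t, 0 <= t -> K (f t) &
    forall T, 0 <= T -> exists2 F, DPoo F & forall t, 0 <= t -> t <= T -> K (F - f t)].

Lemma tame_smooth f : tame f -> smooth_path f.
Proof.
move=> [mf Kf hF]; apply: smooth_path_dominated => // T /hF[F DF hFf].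
by exists (fun=> F) => //; exact: smooth_path_cst.
Qed.

Lemma tame_oo f t : tame f -> 0 <= t -> DPoo (f t).
Proof. by move=> /tame_smooth[_ + _]; apply. Qed.

End smooth_paths.

(** * The evolution problem without transport *)

(** Convexity acts through its monotone increments, which order the sources
    below, and through a local Lipschitz bound, which feeds the Gronwall
    argument. *)
Record convex_rate (R : realType) (a : R -> R) : Prop := ConvexRate {
  cr_ge0 : forall x, 0 <= x -> 0 <= a x;
  cr_mono : forall x y, 0 <= x -> x <= y -> a x <= a y;
  cr_increments : forall x x' y y', 0 <= x -> x <= x' -> 0 <= y -> y <= y' ->
    a (x + y) - a x <= a (x' + y') - a x';
  cr_lipschitz : forall M x y, 0 <= x -> x <= y -> y <= M ->
    a y - a x <= a (M + 1) * (y - x) }.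

Lemma convex_rateP (R : realType) (a : R -> R) :
  (forall x, 0 <= x -> 0 <= a x) -> (forall x y, 0 <= x -> x <= y -> a x <= a y) ->
  convex_function (E := R^o) `[0, +oo[%classic a -> convex_rate a.
Proof.
move=> a0 am ac.
have conv x z t : 0 <= x -> 0 <= z -> 0 <= t -> t <= 1 ->
    a (t * x + (1 - t) * z) <= t * a x + (1 - t) * a z.
  move=> x0 z0 t0 t1; have ht : Itv.spec (@Itv.num_sem R) (Itv.Real `[0%Z, 1%Z]) t.
    by rewrite /= /Itv.num_sem /= num_real in_itv/= t0 t1.
  have := ac (Itv.mk ht) x z; rewrite !convRE/=; apply.
    by rewrite inE /= in_itv/= x0.
  by rewrite inE /= in_itv/= z0.
split => //.
- move=> x x' y y' x0 xx' y0 yy'.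
  have h1 : a (x' + y) <= a (x' + y') by apply: am; [rewrite addr_ge0// (le_trans x0)|rewrite lerD2l].
  suff h2 : a (x + y) + a x' <= a x + a (x' + y) by lra.
  have [h|h] := leP (x' - x + y) 0.
    have -> : y = 0 by lra.
    have -> : x' = x by lra.
    by rewrite addr0.
  pose t := y / (x' - x + y).
  have t0 : 0 <= t by rewrite divr_ge0// ltW.
  have t1 : t <= 1 by rewrite ler_pdivrMr// mul1r lerDr subr_ge0.
  have tE : t * (x' - x + y) = y by rewrite divfK// gt_eqF.
  have xy0 : 0 <= x' + y by rewrite addr_ge0// (le_trans x0).
  have E1 : x + y = (1 - t) * x + (1 - (1 - t)) * (x' + y) by rewrite -[in LHS]tE; ring.
  have E2 : x' = t * x + (1 - t) * (x' + y).
    rewrite (_ : t * x + _ = x' + y - t * (x' - x + y)); last by ring.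
    by rewrite tE addrK.
  have := conv x (x' + y) t x0 xy0 t0 t1; rewrite -E2.
  have := conv x (x' + y) (1 - t) x0 xy0; rewrite -E1 subr_ge0 gerBl => /(_ t1 t0).
  lra.
- move=> M x y x0 xy yM.
  have d1 : 1 <= M + 1 - x by lra.
  have d0 : 0 < M + 1 - x by lra.
  pose t := (y - x) / (M + 1 - x).
  have t0 : 0 <= t by apply: divr_ge0; [rewrite subr_ge0|exact: ltW].
  have t1 : t <= 1 by rewrite ler_pdivrMr// mul1r lerD2r (le_trans yM)// lerDl.
  have tE : t * (M + 1 - x) = y - x by rewrite divfK// gt_eqF.
  have M0 : 0 <= M + 1 by lra.
  have := conv (M + 1) x t M0 x0 t0 t1.
  rewrite (_ : t * (M + 1) + _ = y); last first.
    rewrite -[RHS](subrK x) -tE; ring.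
  have ty : t <= y - x by rewrite -tE ler_peMr.
  have := ler_wpM2r (a0 _ M0) ty; rewrite [_ * (y - x)]mulrC.
  have := mulr_ge0 t0 (a0 _ x0); lra.
Qed.

(** The evolution problem in the moving frame, with every bound at every time.
    The moment functional [q] stands for the norm of [L1] composed with the
    inverse of [L]. *)
Record gain_loss (R : realType) (X : completeNormedModType R) (le : X -> X -> Prop)
    (L : operator X) (a rho : R -> R) (q : X -> R) (Kp Km : R -> X -> X) : Prop :=
  GainLoss {
  gl_rate : convex_rate a;
  gl_rho_ge0 : forall x, 0 <= x -> 0 <= rho x;
  gl_rho_mono : forall x y, 0 <= x -> x <= y -> rho x <= rho y;
  gl_q : bounded_linear (q : X -> R^o);
  gl_q_ge0 : forall x, cone le x -> 0 <= q x;
  gl_gain_pos : forall t g, domain_pos le L 1 g -> cone le (Kp t g);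
  gl_loss_pos : forall t g, domain_pos le L 1 g -> cone le (Km t g);
  gl_gain_isotone : forall t g h, domain_pos le L 1 g -> domain_pos le L 1 h ->
    cone le (h - g) -> cone le (Kp t h - Kp t g);
  gl_loss_isotone : forall t g h, domain_pos le L 1 g -> domain_pos le L 1 h ->
    cone le (h - g) -> cone le (Km t h - Km t g);
  gl_gain_cvg : forall t (u : nat -> X) g, (forall n, domain_pos le L 1 (u n)) ->
    (forall n, cone le (u n.+1 - u n)) -> u n @[n --> \oo] --> g ->
    domain_pos le L 1 g -> Kp t (u n) @[n --> \oo] --> Kp t g;
  gl_loss_cvg : forall t (u : nat -> X) g, (forall n, domain_pos le L 1 (u n)) ->
    (forall n, cone le (u n.+1 - u n)) -> u n @[n --> \oo] --> g ->
    domain_pos le L 1 g -> Km t (u n) @[n --> \oo] --> Km t g;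
  gl_gain_domain : forall t k g, k = 1%N \/ k = 2%N ->
    domain_pos le L k.+1 g -> domain_pos le L k (Kp t g);
  gl_gain_oo : forall t g, domain_pos_oo le L g -> domain_pos_oo le L (Kp t g);
  gl_loss_bound : forall t g, domain_pos le L 1 g ->
    cone le (a (mass le (L g)) *: L g - Km t g);
  gl_gap_isotone : forall t g h, domain_pos le L 1 g -> domain_pos le L 1 h ->
    cone le (h - g) -> cone le ((a (mass le (L h)) *: L h - Km t h) -
      (a (mass le (L g)) *: L g - Km t g));
  gl_diss_ge0 : forall t g, domain_pos le L 2 g ->
    0 <= mass le (L (Km t g) - L (Kp t g));
  gl_diss_isotone : forall t g h, domain_pos le L 2 g -> domain_pos le L 2 h ->
    cone le (h - g) ->
    mass le (L (Km t g) - L (Kp t g)) <= mass le (L (Km t h) - L (Kp t h));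
  gl_moment : forall t g, domain_pos le L 2 g -> 0 <= q (L (Km t g) - L (Kp t g));
  gl_second : forall t g, domain_pos le L 3 g ->
    mass le (L (L (Kp t g)) - L (L (Km t g))) <= rho (q (L g)) * mass le (L (L g));
  gl_gain_measurable : forall f,
    strongly_measurable (@lebesgue_measure R) `[0, +oo[%classic f ->
    (forall t, 0 <= t -> domain_pos le L 1 (f t)) ->
    strongly_measurable (@lebesgue_measure R) `[0, +oo[%classic (fun t => Kp t (f t));
  gl_loss_measurable : forall f,
    strongly_measurable (@lebesgue_measure R) `[0, +oo[%classic f ->
    (forall t, 0 <= t -> domain_pos le L 1 (f t)) ->
    strongly_measurable (@lebesgue_measure R) `[0, +oo[%classic (fun t => Km t (f t));
  gl_gain_integrable : forall g k T, domain_pos_oo le L g -> 0 <= T ->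
    exists I, itv_int 0 T (fun s => iter k L (Kp s g)) I }.

Section evolution.
Context (R : realType) (X : completeNormedModType R) (le : X -> X -> Prop).
Hypothesis ss : state_space le.
Context (L : operator X) (J : X -> X) (S : R -> X -> X).
Hypothesis gd : generator_data le L J S.
Context (a rho : R -> R) (q : X -> R) (Kp Km : R -> X -> X).
Hypothesis gl : gain_loss le L a rho q Kp Km.
Context (M : R) (M0 : 0 <= M).
Local Notation K := (cone le).
Local Notation mass := (mass le).
Local Notation DP := (domain_pos le L).
Local Notation DPoo := (domain_pos_oo le L).
Local Notation mu := (@lebesgue_measure R).
Local Notation Rplus := (`[0, +oo[%classic : set R).
Local Notation sm f := (strongly_measurable mu Rplus f).
Local Notation c := (a M).
Implicit Types (x y g h : X) (t s : R) (k : nat).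

Lemma rate_ge0 : 0 <= c. Proof. exact: (cr_ge0 (gl_rate gl)). Qed.

Lemma mass_L_ge0 g : DP 1 g -> 0 <= mass (L g).
Proof. by move=> /(domain_pos_L gd)[_ h]; exact: mass_ge0. Qed.

Lemma mass_LL_ge0 g : DP 2 g -> 0 <= mass (L (L g)).
Proof. by move=> /(domain_pos_L gd)/mass_L_ge0. Qed.

Lemma mass_L_le g h : DP 1 g -> DP 1 h -> K (h - g) -> mass (L g) <= mass (L h).
Proof.
move=> Dg Dh Kgh; apply: (mass_le ss).
exact: (L_isotone gd (domain_pos1 Dg) (domain_pos1 Dh)).
Qed.

Lemma L_isotone_pos k g h : DP k.+1 g -> DP k.+1 h -> K (h - g) -> K (L h - L g).
Proof.
by move=> Dg Dh; exact: (L_isotone gd (domain_pos_dom gd Dg) (domain_pos_dom gd Dh)).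
Qed.

(** Gain minus loss, plus an absorption term that the linear part [c L] of the
    problem takes back. The rate is evaluated at [|L f| + d], with [d] the
    mass dissipated so far, because that sum is conserved along solutions. *)
Definition source t f (d : R) : X :=
  Kp t f + (a (mass (L f) + d) *: L f - Km t f).

(** The gain is isotone, and so is the loss once it is subtracted from [a (|L
    f|) L f]; what remains is the increment of [a] over [[|L f|, |L f| + d]],
    which by convexity grows with both ends. *)
Lemma source_isotone t f f' (d d' : R) : DP 1 f -> DP 1 f' -> K (f' - f) ->
  0 <= d -> d <= d' -> K (source t f' d' - source t f d).
Proof.
move=> Df Df' Kff d0 dd'.
have -> : source t f' d' - source t f d = (Kp t f' - Kp t f) +
   ((a (mass (L f')) *: L f' - Km t f') - (a (mass (L f)) *: L f - Km t f)) +
   ((a (mass (L f') + d') - a (mass (L f'))) *: (L f' - L f) +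
   ((a (mass (L f') + d') - a (mass (L f'))) -
    (a (mass (L f) + d) - a (mass (L f)))) *: L f) by rewrite /source; lmod R.
have m0 := mass_L_ge0 Df; have m0' := mass_L_ge0 Df'.
apply: coneD => //; first apply: coneD => //.
- exact: (gl_gain_isotone gl).
- exact: (gl_gap_isotone gl).
apply: coneD => //; apply: coneZ => //.
- rewrite subr_ge0; apply: (cr_mono (gl_rate gl)) => //.
  by rewrite lerDl (le_trans d0).
- exact: (L_isotone_pos Df Df' Kff).
- rewrite subr_ge0; apply: (cr_increments (gl_rate gl)) => //.
  exact: mass_L_le.
- by case: (domain_pos_L gd Df).
Qed.

Lemma gap_pos t f (d : R) : DP 1 f -> 0 <= d ->
  K (a (mass (L f) + d) *: L f - Km t f).
Proof.
move=> Df d0; have m0 := mass_L_ge0 Df.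
have -> : a (mass (L f) + d) *: L f - Km t f = (a (mass (L f)) *: L f - Km t f) +
   (a (mass (L f) + d) - a (mass (L f))) *: L f by lmod R.
apply: coneD => //; first exact: (gl_loss_bound gl).
apply: coneZ => //; last by case: (domain_pos_L gd Df).
by rewrite subr_ge0; apply: (cr_mono (gl_rate gl)) => //; rewrite lerDl.
Qed.

Lemma rate_le f (d : R) : DP 1 f -> 0 <= d -> mass (L f) + d <= M ->
  0 <= a (mass (L f) + d) /\ a (mass (L f) + d) <= c.
Proof.
move=> Df d0 h; have m0 := mass_L_ge0 Df; have md0 : 0 <= mass (L f) + d by exact: addr_ge0.
by split; [exact: (cr_ge0 (gl_rate gl))|exact: (cr_mono (gl_rate gl))].
Qed.

Lemma gap_domain k t f (d : R) : (0 < k)%N -> DP k.+1 f -> 0 <= d ->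
  DP k (a (mass (L f) + d) *: L f - Km t f).
Proof.
move=> k0 Df d0; have Df1 : DP 1 f by exact: domain_pos_lower Df.
have ad0 : 0 <= a (mass (L f) + d) by apply: (cr_ge0 (gl_rate gl)); rewrite addr_ge0// mass_L_ge0.
apply: (domain_pos_saturated gd (domain_pos_scale ss gd ad0 (domain_pos_L gd Df))).
  exact: gap_pos.
by rewrite opprB addrC subrK; exact: (gl_loss_pos gl).
Qed.

(** Heredity of the domains below [a (|L f|) L f]. *)
Lemma loss_domain k t f : DP k.+1 f -> DP k (Km t f).
Proof.
move=> Df; have Df1 : DP 1 f by exact: domain_pos_lower Df.
have ad0 : 0 <= a (mass (L f)) by exact: (cr_ge0 (gl_rate gl)) (mass_L_ge0 Df1).
apply: (domain_pos_saturated gd (domain_pos_scale ss gd ad0 (domain_pos_L gd Df))).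
  exact: (gl_loss_pos gl).
exact: (gl_loss_bound gl).
Qed.

Lemma source_domain t f (d : R) : DP 2 f -> 0 <= d -> DP 1 (source t f d).
Proof.
move=> Df d0; apply: (domain_pos_add ss gd); last exact: gap_domain.
by apply: (gl_gain_domain gl) Df; left.
Qed.

Lemma L_source t f (d : R) : DP 2 f -> 0 <= d ->
  L (source t f d) = a (mass (L f) + d) *: L (L f) - (L (Km t f) - L (Kp t f)).
Proof.
move=> Df d0; have D1 : DP 1 (Kp t f) by apply: (gl_gain_domain gl) Df; left.
have D2 := loss_domain t Df; have D3 := gap_domain t (ltn0Sn 0) Df d0.
have D4 := domain_pos_L gd Df.
have [_ ->] := L_add gd (domain_pos1 D1) (domain_pos1 D3).
have [Ds Ls] := L_scale gd (a (mass (L f) + d)) (domain_pos1 D4).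
have [_ ->] := L_sub gd Ds (domain_pos1 D2).
by rewrite Ls; lmod R.
Qed.

(** The dissipation is subtracted from the absorption term, and the rate is at
    most [c]. *)
Lemma mass_L_source t f (d : R) : DP 2 f -> 0 <= d -> mass (L f) + d <= M ->
  mass (L (source t f d)) <= c * mass (L (L f)).
Proof.
move=> Df d0 h; rewrite (L_source t Df d0) (massB ss) (massZ ss).
have Df1 : DP 1 f by exact: domain_pos_lower Df.
have [r0 rc] := rate_le Df1 d0 h.
rewrite lerBlDr (@le_trans _ _ (c * mass (L (L f))))//.
  by rewrite ler_wpM2r// mass_LL_ge0.
by rewrite lerDl; exact: (gl_diss_ge0 gl).
Qed.

Lemma mass_L_loss t f : DP 2 f -> mass (L f) <= M -> mass (L (Km t f)) <= c * mass (L (L f)).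
Proof.
move=> Df fM; have Df1 : DP 1 f by exact: domain_pos_lower Df.
have := rate_le Df1 (lexx 0); rewrite addr0 => /(_ fM)[r0 rc].
have D2 := loss_domain t Df; have D4 := domain_pos_L gd Df.
apply: (@le_trans _ _ (mass (L (a (mass (L f)) *: L f)))).
  apply: mass_L_le => //; first exact: (domain_pos_scale ss gd).
  exact: (gl_loss_bound gl).
have [_ ->] := L_scale gd (a (mass (L f))) (domain_pos1 D4).
by rewrite (massZ ss) ler_wpM2r// mass_LL_ge0.
Qed.

Lemma mass_L_gain t f : DP 2 f -> mass (L (Kp t f)) <= mass (L (Km t f)).
Proof. by move=> Df; rewrite -subr_ge0 -(massB ss); exact: (gl_diss_ge0 gl). Qed.

Lemma source_measurable f (d : R -> R) : sm f -> (forall t, 0 <= t -> DP 1 (f t)) ->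
  sm (d : R -> R^o) ->
  (forall t, 0 <= t -> 0 <= d t /\ mass (L (f t)) + d t <= M) ->
  sm (fun t => source t (f t) (d t)).
Proof.
move=> mf Df md fd; have mLf := L_measurable ss gd mf Df.
apply: strongly_measurableD; first exact: (gl_gain_measurable gl).
apply: strongly_measurableB; last exact: (gl_loss_measurable gl).
apply: strongly_measurableZ => //.
pose cl (r : R) := Num.min (Num.max r 0) M.
have cl_in r : 0 <= cl r /\ cl r <= M.
  by rewrite /cl le_min ge_min le_max !lexx M0 !orbT.
have cl_id r : 0 <= r -> r <= M -> cl r = r by move=> r0 rM; rewrite /cl max_l// min_l.
have ccl : continuous (fun r : R^o => a (cl r) : R^o).
  move=> r; apply/cvgrPdist_lt => eps eps0.
  have C0 : 0 <= a (M + 1) by apply: (cr_ge0 (gl_rate gl)); rewrite addr_ge0.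
  apply/nbhs_ballP; exists (eps / (a (M + 1) + 1)) => [|r' /=].
    by rewrite /= divr_gt0// ltr_wpDl.
  rewrite /= ltr_pdivlMr ?ltr_wpDl// => rr'.
  have key p p' : p <= p' -> `|a (cl p) - a (cl p')| <= a (M + 1) * `|p - p'|.
    move=> pp'; have [h1 h2] := cl_in p; have [h3 h4] := cl_in p'.
    have cpp : cl p <= cl p'.
      by rewrite /cl le_min !ge_min lexx orbT !andbT ge_max !le_max pp' lexx !orbT.
    rewrite distrC ger0_norm ?subr_ge0; last exact: (cr_mono (gl_rate gl)).
    apply: (le_trans (cr_lipschitz (gl_rate gl) h1 cpp h4)).
    rewrite ler_wpM2l// distrC ger0_norm ?subr_ge0//.
    have pp0 : 0 <= p' - p by rewrite subr_ge0.
    rewrite lerBlDr /cl addr_minr addr_maxr subrK addr0 le_min !ge_min ge_max !le_max.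
    by rewrite lexx pp0 !orbT /= lerDr pp0 orbT.
  apply: le_lt_trans rr'; apply: (@le_trans _ _ (a (M + 1) * `|r - r'|)).
    have [h|h] := leP r r'; first exact: key.
    by rewrite distrC [`|r - r'|]distrC; apply: key; exact: ltW.
  by rewrite mulrC ler_wpM2l// lerDl.
apply: (strongly_measurable_ae (mu := mu)
  (g := fun t => (a (cl (mass (L (f t)) + d t)) : R^o))).
  apply: ae_all => t; rewrite /= in_itv/= andbT => t0; have [d0 dM] := fd t t0.
  by rewrite cl_id// addr_ge0// mass_L_ge0//; exact: Df.
apply: (strongly_measurable_comp (mu := mu) (h := fun r : R^o => a (cl r) : R^o)
  (f := fun t => (mass (L (f t)) + d t : R^o))) => //.
apply: strongly_measurableD => //.
exact: (strongly_measurable_comp (mu := mu) (bl_continuous (mass_bounded_linear ss))).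
Qed.

End evolution.

(** * One step of the iteration *)

Section iteration_step.
Context (R : realType) (X : completeNormedModType R) (le : X -> X -> Prop).
Hypothesis ss : state_space le.
Context (L : operator X) (J : X -> X) (S : R -> X -> X).
Hypothesis gd : generator_data le L J S.
Context (a rho : R -> R) (q : X -> R) (Kp Km : R -> X -> X).
Hypothesis gl : gain_loss le L a rho q Kp Km.
Context (M : R) (M0 : 0 <= M).
Local Notation K := (cone le).
Local Notation mass := (mass le).
Local Notation DP := (domain_pos le L).
Local Notation DPoo := (domain_pos_oo le L).
Local Notation mu := (@lebesgue_measure R).
Local Notation Rplus := (`[0, +oo[%classic : set R).
Local Notation sm f := (strongly_measurable mu Rplus f).
Local Notation c := (a M).
Local Notation source := (source le L a Kp Km).
Local Notation diss t g := (L (Km t g) - L (Kp t g)).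
Implicit Types (x y g h : X) (t s T : R) (k : nat).

Lemma gain_cst_smooth F : DPoo F -> smooth_path le L (fun t => Kp t F).
Proof.
move=> DF; split.
- by apply: (gl_gain_measurable gl); [exact: strongly_measurable_cst|move=> t _; exact: DF].
- by move=> t _; exact: (gl_gain_oo gl).
- by move=> k T T0; exact: (gl_gain_integrable gl).
Qed.

Lemma gain_smooth f : tame le L f -> smooth_path le L (fun t => Kp t (f t)).
Proof.
move=> tf; have [mf Kf hF] := tf.
have Df t : 0 <= t -> DP 1 (f t) by move=> t0; exact: domain_pos_oo_k (tame_oo ss gd tf t0).
apply: (smooth_path_dominated ss gd).
- exact: (gl_gain_measurable gl).
- by move=> t /Df; exact: (gl_gain_pos gl).
move=> T /hF[F DF hFf]; exists (fun t => Kp t F); first exact: gain_cst_smooth.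
by move=> t t0 tT; apply: (gl_gain_isotone gl); [exact: Df|exact: DF|exact: hFf].
Qed.

Lemma loss_smooth f : tame le L f -> smooth_path le L (fun t => Km t (f t)).
Proof.
move=> tf; have [mf Kf hF] := tf.
have Df t : 0 <= t -> DP 1 (f t) by move=> t0; exact: domain_pos_oo_k (tame_oo ss gd tf t0).
apply: (smooth_path_dominated ss gd).
- exact: (gl_loss_measurable gl).
- by move=> t /Df; exact: (gl_loss_pos gl).
move=> T /hF[F DF hFf]; have DF1 : DP 1 F by exact: DF.
exists (fun=> a (mass (L F)) *: L F).
  apply: smooth_path_cst; apply: (domain_pos_oo_scale ss gd).
    exact: (cr_ge0 (gl_rate gl)) (mass_L_ge0 ss gd DF1).
  exact: (domain_pos_oo_L gd).
move=> t t0 tT; have -> : a (mass (L F)) *: L F - Km t (f t) =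
  (a (mass (L F)) *: L F - Km t F) + (Km t F - Km t (f t)) by lmod R.
apply: coneD => //; first exact: (gl_loss_bound gl).
by apply: (gl_loss_isotone gl); [exact: Df|exact: DF|exact: hFf].
Qed.

Section dissipation_integral.

Lemma diss_norm (B t : R) g : DP 2 g -> mass (L g) <= B ->
  `|diss t g| <= 2 * (a B * mass (L (L g))).
Proof.
move=> Dg gB; have D1 := loss_domain ss gd gl t Dg.
have D2 : DP 1 (Kp t g) by apply: (gl_gain_domain gl) Dg; left.
have [_ K1] := domain_pos_L gd D1; have [_ K2] := domain_pos_L gd D2.
have h1 := mass_L_loss ss gd gl t Dg gB; have h2 := mass_L_gain ss gl t Dg.
rewrite mulr_natl mulr2n (le_trans (ler_normB _ _))// -(mass_cone ss K1) -(mass_cone ss K2).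
by rewrite lerD// (le_trans h2).
Qed.

(** The gain is controlled by the loss, and the loss by [L^2 g], so the
    integrand is locally bounded. *)
Lemma diss_path (g : R -> X) : sm g -> (forall t, 0 <= t -> DP 2 (g t)) ->
  (forall T, exists C : R, forall t, 0 <= t -> t <= T -> mass (L (L (g t))) <= C) ->
  exists I : R -> X, (forall t, 0 <= t -> itv_int 0 t (fun s => diss s (g s)) (I t)) /\
    forall T, exists C : R, forall s t, 0 <= s -> s <= t -> t <= T ->
      `|I t - I s| <= C * (t - s).
Proof.
move=> mg Dg Cg; have sepX := ss_separable ss.
have Dg1 t : 0 <= t -> DP 1 (g t) by move=> /Dg; exact: domain_pos_lower.
have mdiss : sm (fun s => diss s (g s)).
  apply: strongly_measurableB; apply: (L_measurable ss gd).
  - exact: (gl_loss_measurable gl).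
  - by move=> t /Dg; exact: (loss_domain ss gd gl).
  - exact: (gl_gain_measurable gl).
  - by move=> t /Dg; apply: (gl_gain_domain gl); left.
have bd T : exists2 C : R, 0 <= C & forall t, 0 <= t -> t <= T -> `|diss t (g t)| <= C.
  have [C hC] := Cg T; have [CJ CJ0 hCJ] := mass_J ss gd.
  have B0 : 0 <= CJ * `|C| by exact: mulr_ge0.
  have aB0 := cr_ge0 (gl_rate gl) B0.
  exists (2 * (a (CJ * `|C|) * `|C|)) => [|t t0 tT]; first by rewrite !mulr_ge0.
  have h := le_trans (hC t t0 tT) (ler_norm C).
  have hB : mass (L (g t)) <= CJ * `|C|.
    apply: (le_trans (hCJ _ (domain_pos_L gd (Dg t t0)))); exact: ler_wpM2l.
  apply: (le_trans (diss_norm t (Dg t t0) hB)).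
  by rewrite ler_wpM2l// ler_wpM2l.
have int s t : 0 <= s -> exists I, itv_int s t (fun s => diss s (g s)) I.
  move=> s0; have [C C0 hC] := bd t; apply: (itv_int_bounded sepX (C := C)) => //.
  apply: ae_all => r; rewrite /= in_itv/= => /andP[sr rt].
  by apply: hC => //; exact: le_trans sr.
have [I hI] := choice (fun t => int 0 t (lexx 0)).
exists I; split=> // T; have [C C0 hC] := bd T; exists C => s t s0 st tT.
have [I1 [I2 [h1 h2 IE]]] := itv_int_split s0 st (hI t).
rewrite IE (itv_int_uniq h1 (hI s)) addrAC subrr add0r.
apply: (itv_int_norm_le st h2 C0); apply: ae_all => r.
by rewrite /= in_itv/= => /andP[sr rt]; apply: hC; [exact: le_trans sr|exact: le_trans tT].
Qed.

Lemma diss_path_exists (g : R -> X) : sm g -> (forall t, 0 <= t -> DP 2 (g t)) ->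
  (forall T, exists C : R, forall t, 0 <= t -> t <= T -> mass (L (L (g t))) <= C) ->
  exists2 e, sm (e : R -> R^o) & forall t, 0 <= t ->
    exists2 I, itv_int 0 t (fun s => diss s (g s)) I & e t = mass I.
Proof.
move=> mg Dg Cg; have [I [hI IL]] := diss_path mg Dg Cg.
exists (fun t => mass (I t)) => [|t t0]; last by exists (I t) => //; exact: hI.
apply: (strongly_measurable_comp (mu := mu) (bl_continuous (mass_bounded_linear ss))).
by apply: lipschitz_measurable => //; exact: (ss_separable ss).
Qed.

End dissipation_integral.

Section source_of_path.
Context (f : R -> X) (d : R -> R).
Hypotheses (tf : tame le L f) (md : sm (d : R -> R^o))
  (fd : forall t, 0 <= t -> 0 <= d t /\ mass (L (f t)) + d t <= M).

Let Df k t : 0 <= t -> DP k (f t).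
Proof. by move=> t0; exact: domain_pos_oo_k (tame_oo ss gd tf t0). Qed.

Let fM t : 0 <= t -> mass (L (f t)) <= M.
Proof. by move=> t0; have [d0] := fd t0; apply: le_trans; rewrite lerDl. Qed.

Lemma source_dominated F T : DPoo F -> (forall t, 0 <= t -> t <= T -> K (F - f t)) ->
  forall t, 0 <= t -> t <= T -> K (Kp t F + c *: L F - source t (f t) (d t)).
Proof.
move=> DF hF t t0 tT; have DF1 : DP 1 F by exact: DF.
have [d0 dM] := fd t0; have [r0 rc] := rate_le ss gd gl (Df 1 t0) d0 dM.
have KFf := hF t t0 tT.
have -> : Kp t F + c *: L F - source t (f t) (d t) = (Kp t F - Kp t (f t)) +
   (c *: (L F - L (f t)) + (c - a (mass (L (f t)) + d t)) *: L (f t) + Km t (f t)).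
  by rewrite /source; lmod R.
apply: coneD => //; first by apply: (gl_gain_isotone gl) => //; exact: Df.
apply: coneD => //; last by apply: (gl_loss_pos gl); exact: Df.
apply: coneD => //; apply: coneZ => //.
- exact: (rate_ge0 gl M0).
- exact: (L_isotone_pos gd (Df 1 t0) DF1).
- by rewrite subr_ge0.
- by case: (domain_pos_L gd (Df 1 t0)).
Qed.

Lemma source_smooth : smooth_path le L (fun t => source t (f t) (d t)).
Proof.
have [_ _ hF] := tf; apply: (smooth_path_dominated ss gd).
- by apply: (source_measurable ss gd gl M0) => //; [case: tf|exact: Df].
- move=> t t0; have [d0 _] := fd t0.
  exact: domain_pos_cone (source_domain ss gd gl t (Df 2 t0) d0).
move=> T /hF[F DF hFf]; exists (fun t => Kp t F + c *: L F).
  apply: (smooth_path_add ss gd); first exact: gain_cst_smooth.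
  apply: smooth_path_cst; apply: (domain_pos_oo_scale ss gd).
    exact: (rate_ge0 gl M0).
  exact: (domain_pos_oo_L gd).
exact: source_dominated.
Qed.

(** The source is dominated by the gain of a fixed bound of [f] plus [c L] of
    that bound; this dominates the new iterate too. *)
Lemma step_exists (w0 : X) : DPoo w0 -> exists w : R -> X, tame le L w /\
  linear_solution le L c w0 (fun t => source t (f t) (d t)) w.
Proof.
move=> Dw0; have [_ _ hF] := tf; have [ms Ds Is] := source_smooth.
have c0 := rate_ge0 gl M0.
have dom T : 0 <= T -> exists h : R -> X, smooth_path le L h /\
   forall t, 0 <= t -> t <= T -> K (h t - source t (f t) (d t)).
  move=> /hF[F DF hFf]; exists (fun t => Kp t F + c *: L F); split.
    apply: (smooth_path_add ss gd); first exact: gain_cst_smooth.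
    by apply/smooth_path_cst/(domain_pos_oo_scale ss gd c0); exact: (domain_pos_oo_L gd).
  exact: source_dominated.
have int_le T I I' (h : R -> X) : 0 <= T ->
    (forall t, 0 <= t -> t <= T -> K (h t - source t (f t) (d t))) ->
    itv_int 0 T h I' -> itv_int 0 T (fun t => source t (f t) (d t)) I -> K (I' - I).
  move=> T0 hK h1 h2; apply: (itv_int_cone (ss_closed ss)) (itv_intB h1 h2).
  - exact: cone0.
  - by move=> x y; exact: coneD.
  - by move=> k x; exact: coneZ.
  - by apply: ae_all => t; rewrite /= in_itv/= => /andP[]; exact: hK.
have [||||T T0|w sw wI] := linear_solution_exists ss gd c0 (w0 := w0)
  (b := fun t => source t (f t) (d t)).
- exact: Dw0.
- exact: ms.
- by move=> t t0; exact: (Ds t t0).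
- move=> T; have [T0|T0] := leP 0 T; last first.
    by exists 0 => t t0 /le_lt_trans/(_ T0)/(le_lt_trans t0); rewrite ltxx.
  have [F DF hFf] := hF T T0; exists (c * mass (L (L F))) => t t0 tT.
  have [d0 dM] := fd t0.
  apply: (le_trans (mass_L_source ss gd gl t (Df 2 t0) d0 dM)).
  rewrite ler_wpM2l//.
  apply: (mass_L_le ss gd); [exact: (domain_pos_L gd (Df 2 t0))| |].
    exact: (domain_pos_L gd (domain_pos_oo_k 2 DF)).
  exact: (L_isotone_pos gd (Df 1 t0) (domain_pos_oo_k 1 DF) (hFf t t0 tT)).
- have [h [sh hh]] := dom T T0; have [_ _ Ih] := sh; have [I' hI'] := Ih 0%N T T0.
  exists (w0 + I') => [|I hI].
    apply: (domain_pos_oo_k 2); apply: (domain_pos_oo_add ss gd) => //.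
    exact: (smooth_path_int_oo ss gd sh T0 hI').
  have -> : w0 + I' - (w0 + I) = I' - I by lmod R.
  exact: (int_le T I I' h).
exists w; split => //; have [Dw _ LwL _] := sw.
have mLw : sm (fun t => L (w t)) by exact: (lipschitz_measurable (ss_separable ss)).
split.
- apply: (strongly_measurable_ae (mu := mu) (g := fun t => J (L (w t)))).
    apply: ae_all => t; rewrite /= in_itv/= andbT => t0.
    by rewrite (gd_LK gd)//; exact: (domain_pos_dom gd (Dw t t0)).
  exact: (strongly_measurable_comp (mu := mu) (bl_continuous (gd_J gd))).
- by move=> t /Dw[].
move=> T T0; have [h [sh hh]] := dom T T0; have [_ Dh Ih] := sh.
have [I' hI'] := Ih 0%N T T0; exists (w0 + I').
  apply: (domain_pos_oo_add ss gd) => //.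
  exact: (smooth_path_int_oo ss gd sh T0 hI').
move=> t t0 tT; have [I1 [I2 [h1 h2 IE]]] := itv_int_split t0 tT hI'.
have [I hI KI] := wI t t0.
have -> : w0 + I' - w t = (I1 - I) + (w0 + I - w t) + I2 by rewrite IE; lmod R.
apply: coneD => //; first apply: coneD => //.
  by apply: (int_le t I I1 h t0 _ h1 hI) => s s0 st; apply: hh => //; exact: le_trans tT.
apply: (itv_int_pos ss t0 (f := fun s => h (Num.max s 0))).
  move=> s s0; rewrite max_l//; exact: (domain_pos_oo_cone (Dh s s0)).
by apply: itv_int_eq h2 => s ts _; rewrite max_l// (le_trans t0).
Qed.

(** Along one step, the moments of the new iterate are dominated through the
    balance of gain and loss of the old one; what is discarded is the excess
    [c L^(k+1) w - a(...) L^(k+1) f], positive because the iterates increase. *)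
Lemma step_moment k (w0 : X) (w : R -> X) : DPoo w0 -> tame le L w ->
  linear_solution le L c w0 (fun t => source t (f t) (d t)) w ->
  (forall t, 0 <= t -> K (w t - f t)) -> forall t, 0 <= t ->
  exists2 D, itv_int 0 t (fun s => iter k L (Km s (f s)) - iter k L (Kp s (f s))) D &
    K (iter k L w0 - D - iter k L (w t)).
Proof.
move=> Dw0 tw [_ _ _ weq] fw t t0; have [I1 [I2 [h1 h2 E]]] := weq t t0.
have [_ Dwoo Iw] := tame_smooth ss gd tw.
have [_ _ Is] := source_smooth; have [_ Dp Ip] := gain_smooth tf.
have [_ Dm Im] := loss_smooth tf.
have [I1k hI1k] := Iw k.+1 t t0; have [I2k hI2k] := Is k t t0.
have [Ipk hIpk] := Ip k t t0; have [Imk hImk] := Im k t t0.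
exists (Imk - Ipk); first exact: itv_intB.
have bJ := iterJ_bounded_linear gd k.
have I1E : I1 = iter k J I1k.
  apply: (itv_int_uniq h1); apply: itv_int_eq (itv_int_linear bJ hI1k) => s s0 _.
  rewrite iterSr (domain_pos_iterJK gd)//.
  exact: (domain_pos_L gd (domain_pos_oo_k k.+1 (Dwoo s s0))).
have I2E := smooth_path_int gd source_smooth h2 hI2k.
have wE : iter k L (w t) = iter k L w0 + I2k - c *: I1k.
  rewrite -[LHS](iterLJ gd k) -[RHS](iterLJ gd k); congr (iter k L _).
  rewrite (bl_sub bJ) (bl_add bJ) (bl_scale bJ) -I1E -I2E.
  rewrite (domain_pos_iterJK gd); last exact: domain_pos_oo_k (Dwoo t t0).
  by rewrite (domain_pos_iterJK gd (domain_pos_oo_k k Dw0)) -E addrK.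
have -> : iter k L w0 - (Imk - Ipk) - iter k L (w t) = c *: I1k - I2k - (Imk - Ipk).
  by rewrite wE; lmod R.
apply: (itv_int_cone (ss_closed ss)) (itv_intB (itv_intB (itv_intZ c hI1k) hI2k) (itv_intB hImk hIpk)).
- exact: cone0.
- by move=> x y; exact: coneD.
- by move=> r x; exact: coneZ.
apply: ae_all => s; rewrite /= in_itv/= => /andP[s0 _].
have [d0 dM] := fd s0; have [r0 rc] := rate_le ss gd gl (Df 1 s0) d0 dM.
have Dgap := gap_domain ss gd gl s (ltn0Sn k) (Df k.+2 s0) d0.
have {}Dgap := domain_pos_lower (leqnSn k) Dgap.
have DLf : DP k (L (f s)) := domain_pos_L gd (Df k.+1 s0).
have -> : iter k L (source s (f s) (d s)) = iter k L (Kp s (f s)) +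
   (a (mass (L (f s)) + d s) *: iter k.+1 L (f s) - iter k L (Km s (f s))).
  rewrite /source (iterL_add gd (domain_pos_oo_k k (Dp s s0)) Dgap); congr (_ + _).
  rewrite [iter k.+1 L _]iterSr -(iterL_scale gd _ DLf).
  have := iterL_add gd Dgap (domain_pos_oo_k k (Dm s s0)).
  by rewrite subrK => ->; rewrite addrK.
set u := iter k.+1 L (f s); set v := iter k.+1 L (w s).
have -> : c *: v - (iter k L (Kp s (f s)) + (a (mass (L (f s)) + d s) *: u -
     iter k L (Km s (f s)))) - (iter k L (Km s (f s)) - iter k L (Kp s (f s))) =
   c *: (v - u) + (c - a (mass (L (f s)) + d s)) *: u by lmod R.
apply: coneD => //; apply: coneZ => //.
- exact: (rate_ge0 gl M0).
- apply: (iterL_isotone gd); [exact: Df|exact: domain_pos_oo_k (Dwoo s s0)|exact: fw].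
- by rewrite subr_ge0.
- have := domain_pos_iterL gd (j := k.+1) (k := 0) (g := f s); rewrite addn0.
  by move=> /(_ (Df _ s0))[].
Qed.

End source_of_path.

End iteration_step.

(** * The monotone iteration *)

Lemma real_separable (R : realType) : exists2 S : set R^o, countable S & dense S.
Proof.
by exists (range (@ratr R)); [exact: card_le_trans (card_image_le _ _) (countableP _)|exact: dense_rat].
Qed.

Lemma itv_int_expR (R : realType) (y r t : R) : 0 <= t ->
  itv_int 0 t (fun s => y * (r * expR (r * s)) : R^o) (y * (expR (r * t) - 1) : R^o).
Proof.
have cf : continuous (fun s => y * (r * expR (r * s)) : R).
  move=> s; apply: cvgMr; apply: cvgMr; apply: continuous_comp; last exact: continuous_expR.
  by apply: cvgMr; exact: cvg_id.
have dF (s : R) : is_derive s (1 : R) (fun s : R => y * expR (r * s)) (y * (r * expR (r * s))).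
  by apply: is_derive_eq; rewrite /GRing.scale/= ?mulr1 ?mul1r ?mulr0 ?addr0 ?mul0r ?add0r; ring.
rewrite le_eqVlt => /orP[/eqP <-|t0].
  by rewrite mulr0 expR0 subrr mulr0; exact: itv_int_point.
have [I hI] : exists I : R^o, itv_int 0 t (fun s => y * (r * expR (r * s)) : R^o) I.
  apply: (itv_int_bounded (real_separable R) (C := `|y| * (`|r| * expR (`|r| * t)))) => //.
    apply: (continuous_strongly_measurable (real_separable R)) => s s0 eps eps0.
    have /cvgrPdist_lt/(_ _ eps0)/nbhs_ballP[del /= del0 hd] := cf s.
    exists del => // s' _ ss'; rewrite distrC; apply: hd.
    by rewrite /ball /= distrC.
  apply: ae_all => s; rewrite /= in_itv/= => /andP[s0 st].
  rewrite !normrM ler_wpM2l// ler_wpM2l// (ger0_norm (expR_ge0 _)) ler_expR.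
  by rewrite (le_trans (ler_norm _))// normrM (ger0_norm s0) ler_wpM2l.
suff -> : y * (expR (r * t) - 1) = I by [].
have := has_int_lebesgue (mu := @lebesgue_measure R) (measurable_itv _) (interval_finite _ _) hI.
rewrite (@continuous_FTC2 _ _ (fun s : R => y * expR (r * s)) _ _ t0).
- by rewrite -EFinB => -[<-]; rewrite mulr0 expR0; ring.
- by apply: continuous_subspaceT.
- have cF (s : R) : {for s, continuous (fun s : R => y * expR (r * s))}.
    by apply: differentiable_continuous; apply/derivable1_diffP; case: (dF s).
  split => [s _||]; [by case: (dF s)|exact: cvg_at_right_filter (cF 0)|
    exact: cvg_at_left_filter (cF t)].
- by move=> s _; rewrite derive1E; case: (dF s).
Qed.

Section iteration.
Context (R : realType) (X : completeNormedModType R) (le : X -> X -> Prop).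
Hypothesis ss : state_space le.
Context (L : operator X) (J : X -> X) (S : R -> X -> X).
Hypothesis gd : generator_data le L J S.
Context (a rho : R -> R) (q : X -> R) (Kp Km : R -> X -> X).
Hypothesis gl : gain_loss le L a rho q Kp Km.
Context (M moment0 second0 : R).
Hypotheses (M0 : 0 <= M) (moment0_ge0 : 0 <= moment0) (second0_ge0 : 0 <= second0).
Local Notation K := (cone le).
Local Notation mass := (mass le).
Local Notation DP := (domain_pos le L).
Local Notation DPoo := (domain_pos_oo le L).
Local Notation mu := (@lebesgue_measure R).
Local Notation Rplus := (`[0, +oo[%classic : set R).
Local Notation sm f := (strongly_measurable mu Rplus f).
Local Notation c := (a M).
Local Notation r := (rho moment0).
Local Notation source := (source le L a Kp Km).
Local Notation diss t g := (L (Km t g) - L (Kp t g)).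
Implicit Types (x y g h : X) (t s T : R) (k : nat) (f w : R -> X) (d e : R -> R).

Lemma functional_int_le (phi : X -> R) (u u' : R -> X) t I I' :
  bounded_linear (phi : X -> R^o) -> itv_int 0 t u I -> itv_int 0 t u' I' ->
  (forall s, 0 <= s -> s <= t -> phi (u s) <= phi (u' s)) -> phi I <= phi I'.
Proof.
move=> bp h h' H; rewrite -subr_ge0.
have := itv_intB (itv_int_linear bp h') (itv_int_linear bp h).
move=> /(has_int_real_ge0 (mu := mu) (measurable_itv _)) hge; apply: hge; first exact: interval_finite.
by apply: ae_all => s; rewrite /= in_itv/= => /andP[s0 st]; rewrite subr_ge0 H.
Qed.

Definition initial_bounds x :=
  [/\ DPoo x, mass (L x) <= M, q (L x) <= moment0 & mass (L (L x)) <= second0].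

(** The a priori bounds propagated along the iteration. *)
Definition admissible f d : Prop :=
  [/\ tame le L f, sm (d : R -> R^o),
    forall t, 0 <= t -> 0 <= d t /\ mass (L (f t)) + d t <= M,
    forall t, 0 <= t -> q (L (f t)) <= moment0 &
    forall t, 0 <= t -> mass (L (L (f t))) <= second0 * expR (r * t)].

(** One step of the iteration, together with the fact that it increases both
    components. *)
Definition successor x f d w e : Prop :=
  [/\ tame le L w /\ sm (e : R -> R^o),
    linear_solution le L c x (fun t => source t (f t) (d t)) w,
    forall t, 0 <= t -> exists2 I, itv_int 0 t (fun s => diss s (f s)) I & e t = mass I,
    forall t, 0 <= t -> K (w t - f t) & forall t, 0 <= t -> d t <= e t].

Lemma admissible_DP f d k t : admissible f d -> 0 <= t -> DP k (f t).
Proof. by case=> tf _ _ _ _ t0; exact: domain_pos_oo_k (tame_oo ss gd tf t0). Qed.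

Lemma admissible_mass f d t : admissible f d -> 0 <= t -> mass (L (f t)) <= M.
Proof. by case=> _ _ fd _ _ /fd[d0]; apply: le_trans; rewrite lerDl. Qed.

Lemma q_le x y : K (y - x) -> q x <= q y.
Proof.
by move=> /(gl_q_ge0 gl); rewrite (bl_sub (gl_q gl)) subr_ge0.
Qed.

(** The moment inequality for [L], for [q] and for [L^2]: the first balance is
    the dissipation itself, the second one has a sign, and the third one is
    absorbed by the exponential. *)
Lemma successor_admissible x f d w e : initial_bounds x -> admissible f d ->
  successor x f d w e -> admissible w e.
Proof.
move=> [Dx xM xq x2] ad [[tw me] sw de fw ew].
have [tf md fd fq f2] := ad.
have Df k t : 0 <= t -> DP k (f t) := @admissible_DP f d k t ad.
have mom k := step_moment ss gd gl M0 tf md fd k Dx tw sw fw.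
have mb := mass_bounded_linear ss.
split => // t t0.
- have [I hI ->] := de t t0; split.
    have := functional_int_le mb (itv_int_eq _ (has_int_cst (0 : X) t0)) hI.
    rewrite scaler0 (mass0 ss); apply => [s _ _|s s0 _]; first reflexivity.
    by rewrite (mass0 ss); apply: (gl_diss_ge0 gl); exact: Df.
  have [D hD KD] := mom 1%N t t0; have DI := itv_int_uniq hD hI.
  have := mass_ge0 ss KD; rewrite !(massB ss) DI; rewrite [iter 1 L]/=; lra.
- have [D hD KD] := mom 1%N t t0; apply: le_trans xq.
  have : q (L (w t)) <= q (L x - D).
    by apply: q_le; rewrite [iter 1 L]/= in KD.
  rewrite (bl_sub (gl_q gl)) => /le_trans; apply; rewrite gerBl.
  have := functional_int_le (gl_q gl) (itv_int_eq _ (has_int_cst (0 : X) t0)) hD.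
  rewrite scaler0 (bl0 (gl_q gl)); apply => [s _ _|s s0 _]; first reflexivity.
  by rewrite (bl0 (gl_q gl)); apply: (gl_moment gl); exact: Df.
- have [D hD KD] := mom 2%N t t0.
  have h : mass (L (L (w t))) <= mass (L (L x)) - mass D.
    by rewrite -(massB ss); apply: (mass_le ss); rewrite [iter 2 L]/= in KD.
  apply: (le_trans h); rewrite -[leRHS](subrK second0) addrC lerD//.
  rewrite lerNl -subr_ge0 opprK.
  have hE := @itv_int_expR R second0 r t t0.
  have := itv_intD (itv_int_linear mb hD) hE.
  move=> /(has_int_real_ge0 (mu := mu) (measurable_itv _)) hge.
  have := hge (interval_finite _ _); rewrite mulrBr mulr1; apply.
  apply: ae_all => s; rewrite /= in_itv/= => /andP[s0 st].
  have := gl_second gl s (Df 3%N s s0); rewrite !(massB ss).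
  have q0 : 0 <= q (L (f s)).
    by apply: (gl_q_ge0 gl); case: (domain_pos_L gd (Df 1%N s s0)).
  have h1 : rho (q (L (f s))) * mass (L (L (f s))) <= r * (second0 * expR (r * s)).
    apply: ler_pM => //; first exact: (gl_rho_ge0 gl).
    - exact: (mass_LL_ge0 ss gd (Df 2%N s s0)).
    - by apply: (gl_rho_mono gl) => //; exact: fq.
    - exact: f2.
  lra.
Qed.

Lemma successor_start x : initial_bounds x -> exists w e,
  admissible (fun=> 0) (fun=> 0) /\ successor x (fun=> 0) (fun=> 0) w e.
Proof.
move=> [Dx xM xq x2]; have L0 := (L_0 gd).2.
have D0 : DPoo 0 by move=> k _; exact: (domain_pos_0 ss gd).
have ad0 : admissible (fun=> 0) (fun=> 0).
  split.
  - split; [exact: strongly_measurable_cst|by move=> t _; exact: cone0|].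
    by move=> T T0; exists 0 => // t _ _; rewrite subrr; exact: cone0.
  - exact: strongly_measurable_cst.
  - by move=> t _; rewrite L0 (mass0 ss) addr0.
  - by move=> t _; rewrite L0 (bl0 (gl_q gl)).
  - by move=> t _; rewrite !L0 (mass0 ss) mulr_ge0// expR_ge0.
have [tf md fd fq f2] := ad0.
have [w [tw sw]] := step_exists ss gd gl M0 tf md fd Dx.
have [e me he] : exists2 e, sm (e : R -> R^o) & forall t, 0 <= t ->
    exists2 I, itv_int 0 t (fun s => diss s 0) I & e t = mass I.
  apply: (diss_path_exists ss gd gl) => //; first by case: tf.
  - by move=> t _; exact: D0.
  - by move=> T; exists 0 => t _ _; rewrite !L0 (mass0 ss).
exists w, e; split => //; split => //.
- by move=> t t0; rewrite subr0; case: tw => _ + _; apply.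
move=> t t0; have [I hI ->] := he t t0.
have := functional_int_le (mass_bounded_linear ss) (itv_int_eq _ (has_int_cst (0 : X) t0)) hI.
rewrite scaler0 (mass0 ss); apply => [s _ _|s s0 _]; first reflexivity.
by rewrite (mass0 ss); apply: (gl_diss_ge0 gl); exact: D0.
Qed.

(** Each iterate lies above the previous one by comparison, since both the
    datum and the source have increased. *)
Lemma successor_next x x' f d w e : initial_bounds x -> initial_bounds x' ->
  K (x' - x) -> admissible f d -> successor x f d w e ->
  exists w' e', successor x' w e w' e'.
Proof.
move=> bx bx' Kx ad su; have ad' := successor_admissible bx ad su.
have [[tw me] sw de fw dle] := su; have [_ _ wd _ w2] := ad'.
have [Dx' _ _ _] := bx'.
have [w' [tw' sw']] := step_exists ss gd gl M0 tw me wd Dx'.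
have [|t t0|T|e' me' he'] := diss_path_exists ss gd gl (g := w).
- by case: tw.
- exact: admissible_DP ad' t0.
- exists (second0 * expR (`|r| * `|T|)) => t t0 tT; apply: (le_trans (w2 t t0)).
  rewrite ler_wpM2l// ler_expR (le_trans (ler_norm _))// normrM ler_wpM2l//.
  by rewrite (ger0_norm t0) (le_trans tT)// ler_norm.
exists w', e'; split => //.
  apply: (linear_solution_comparison ss gd (rate_ge0 gl M0) sw sw' Kx) => s s0.
  have [_ _ fd _ _] := ad; have [d0 _] := fd s s0.
  apply: (source_isotone ss gd gl) => //; [exact: admissible_DP ad s0|
    exact: admissible_DP ad' s0|exact: fw|exact: dle].
move=> t t0; have [I hI ->] := de t t0; have [I' hI' ->] := he' t t0.
apply: (functional_int_le (mass_bounded_linear ss) hI hI') => s s0 _.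
by apply: (gl_diss_isotone gl); [exact: admissible_DP ad s0|
  exact: admissible_DP ad' s0|exact: fw].
Qed.

Lemma iteration (v : nat -> X) : (forall n, initial_bounds (v n)) ->
  (forall n, K (v n.+1 - v n)) -> exists (f : nat -> R -> X) (d : nat -> R -> R),
  [/\ forall t, f 0%N t = 0, forall t, d 0%N t = 0 &
    forall n, admissible (f n) (d n) /\ successor (v n) (f n) (d n) (f n.+1) (d n.+1)].
Proof.
move=> bv Kv; pose path := ((R -> X) * (R -> R))%type.
pose good (s : nat * (path * path)) := admissible s.2.1.1 s.2.1.2 /\
  successor (v s.1) s.2.1.1 s.2.1.2 s.2.2.1 s.2.2.2.
pose next (s s' : {s | good s}) := (sval s').1 = (sval s).1.+1 /\ (sval s').2.1 = (sval s).2.2.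
have [w [e [ad su]]] := successor_start (bv 0%N).
have g0 : good (0%N, ((fun=> 0, fun=> 0), (w, e))) by [].
have [|u [u0 uS]] := @dependent_choice _ next _ (exist _ _ g0).
  case=> -[n [[f d] [f' d']]] [/= ad1 su1]; apply: cid.
  have [w' [e' su2]] := successor_next (bv n) (bv n.+1) (Kv n) ad1 su1.
  have ad2 := successor_admissible (bv n) ad1 su1.
  have g : good (n.+1, ((f', d'), (w', e'))) by [].
  by exists (exist _ _ g).
have un n : (sval (u n)).1 = n by elim: n => [|n IH]; [rewrite u0|case: (uS n) => -> _; rewrite IH].
exists (fun n => (sval (u n)).2.1.1), (fun n => (sval (u n)).2.1.2).
split=> [t|t|n]; [by rewrite u0|by rewrite u0|].
have [E1 E2] := uS n; have := svalP (u n); rewrite /good un => -[ad1 su1].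
by split => //; rewrite E2.
Qed.

End iteration.

(** * Solutions of the evolution problem *)

Section solutions.
Context (R : realType) (X : completeNormedModType R) (le : X -> X -> Prop).
Hypothesis ss : state_space le.
Context (L : operator X) (J : X -> X) (S : R -> X -> X).
Hypothesis gd : generator_data le L J S.
Context (a rho : R -> R) (q : X -> R) (Kp Km : R -> X -> X).
Hypothesis gl : gain_loss le L a rho q Kp Km.
Context (f0 : X).
Hypothesis Df0 : domain_pos le L 2 f0.
Local Notation K := (cone le).
Local Notation mass := (mass le).
Local Notation DP := (domain_pos le L).
Local Notation DPoo := (domain_pos_oo le L).
Local Notation mu := (@lebesgue_measure R).
Local Notation Rplus := (`[0, +oo[%classic : set R).
Local Notation sm f := (strongly_measurable mu Rplus f).
Local Notation M := (mass (L f0)).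
Local Notation c := (a M).
Local Notation source := (source le L a Kp Km).
Local Notation diss t g := (L (Km t g) - L (Kp t g)).
Implicit Types (x y h : X) (t s T : R) (k : nat) (f g w : R -> X) (d e : R -> R).

(** Mild solutions in the moving frame, where the group has disappeared from
    the equation. *)
Definition evolution_solution g : Prop :=
  [/\ sm g, forall t, 0 <= t -> DP 2 (g t),
    forall T, exists C : R, forall t, 0 <= t -> t <= T -> mass (L (L (g t))) <= C &
    forall t, 0 <= t -> exists2 I, itv_int 0 t (fun s => Kp s (g s) - Km s (g s)) I &
      g t = f0 + I].

Lemma initial_mass_ge0 : 0 <= M.
Proof. exact: (mass_L_ge0 ss gd (domain_pos_lower (isT : (1 <= 2)%N) Df0)). Qed.

(** The equation is read through [J]: the right-hand side is [- J] of the
    dissipation, hence its integral is [- J D]. *)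
Lemma solution_dissipation g : evolution_solution g -> exists D : R -> X,
  [/\ forall t, 0 <= t -> itv_int 0 t (fun s => diss s (g s)) (D t),
    forall t, 0 <= t -> L (g t) = L f0 - D t &
    forall T, exists C : R, forall s t, 0 <= s -> s <= t -> t <= T ->
      `|D t - D s| <= C * (t - s)].
Proof.
move=> [mg Dg Cg eg]; have [D [hD DL]] := diss_path ss gd gl mg Dg Cg.
exists D; split=> // t t0; have [I hI gE] := eg t t0.
have IE : I = - J (D t).
  rewrite -[I]opprK; congr (- _); apply: (itv_int_uniq (f := fun s => Km s (g s) - Kp s (g s))).
    apply: itv_int_eq (has_intN (mu := mu) (measurable_itv _) (interval_finite _ _) hI).
    by move=> s _ _; rewrite opprB.
  apply: itv_int_eq (itv_int_linear (gd_J gd) (hD t t0)) => s s0 _.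
  have D1 := loss_domain ss gd gl s (Dg s s0).
  have D2 : DP 1 (Kp s (g s)) by apply: (gl_gain_domain gl) (Dg s s0); left.
  by rewrite (bl_sub (gd_J gd)) (gd_LK gd (domain_pos1 D1)) (gd_LK gd (domain_pos1 D2)).
have [DJ LJ] := gd_JK gd (D t).
have [_ ->] : domain L (g t) /\ L (g t) = L f0 - L (J (D t)).
  by rewrite gE IE; apply: (L_sub gd) => //; exact: (domain_pos_dom gd Df0).
by rewrite LJ.
Qed.

Lemma solution_lipschitz g D : (forall t, 0 <= t -> L (g t) = L f0 - D t) ->
  (forall T, exists C : R, forall s t, 0 <= s -> s <= t -> t <= T ->
      `|D t - D s| <= C * (t - s)) ->
  forall T, exists C : R, forall s t, 0 <= s -> s <= t -> t <= T ->
      `|L (g t) - L (g s)| <= C * (t - s).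
Proof.
move=> LE DL T; have [C hC] := DL T; exists C => s t s0 st tT.
rewrite !LE ?(le_trans s0)//.
have -> : L f0 - D t - (L f0 - D s) = - (D t - D s) by lmod R.
by rewrite normrN hC.
Qed.

(** A solution solves the linear problem behind the iteration, because its
    dissipated mass exactly compensates the decrease of the norm of [L g]. *)
Lemma solution_linear g D : evolution_solution g ->
  (forall t, 0 <= t -> itv_int 0 t (fun s => diss s (g s)) (D t)) ->
  (forall t, 0 <= t -> L (g t) = L f0 - D t) ->
  (forall T, exists C : R, forall s t, 0 <= s -> s <= t -> t <= T ->
      `|D t - D s| <= C * (t - s)) ->
  linear_solution le L c f0 (fun t => source t (g t) (mass (D t))) g.
Proof.
move=> [mg Dg Cg eg] hD LE DL; have LgL := solution_lipschitz LE DL.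
have sepX := ss_separable ss.
split => // t t0; have [I hI gE] := eg t t0.
have [I1 hI1] : exists I, itv_int 0 t (fun s => L (g s)) I.
  have [C hC] := LgL t; apply: (itv_int_bounded sepX (C := `|L (g 0)| + `|C| * t)) => //.
    exact: lipschitz_measurable.
  apply: ae_all => s; rewrite /= in_itv/= => /andP[s0 st].
  rewrite -(subrK (L (g 0)) (L (g s))) (le_trans (ler_normD _ _))// addrC lerD2l.
  rewrite (le_trans (hC _ _ (lexx 0) s0 st))// subr0.
  by rewrite (le_trans (ler_wpM2r s0 (ler_norm C)))// ler_wpM2l.
exists I1, (I + c *: I1); split => //; last by rewrite gE addrA.
apply: itv_int_eq (itv_intD hI (itv_intZ c hI1)) => s s0 _.
have E : mass (L (g s)) + mass (D s) = M by rewrite LE// (massB ss) subrK.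
by rewrite /source E; lmod R.
Qed.

(** By induction: if a solution and its dissipated mass lie above an iterate,
    its source lies above that of the iterate, and comparison applies to the
    linear problems they solve. *)
Lemma solution_above g D (v : nat -> X) (f : nat -> R -> X) (d : nat -> R -> R)
    (m1 m2 : R) : evolution_solution g ->
  (forall t, 0 <= t -> itv_int 0 t (fun s => diss s (g s)) (D t)) ->
  (forall t, 0 <= t -> L (g t) = L f0 - D t) ->
  (forall T, exists C : R, forall s t, 0 <= s -> s <= t -> t <= T ->
      `|D t - D s| <= C * (t - s)) ->
  (forall n, K (f0 - v n)) -> (forall t, f 0%N t = 0) -> (forall t, d 0%N t = 0) ->
  (forall n, admissible le L rho q M m1 m2 (f n) (d n) /\
     successor le L a Kp Km M (v n) (f n) (d n) (f n.+1) (d n.+1)) ->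
  forall n t, 0 <= t -> K (g t - f n t) /\ d n t <= mass (D t).
Proof.
move=> sg hD LE DL Kv f00 d00 fS; have sl := solution_linear sg hD LE DL.
have [mg Dg Cg eg] := sg; have mb := mass_bounded_linear ss.
have Dg1 t : 0 <= t -> DP 1 (g t) by move=> /Dg; exact: domain_pos_lower.
have Df n t k : 0 <= t -> DP k (f n t).
  by have [ad _] := fS n => t0; exact: (admissible_DP ss gd k ad t0).
elim=> [t t0|n IH t t0].
  rewrite f00 d00 subr0; split; first by case: (Dg t t0).
  have := functional_int_le mb (itv_int_eq _ (has_int_cst (0 : X) t0)) (hD t t0).
  rewrite scaler0 (mass0 ss); apply => [s _ _|s s0 _]; first reflexivity.
  by rewrite (mass0 ss); apply: (gl_diss_ge0 gl); exact: Dg.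
have [[_ _ fd _ _] [_ sf de _ _]] := fS n; split.
  apply: (linear_solution_comparison ss gd (rate_ge0 gl initial_mass_ge0) sf sl (Kv n)) => // s s0.
  have [KS dS] := IH s s0; have [d0 _] := fd s s0.
  by apply: (source_isotone ss gd gl) => //; [exact: Df|exact: Dg1].
have [I hI ->] := de t t0; apply: (functional_int_le mb hI (hD t t0)) => s s0 _.
have [KS _] := IH s s0.
by apply: (gl_diss_isotone gl); [exact: Df|exact: Dg|].
Qed.

End solutions.

(** * Existence and uniqueness *)

(** If [psi] vanishes up to [tau], then over the next [1 / (2 alpha + 1)] any
    bound for [psi] can be halved, hence [psi] vanishes there as well. *)
Lemma gronwall_zero (R : realType) (X : completeNormedModType R) (psi : R -> R)
    (u : R -> X) (T alpha B : R) : 0 <= alpha ->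
  (forall t, 0 <= t -> t <= T -> 0 <= psi t /\ psi t <= B) ->
  (forall t, 0 <= t -> t <= T -> exists2 I, itv_int 0 t u I & psi t = `|I|) ->
  (forall t, 0 <= t -> t <= T -> `|u t| <= alpha * psi t) ->
  forall t, 0 <= t -> t <= T -> psi t = 0.
Proof.
move=> al0 psiB psiI psiu; pose h := (2 * alpha + 1)^-1.
have h1 : 0 < 2 * alpha + 1 by rewrite ltr_wpDl// mulr_ge0.
have h0 : 0 < h by rewrite invr_gt0.
have alh : alpha * h <= 2^-1 by rewrite ler_pdivrMr// mulrDr mulrA mulVf// mul1r lerDl.
suff claim m t : 0 <= t -> t <= T -> t <= m%:R * h -> psi t = 0.
  move=> t t0 tT; apply: (claim (Num.bound (t / h))) => //.
  by rewrite -ler_pdivrMr//; apply/ltW/archi_boundP; rewrite divr_ge0// ltW.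
elim: m t => [t t0 tT|m IH].
  rewrite mul0r => t0'; have /eqP tE : t == 0 by rewrite eq_le t0 t0'.
  have [I + ->] := psiI t t0 tT.
  by rewrite tE => /itv_int_uniq/(_ (itv_int_point 0 u)) ->; rewrite normr0.
pose tau := m%:R * h; have tau0 : 0 <= tau by rewrite mulr_ge0// ltW.
have half j t : tau <= t -> t <= T -> t <= m.+1%:R * h -> psi t <= B * 2^-1 ^+ j.
  elim: j t => [t ht tT _|j IHj t ht tT th].
    by rewrite mulr1; have [] := psiB t (le_trans tau0 ht) tT.
  have t0 := le_trans tau0 ht; have [I hI ->] := psiI t t0 tT.
  have B0 : 0 <= B by have [p0 pB] := psiB t t0 tT; exact: le_trans pB.
  have Bj : 0 <= B * 2^-1 ^+ j by rewrite mulr_ge0// exprn_ge0.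
  have [I1 [I2 [hI1 hI2 ->]]] := itv_int_split tau0 ht hI.
  have I10 : `|I1| <= 0.
    rewrite -[0](mul0r (tau - 0)); apply: (itv_int_norm_le tau0 hI1) => //.
    apply: ae_all => s; rewrite /= in_itv/= => /andP[s0 st].
    have sT := le_trans st (le_trans ht tT).
    by apply: (le_trans (psiu s s0 sT)); rewrite (IH s s0 sT st) mulr0.
  have I2b : `|I2| <= alpha * (B * 2^-1 ^+ j) * (t - tau).
    apply: (itv_int_norm_le ht hI2); first exact: mulr_ge0.
    apply: ae_all => s; rewrite /= in_itv/= => /andP[ts st].
    apply: (le_trans (psiu s (le_trans tau0 ts) (le_trans st tT))).
    by rewrite ler_wpM2l// IHj// (le_trans st).
  rewrite (le_trans (ler_normD _ _))// (le_trans (lerD I10 I2b))// add0r.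
  have tt : t - tau <= h by move: th; rewrite -natr1 mulrDl mul1r -/tau lerBlDl.
  have aB : 0 <= alpha * (B * 2^-1 ^+ j) by exact: mulr_ge0.
  apply: (le_trans (ler_wpM2l aB tt)); rewrite exprSr [leRHS]mulrA.
  rewrite (_ : _ * h = B * 2^-1 ^+ j * (alpha * h)); last by ring.
  by rewrite ler_wpM2l.
move=> t t0 tT th; have [tt|tt] := leP t tau; first exact: IH tt.
have [p0 _] := psiB t t0 tT; apply/eqP; rewrite eq_le p0 andbT.
have hB : (fun j => B * 2^-1 ^+ j) @ \oo --> (0 : R) by exact: cvg_geometric_half.
apply: (ler_cvg_to (cvg_cst _) hB); apply: nearW => j; exact: (half j t (ltW tt) tT th).
Qed.

Section well_posedness.
Context (R : realType) (X : completeNormedModType R) (le : X -> X -> Prop).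
Hypothesis ss : state_space le.
Context (L : operator X) (J : X -> X) (S : R -> X -> X).
Hypothesis gd : generator_data le L J S.
Context (a rho : R -> R) (q : X -> R) (Kp Km : R -> X -> X).
Hypothesis gl : gain_loss le L a rho q Kp Km.
Context (f0 : X).
Hypothesis Df0 : domain_pos le L 2 f0.
Local Notation K := (cone le).
Local Notation mass := (mass le).
Local Notation DP := (domain_pos le L).
Local Notation DPoo := (domain_pos_oo le L).
Local Notation mu := (@lebesgue_measure R).
Local Notation Rplus := (`[0, +oo[%classic : set R).
Local Notation sm f := (strongly_measurable mu Rplus f).
Local Notation M := (mass (L f0)).
Local Notation c := (a M).
Local Notation moment0 := (q (L f0)).
Local Notation second0 := (mass (L (L f0))).
Local Notation r := (rho moment0).
Local Notation source := (source le L a Kp Km).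
Local Notation diss t g := (L (Km t g) - L (Kp t g)).
Local Notation evolution_solution := (evolution_solution le L Kp Km f0).
Implicit Types (x y h : X) (t s T : R) (k n : nat) (g w : R -> X) (d e : R -> R).

Let Df01 : DP 1 f0. Proof. exact: (domain_pos_lower (isT : (1 <= 2)%N) Df0). Qed.
Let M0 : 0 <= M. Proof. exact: (mass_L_ge0 ss gd Df01). Qed.

Lemma iteration_exists : exists (v : nat -> X) (f : nat -> R -> X) (d : nat -> R -> R),
  [/\ v n @[n --> \oo] --> f0, forall n, K (f0 - v n),
    (forall t, f 0%N t = 0) /\ (forall t, d 0%N t = 0) &
    forall n, admissible le L rho q M moment0 second0 (f n) (d n) /\
      successor le L a Kp Km M (v n) (f n) (d n) (f n.+1) (d n.+1)].
Proof.
have [v [vD vS Kv vc]] := domain_pos_oo_approx ss gd Df01.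
have m1 : 0 <= moment0.
  by apply: (gl_q_ge0 gl); case: (domain_pos_L gd Df01).
have m2 : 0 <= second0 by exact: (mass_LL_ge0 ss gd Df0).
have bv n : initial_bounds le L q M moment0 second0 (v n).
  have D1 := domain_pos_oo_k 1 (vD n); have D2 := domain_pos_oo_k 2 (vD n).
  have KL : K (L f0 - L (v n)) := L_isotone_pos gd D1 Df01 (Kv n).
  split => //.
  - exact: (mass_le ss).
  - exact: (q_le gl).
  - exact: (mass_L_le ss gd (domain_pos_L gd D2) (domain_pos_L gd Df0) KL).
have [f [d [fz dz fS]]] := iteration ss gd gl M0 m1 m2 bv vS.
by exists v, f, d.
Qed.

Section limit.
Context (v : nat -> X) (f : nat -> R -> X) (d : nat -> R -> R).
Hypotheses (vc : v n @[n --> \oo] --> f0) (Kv : forall n, K (f0 - v n))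
  (fS : forall n, admissible le L rho q M moment0 second0 (f n) (d n) /\
      successor le L a Kp Km M (v n) (f n) (d n) (f n.+1) (d n.+1)).

Let Df k n t : 0 <= t -> DP k (f n t).
Proof. by have [ad _] := fS n => t0; exact: (admissible_DP ss gd k ad t0). Qed.

Let fM n t : 0 <= t -> mass (L (f n t)) <= M.
Proof. by have [ad _] := fS n; exact: (admissible_mass ad). Qed.

Let Kf n t : 0 <= t -> K (f n.+1 t - f n t).
Proof. by have [_ [_ _ _ + _]] := fS n; apply. Qed.

Let f2 n t : 0 <= t -> mass (L (L (f n t))) <= second0 * expR (r * t).
Proof. by have [[_ _ _ _ +] _] := fS n; apply. Qed.

Let CT T : R := second0 * expR (`|r| * `|T|).

Let f2T n t T : 0 <= t -> t <= T -> mass (L (L (f n t))) <= CT T.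
Proof.
move=> t0 tT; apply: (le_trans (f2 n t0)); rewrite ler_wpM2l//.
  exact: (mass_LL_ge0 ss gd Df0).
rewrite ler_expR (le_trans (ler_norm _))// normrM ler_wpM2l//.
by rewrite (ger0_norm t0) (le_trans tT)// ler_norm.
Qed.

(** The bound on [L^2 f n t] gives convergence of [L (f n t)] together with
    its image, and [J] gives that of [f n t]. *)
Lemma limit_exists : exists g : R -> X, forall t, 0 <= t ->
  [/\ DP 2 (g t), f n t @[n --> \oo] --> g t, L (f n t) @[n --> \oo] --> L (g t),
    L (L (f n t)) @[n --> \oo] --> L (L (g t)) & forall n, K (g t - f n t)].
Proof.
suff /choice[g hg] t : exists x, 0 <= t -> [/\ DP 2 x, f n t @[n --> \oo] --> x,
  L (f n t) @[n --> \oo] --> L x, L (L (f n t)) @[n --> \oo] --> L (L x) &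
  forall n, K (x - f n t)] by exists g.
have [t0|t0] := leP 0 t; last by exists 0.
have DL n : DP 1 (L (f n t)) := domain_pos_L gd (Df 2 n t0).
have KL n : K (L (f n.+1 t) - L (f n t)).
  exact: (L_isotone_pos gd (Df 1 n t0) (Df 1 n.+1 t0) (Kf n t0)).
have [y [Dy yc Lyc _]] := domain_pos_mono_cvg ss gd DL KL (fun n => f2 n t0).
have [DJ LJ] := gd_JK gd y.
have fE : (fun n => f n t) = fun n => J (L (f n t)).
  by apply/funext => n; rewrite (gd_LK gd)//; exact: (domain_pos1 (Df 1 n t0)).
have fc : f n t @[n --> \oo] --> J y by rewrite fE; exact: (bl_cvg (gd_J gd)).
exists (J y) => _; rewrite LJ; split => //; first exact: (domain_pos_J gd).
exact: (incr_cone_lim ss (fun n => Kf n t0) fc).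
Qed.

Section limit_path.
Context (g : R -> X).
Hypothesis gP : forall t, 0 <= t ->
  [/\ DP 2 (g t), f n t @[n --> \oo] --> g t, L (f n t) @[n --> \oo] --> L (g t),
    L (L (f n t)) @[n --> \oo] --> L (L (g t)) & forall n, K (g t - f n t)].

Let Dg t : 0 <= t -> DP 2 (g t). Proof. by case/gP. Qed.
Let Dg1 t : 0 <= t -> DP 1 (g t). Proof. by move=> /Dg; exact: domain_pos_lower. Qed.

Lemma limit_second t : 0 <= t -> mass (L (L (g t))) <= second0 * expR (r * t).
Proof.
move=> t0; have [_ _ _ h _] := gP t0.
have [_ KLL] := domain_pos_L gd (domain_pos_L gd (Dg t0)).
rewrite (mass_cone ss KLL); apply: (cvgn_norm_le h) => n.
by rewrite -(mass_cone ss) ?f2//; case: (domain_pos_L gd (domain_pos_L gd (Df 2 n t0))).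
Qed.

Let g2T T : exists C : R, forall t, 0 <= t -> t <= T -> mass (L (L (g t))) <= C.
Proof.
exists (CT T) => t t0 tT; apply: (le_trans (limit_second t0)).
rewrite ler_wpM2l//; first exact: (mass_LL_ge0 ss gd Df0).
rewrite ler_expR (le_trans (ler_norm _))// normrM ler_wpM2l//.
by rewrite (ger0_norm t0) (le_trans tT)// ler_norm.
Qed.

Let mg : sm g.
Proof.
apply: (strongly_measurable_lim (mu := mu) (measurable_itv _) (u := f) (ss_separable ss)).
  by move=> n; have [[[mf _ _] _ _ _ _] _] := fS n.
by apply: ae_all => t; rewrite /= in_itv/= andbT => /gP[].
Qed.

(** The images under [L] of gain and loss increase with bounded norms; their
    limits are identified by the convergence of gain and loss. *)
Lemma diss_cvg s : 0 <= s -> diss s (f n s) @[n --> \oo] --> diss s (g s).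
Proof.
move=> s0; have [_ fc _ _ _] := gP s0.
have D1 n := Df 1 n s0; have KS n := Kf n s0.
have loss_bd n : mass (L (Km s (f n s))) <= c * CT s.
  apply: (le_trans (mass_L_loss ss gd gl s (Df 2 n s0) (fM n s0))).
  by rewrite ler_wpM2l//; [exact: (rate_ge0 gl M0)|exact: f2T].
have [x [_ xc Lx _]] := domain_pos_mono_cvg ss gd (u := fun n => Km s (f n s))
  (fun n => loss_domain ss gd gl s (Df 2 n s0))
  (fun n => gl_loss_isotone gl s (D1 n) (D1 n.+1) (KS n)) loss_bd.
have [y [_ yc Ly _]] := domain_pos_mono_cvg ss gd (u := fun n => Kp s (f n s))
  (fun n => gl_gain_domain gl s (or_introl erefl) (Df 2 n s0))
  (fun n => gl_gain_isotone gl s (D1 n) (D1 n.+1) (KS n))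
  (fun n => le_trans (mass_L_gain ss gl s (Df 2 n s0)) (loss_bd n)).
rewrite (cvgn_uniq (gl_loss_cvg gl (t := s) D1 KS fc (Dg1 s0)) xc).
by rewrite (cvgn_uniq (gl_gain_cvg gl (t := s) D1 KS fc (Dg1 s0)) yc); exact: cvgB.
Qed.

Context (D : R -> X).
Hypotheses (hD : forall t, 0 <= t -> itv_int 0 t (fun s => diss s (g s)) (D t))
  (mD : sm (fun t => mass (D t) : R^o)).

Lemma dissipated_cvg t : 0 <= t -> d n.+1 t @[n --> \oo] --> (mass (D t) : R).
Proof.
move=> t0; have /choice[I hI] n : exists I, itv_int 0 t (fun s => diss s (f n s)) I /\
    d n.+1 t = mass I.
  by have [_ [_ _ de _ _]] := fS n; have [I hI E] := de t t0; exists I.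
have [|||I' hI' Ic] := itv_int_lim (ss_separable ss) (a := 0) (b := t)
  (u := fun n s => diss s (f n s)) (f := fun s => diss s (g s)) (I_ := I)
  (C := 2 * (c * CT t)).
- by move=> n; case: (hI n).
- by apply: ae_all => s; rewrite /= in_itv/= => /andP[s0 _]; exact: diss_cvg.
- apply: ae_all => s n; rewrite /= in_itv/= => /andP[s0 st].
  apply: (le_trans (diss_norm ss gd gl s (Df 2 n s0) (fM n s0))).
  by rewrite ler_wpM2l// ler_wpM2l//; [exact: (rate_ge0 gl M0)|exact: f2T].
rewrite (itv_int_uniq (hD t0) hI').
under eq_fun do rewrite (hI _).2.
exact: (mass_cvg ss Ic).
Qed.

Lemma limit_bounds t : 0 <= t -> 0 <= mass (D t) /\ mass (L (g t)) + mass (D t) <= M.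
Proof.
move=> t0; have dc := dissipated_cvg t0; have [_ _ Lc _ _] := gP t0.
split.
  apply: (ler_cvg_to (cvg_cst _) dc); apply: nearW => n.
  by have [[_ _ fd _ _] _] := fS n.+1; case: (fd t t0).
have h : mass (L (f n.+1 t)) + d n.+1 t @[n --> \oo] --> mass (L (g t)) + mass (D t).
  by apply: cvgD => //; exact: (cvgn_succ (V := R^o) (mass_cvg ss Lc)).
apply: (ler_cvg_to h (cvg_cst _)); apply: nearW => n.
by have [[_ _ fd _ _] _] := fS n.+1; case: (fd t t0).
Qed.

Lemma source_cvg s : 0 <= s ->
  source s (f n.+1 s) (d n.+1 s) @[n --> \oo] --> source s (g s) (mass (D s)).
Proof.
move=> s0; have [_ fc Lc _ Kg] := gP s0; have dc := dissipated_cvg s0.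
have D1 n := Df 1 n s0; have KS n := Kf n s0.
have gc := cvgn_succ (gl_gain_cvg gl (t := s) D1 KS fc (Dg1 s0)).
have lc := cvgn_succ (gl_loss_cvg gl (t := s) D1 KS fc (Dg1 s0)).
apply: cvgD => //; apply: cvgB => //; apply: cvgZ; last exact: cvgn_succ Lc.
have [b0 bM] := limit_bounds s0; have mg0 := mass_L_ge0 ss gd (Dg1 s0).
have xc : mass (L (f n.+1 s)) + d n.+1 s @[n --> \oo] --> mass (L (g s)) + mass (D s).
  by apply: cvgD => //; exact: (cvgn_succ (V := R^o) (mass_cvg ss Lc)).
set x := mass (L (g s)) + mass (D s) in bM xc *.
have aM0 : 0 <= a (M + 1) by apply: (cr_ge0 (gl_rate gl)); rewrite addr_ge0.
apply: (cvgn_bound (V := R^o) (b := fun n => a (M + 1) * `|mass (L (f n.+1 s)) + d n.+1 s - x|)).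
  move=> n; have [[_ _ fd _ _] _] := fS n.+1; have [d0 dM] := fd s s0.
  set y := mass (L (f n.+1 s)) + d n.+1 s in dM *.
  have y0 : 0 <= y by rewrite addr_ge0// (mass_L_ge0 ss gd)//; exact: Df.
  have x0 : 0 <= x by rewrite addr_ge0.
  have key (p p' : R) : 0 <= p -> p <= p' -> p' <= M -> `|a p' - a p| <= a (M + 1) * `|p' - p|.
    move=> p0 pp' p'M; rewrite [leLHS]ger0_norm ?subr_ge0; last exact: (cr_mono (gl_rate gl)).
    by rewrite ger0_norm ?subr_ge0//; exact: (cr_lipschitz (gl_rate gl)).
  have [xy|yx] := leP x y; first exact: key.
  by rewrite distrC [`|y - x|]distrC; apply: key => //; exact: ltW.
rewrite -[X in _ --> X](mulr0 (a (M + 1))); apply: cvgMr.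
rewrite -(normr0 R); apply: cvg_norm; rewrite -(subrr x); apply: cvgB => //; exact: cvg_cst.
Qed.

(** Bounded convergence in the linear problems of the iteration. *)
Lemma limit_equation t : 0 <= t -> exists I1 I2,
  [/\ itv_int 0 t (fun s => L (g s)) I1,
    itv_int 0 t (fun s => source s (g s) (mass (D s))) I2 & g t + c *: I1 = f0 + I2].
Proof.
move=> t0; have sepX := ss_separable ss.
have eqn n : exists I1 I2, [/\ itv_int 0 t (fun s => L (f n.+2 s)) I1,
    itv_int 0 t (fun s => source s (f n.+1 s) (d n.+1 s)) I2 &
    f n.+2 t + c *: I1 = v n.+1 + I2].
  by have [_ [_ [_ _ _ weq] _ _ _]] := fS n.+1; exact: weq.
have [I1 /choice[I2 hI]] := choice eqn.
have [CJ CJ0 hCJ] := mass_J ss gd.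
have [|||J1 hJ1 J1c] := itv_int_lim sepX (a := 0) (b := t) (u := fun n s => L (f n.+2 s))
  (f := fun s => L (g s)) (I_ := I1) (C := M).
- by move=> n; case: (hI n).
- apply: ae_all => s; rewrite /= in_itv/= => /andP[/gP[_ _ Lc _ _] _].
  exact: (cvgn_succ (cvgn_succ Lc)).
- apply: ae_all => s n; rewrite /= in_itv/= => /andP[s0 _].
  by rewrite -(mass_cone ss) ?fM//; case: (domain_pos_L gd (Df 1 n.+2 s0)).
have [|||J2 hJ2 J2c] := itv_int_lim sepX (a := 0) (b := t)
  (u := fun n s => source s (f n.+1 s) (d n.+1 s))
  (f := fun s => source s (g s) (mass (D s))) (I_ := I2) (C := CJ * (c * CT t)).
- by move=> n; case: (hI n).
- by apply: ae_all => s; rewrite /= in_itv/= => /andP[s0 _]; exact: source_cvg.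
- apply: ae_all => s n; rewrite /= in_itv/= => /andP[s0 st].
  have [[_ _ fd _ _] _] := fS n.+1; have [d0 dM] := fd s s0.
  have D1 := source_domain ss gd gl s (Df 2 n.+1 s0) d0.
  rewrite -(mass_cone ss (domain_pos_cone D1)) (le_trans (hCJ _ D1))// ler_wpM2l//.
  apply: (le_trans (mass_L_source ss gd gl s (Df 2 n.+1 s0) d0 dM)).
  by rewrite ler_wpM2l//; [exact: (rate_ge0 gl M0)|exact: f2T].
exists J1, J2; split => //; have [_ fc _ _ _] := gP t0.
apply: (cvgn_uniq (u := fun n => f n.+2 t + c *: I1 n)).
  by apply: cvgD; [exact: (cvgn_succ (cvgn_succ fc))|exact: cvgZr].
have E : (fun n => f n.+2 t + c *: I1 n) = fun n => v n.+1 + I2 n.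
  by apply/funext => n; case: (hI n).
by rewrite E; apply: cvgD => //; exact: (cvgn_succ vc).
Qed.

(** The defect [psi = M - |L g| - mass D] of the energy identity satisfies a
    homogeneous Gronwall inequality: it is the integral of
    [(a M - a (M - psi)) |L^2 g|], and [a] is Lipschitz on [[0, M]]. *)
Lemma limit_energy t : 0 <= t -> mass (L (g t)) + mass (D t) = M.
Proof.
move=> T0; set T := t in T0 *; have sepX := ss_separable ss.
pose psi s := M - (mass (L (g s)) + mass (D s)).
suff /(_ T T0 (lexx T)) : forall s, 0 <= s -> s <= T -> psi s = 0.
  by rewrite /psi => /eqP; rewrite subr_eq0 => /eqP.
have md s : 0 <= s -> 0 <= mass (D s) /\ mass (L (g s)) + mass (D s) <= M := @limit_bounds s.
have LLm : sm (fun s => L (L (g s))).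
  apply: (L_measurable ss gd) => [|s s0]; last exact: (domain_pos_L gd (Dg s0)).
  by apply: (L_measurable ss gd).
have msrc := source_measurable ss gd gl M0 mg Dg1 mD md.
have Dsrc s : 0 <= s -> DP 1 (source s (g s) (mass (D s))).
  by move=> s0; have [d0 _] := md s s0; exact: (source_domain ss gd gl s (Dg s0) d0).
have mLsrc := L_measurable ss gd msrc Dsrc.
have [C0 hC0] := g2T T; pose C := `|C0|.
have hC s : 0 <= s -> s <= T -> mass (L (L (g s))) <= C.
  by move=> s0 sT; apply: (le_trans (hC0 s s0 sT)); exact: ler_norm.
have c0 := rate_ge0 gl M0; have aM0 : 0 <= a (M + 1).
  by apply: (cr_ge0 (gl_rate gl)); rewrite addr_ge0.
have KLL s : 0 <= s -> K (L (L (g s))).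
  by move=> s0; case: (domain_pos_L gd (domain_pos_L gd (Dg s0))).
pose u s := (c - a (mass (L (g s)) + mass (D s))) *: L (L (g s)).
have rate s : 0 <= s -> 0 <= c - a (mass (L (g s)) + mass (D s)) /\
    c - a (mass (L (g s)) + mass (D s)) <= a (M + 1) * psi s.
  move=> s0; have [d0 dM] := md s s0; have [r0 rc] := rate_le ss gd gl (Dg1 s0) d0 dM.
  rewrite subr_ge0; split => //; apply: (cr_lipschitz (gl_rate gl)) => //.
  by rewrite addr_ge0// (mass_L_ge0 ss gd (Dg1 s0)).
apply: (gronwall_zero (u := u) (alpha := a (M + 1) * C) (B := M)).
- by rewrite mulr_ge0// normr_ge0.
- move=> s s0 _; have [d0 dM] := md s s0; rewrite subr_ge0; split => //.
  by rewrite gerBl addr_ge0// (mass_L_ge0 ss gd (Dg1 s0)).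
- move=> s s0 sT; have [I1 [I2 [hI1 hI2 E]]] := limit_equation s0.
  have [I1' hI1'] : exists I, itv_int 0 s (fun r => L (L (g r))) I.
    apply: (itv_int_bounded sepX (C := C)) => //; apply: ae_all => p.
    rewrite /= in_itv/= => /andP[p0 ps]; rewrite -(mass_cone ss (KLL p p0)).
    by apply: hC => //; exact: le_trans sT.
  have [I2' hI2'] : exists I, itv_int 0 s (fun r => L (source r (g r) (mass (D r)))) I.
    apply: (itv_int_bounded sepX (C := c * C)) => //; apply: ae_all => p.
    rewrite /= in_itv/= => /andP[p0 ps]; have [d0 dM] := md p p0.
    have [_ KLs] := domain_pos_L gd (Dsrc p p0); rewrite -(mass_cone ss KLs).
    apply: (le_trans (mass_L_source ss gd gl p (Dg p0) d0 dM)).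
    by rewrite ler_wpM2l// hC// (le_trans ps).
  have I1E : I1 = J I1'.
    apply: (itv_int_uniq hI1 (itv_int_J gd _ hI1')) => p p0 _.
    exact: (domain_pos_dom gd (domain_pos_L gd (Dg p0))).
  have I2E : I2 = J I2'.
    apply: (itv_int_uniq hI2 (itv_int_J gd _ hI2')) => p p0 _.
    exact: (domain_pos1 (Dsrc p p0)).
  have hu : itv_int 0 s u (c *: I1' - I2' - D s).
    apply: itv_int_eq (itv_intB (itv_intB (itv_intZ c hI1') hI2') (hD s0)) => p p0 _.
    have [d0 _] := md p p0; rewrite (L_source ss gd gl p (Dg p0) d0) /u; lmod R.
  exists (c *: I1' - I2' - D s) => //.
  have Ku : K (c *: I1' - I2' - D s).
    apply: (itv_int_pos ss (lexx 0) _ hu) => p p0; apply: coneZ => //; last exact: KLL.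
    by have [] := rate p p0.
  rewrite -(mass_cone ss Ku).
  have gE : J (L (g s)) = J (L f0 + I2' - c *: I1').
    have bJ := gd_J gd; rewrite (gd_LK gd (domain_pos1 (Dg1 s0))) (bl_sub bJ) (bl_add bJ).
    by rewrite (bl_scale bJ) (gd_LK gd (domain_pos1 Df01)) -I1E -I2E -E addrK.
  have LgE : L (g s) = L f0 + I2' - c *: I1'.
    by have [_ <-] := gd_JK gd (L (g s)); rewrite gE; case: (gd_JK gd (L f0 + I2' - c *: I1')).
  by rewrite /psi LgE !(massB ss, massD ss); ring.
- move=> s s0 sT; have [r0 rb] := rate s s0.
  rewrite /u normrZ (ger0_norm r0) -(mass_cone ss (KLL s s0)) mulrAC.
  apply: ler_pM => //; first exact: (mass_ge0 ss (KLL s s0)).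
  exact: hC.
Qed.

(** By the energy identity the rate in the source is [a M = c], and the
    absorption term cancels. *)
Lemma limit_solution : evolution_solution g.
Proof.
split => // t t0; have [I1 [I2 [hI1 hI2 E]]] := limit_equation t0.
exists (I2 - c *: I1); last by rewrite addrA -E addrK.
apply: itv_int_eq (itv_intB hI2 (itv_intZ c hI1)) => s s0 _.
by rewrite /source (limit_energy s0); lmod R.
Qed.

End limit_path.

End limit.

(** Any solution lies above the iterates, hence above their limit. Two ordered
    solutions dissipate in the same order, while the sum of [|L g|] and the
    dissipated mass is the same for both; so [L] vanishes on their difference.
    *)
Theorem evolution_well_posed : exists g, [/\ evolution_solution g,
  forall g', evolution_solution g' -> forall t, 0 <= t -> g' t = g t &
  forall t, 0 <= t -> mass (L (L (g t))) <= second0 * expR (r * t)].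
Proof.
have [v [f [d [vc Kv [fz dz] fS]]]] := iteration_exists.
have [g gP] := limit_exists fS.
have Dg t : 0 <= t -> DP 2 (g t) by case/gP.
have g2 := limit_second fS gP.
have mg : sm g.
  apply: (strongly_measurable_lim (mu := mu) (measurable_itv _) (u := f) (ss_separable ss)).
    by move=> n; have [[[mf _ _] _ _ _ _] _] := fS n.
  by apply: ae_all => t; rewrite /= in_itv/= andbT => /gP[].
have [|D0 [hD0 DL0]] := diss_path ss gd gl mg Dg.
  move=> T; exists (second0 * expR (`|r| * `|T|)) => t t0 tT; apply: (le_trans (g2 t t0)).
  rewrite ler_wpM2l//; first exact: (mass_LL_ge0 ss gd Df0).
  rewrite ler_expR (le_trans (ler_norm _))// normrM ler_wpM2l//.
  by rewrite (ger0_norm t0) (le_trans tT)// ler_norm.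
have mD0 : sm (fun t => mass (D0 t) : R^o).
  apply: (strongly_measurable_comp (mu := mu) (bl_continuous (mass_bounded_linear ss))).
  by apply: lipschitz_measurable => //; exact: (ss_separable ss).
have sg := limit_solution vc fS gP hD0 mD0.
exists g; split => // g' sg' t t0.
have [D [hD LE DL]] := solution_dissipation ss gd gl Df0 sg.
have [D' [hD' LE' DL']] := solution_dissipation ss gd gl Df0 sg'.
have above s : 0 <= s -> K (g' s - g s).
  move=> s0; have [_ fc _ _ _] := gP s s0.
  apply: (cone_lim ss (u := fun n => g' s - f n s)).
    by apply: cvgB => //; exact: cvg_cst.
  by move=> n; have [] := solution_above ss gd gl Df0 sg' hD' LE' DL' Kv fz dz fS n s0.
have [_ Dg' _ _] := sg'.
have Dg1 : DP 1 (g t) := domain_pos_lower (isT : (1 <= 2)%N) (Dg t t0).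
have Dg1' : DP 1 (g' t) := domain_pos_lower (isT : (1 <= 2)%N) (Dg' t t0).
have DD : mass (D t) <= mass (D' t).
  apply: (functional_int_le (mass_bounded_linear ss) (hD t t0) (hD' t t0)) => s s0 _.
  by apply: (gl_diss_isotone gl); [exact: Dg|exact: Dg'|exact: above].
have KL := L_isotone_pos gd Dg1 Dg1' (above t t0).
have L0 : L (g' t) - L (g t) = 0.
  apply: (cone_mass_eq0 ss KL); apply/eqP; rewrite eq_le (mass_ge0 ss KL) andbT.
  by rewrite LE// LE'// (massB ss) !(massB ss); lra.
rewrite -(gd_LK gd (domain_pos1 Dg1)) -(gd_LK gd (domain_pos1 Dg1')).
by congr J; apply/eqP; rewrite -subr_eq0 L0.
Qed.

End well_posedness.

(** * The isometric group *)

Lemma half_line_continuousP (R : realType) (X : completeNormedModType R) (f : R -> X) :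
  {within `[0, +oo[%classic, continuous f} <->
  forall t, 0 <= t -> forall eps : R, 0 < eps -> exists2 del : R, 0 < del &
     forall s, 0 <= s -> `|s - t| < del -> `|f s - f t| < eps.
Proof.
split=> [/subspace_continuousP cf t t0 eps eps0|cf].
  have t0' : `[0, +oo[%classic t by rewrite /= in_itv/= t0.
  have /cvgrPdist_lt/(_ _ eps0)/nbhs_ballP[del /= del0 hd] := cf t t0'.
  exists del => // s s0 st; rewrite distrC; apply: hd.
    by rewrite -ball_normE /= distrC.
  by rewrite /= in_itv/= s0.
apply/subspace_continuousP => t; rewrite /= in_itv/= andbT => t0.
apply/cvgrPdist_lt => eps eps0; have [del del0 hd] := cf t t0 eps eps0.
apply/nbhs_ballP; exists del => // s; rewrite -ball_normE /= => ts.
by rewrite in_itv/= andbT => s0; rewrite distrC; apply: hd => //; rewrite distrC.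
Qed.

(** The commutation for negative times follows from that at positive times,
    because the group maps the domain onto itself. *)
Lemma operator_image_domain (R : realType) (X : completeNormedModType R)
    (T : operator X) (U : R -> X -> X) : C0_group U ->
  (forall t, U t @` domain T = domain T) ->
  (forall t g, 0 < t -> domain T g -> U t (T g) = T (U t g)) ->
  forall t g, domain T g -> domain T (U t g) /\ T (U t g) = U t (T g).
Proof.
move=> gU imU cU; have Ud t g : domain T g -> domain T (U t g).
  by move=> Dg; rewrite -(imU t); exists g.
move=> t g Dg; split; first exact: Ud.
have [->|t0] := eqVneq t 0; first by rewrite !(gr_0 gU).
have [tp|tn] := ltP 0 t; first by rewrite cU.
have nt : 0 < - t by rewrite oppr_gt0 lt_neqAle t0.
have := cU (- t) (U t g) nt (Ud t g Dg).
rewrite -(gr_add gU) addNr (gr_0 gU) => <-.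
by rewrite -(gr_add gU) subrr (gr_0 gU).
Qed.

Section group.
Context (R : realType) (X : completeNormedModType R) (le : X -> X -> Prop).
Hypothesis ss : state_space le.
Context (L : operator X) (J : X -> X) (S : R -> X -> X).
Hypothesis gd : generator_data le L J S.
Context (U : R -> X -> X).
Hypotheses (gU : C0_group U) (U_pos : forall t g, cone le g -> cone le (U t g))
  (U_norm : forall t g, cone le g -> `|U t g| = `|g|)
  (UL : forall t g, domain L g -> domain L (U t g) /\ L (U t g) = U t (L g)).
Local Notation K := (cone le).
Local Notation mass := (mass le).
Local Notation DP := (domain_pos le L).
Local Notation DPoo := (domain_pos_oo le L).
Local Notation mu := (@lebesgue_measure R).
Local Notation Rplus := (`[0, +oo[%classic : set R).
Local Notation sm f := (strongly_measurable mu Rplus f).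
Implicit Types (x y g h : X) (t s : R) (k : nat).

Lemma groupB t x y : U t (x - y) = U t x - U t y.
Proof.
have -> : x - y = -1 *: y + x by lmod R.
by rewrite (gr_linear gU); lmod R.
Qed.

Lemma groupK t x : U (- t) (U t x) = x.
Proof. by rewrite -(gr_add gU) addNr (gr_0 gU). Qed.

Lemma groupNK t x : U t (U (- t) x) = x.
Proof. by rewrite -(gr_add gU) subrr (gr_0 gU). Qed.

Lemma group_uniform_bound : exists2 C : R, 0 <= C & forall t x, `|U t x| <= C * `|x|.
Proof.
have [C C0 hC] := cone_decomposition ss.
exists (C + C) => [|t x]; first exact: addr_ge0.
have [g [g' [Kg Kg' xE gC gC']]] := hC x.
by rewrite {1}xE groupB (le_trans (ler_normB _ _))// mulrDl lerD// U_norm.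
Qed.

Lemma group_bounded_linear t : bounded_linear (U t).
Proof.
split; [exact: groupB| |by have [C C0 hC] := group_uniform_bound; exists C].
move=> a x; have U0 : U t 0 = 0 by rewrite -{1}(subrr (0 : X)) groupB subrr.
by rewrite -[a *: x]addr0 (gr_linear gU) U0 addr0.
Qed.

Lemma mass_group t x : mass (U t x) = mass x.
Proof.
have [g [h [Kg Kh ->]]] := ss_generating ss x.
by rewrite groupB !(massE ss) ?U_norm//; exact: U_pos.
Qed.

(** [U t (J x)] is in the domain and [L] maps it to [U t x]. *)
Lemma J_group t x : J (U t x) = U t (J x).
Proof.
have [DJ LJ] := gd_JK gd x; have [D1 L1] := UL t DJ.
by rewrite -(gd_LK gd D1) L1 LJ.
Qed.

Lemma domain_pos_group k t g : DP k g -> DP k (U t g) /\ iter k L (U t g) = U t (iter k L g).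
Proof.
move=> /(domain_posP gd)[y Ky ->].
have -> : U t (iter k J y) = iter k J (U t y) by elim: k => //= k <-; rewrite J_group.
by rewrite !(iterLJ gd); split => //; apply/(domain_posP gd); exists (U t y) => //; exact: U_pos.
Qed.

Lemma domain_pos_oo_group t g : DPoo g -> DPoo (U t g).
Proof. by move=> Dg k k0; have [] := domain_pos_group t (Dg k k0). Qed.

Lemma orbit_continuous x t (eps : R) : 0 < eps ->
  exists2 del : R, 0 < del & forall s, `|s - t| < del -> `|U s x - U t x| < eps.
Proof.
move=> eps0; have [C C0 hC] := group_uniform_bound.
have C1 : 0 < C + 1 by rewrite ltr_wpDl.
have e1 : 0 < eps / (C + 1) by exact: divr_gt0.
have /cvgrPdist_lt/(_ _ e1)/nbhs_ballP[del /= del0 hd] := gr_cont gU (g := x).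
exists del => // s st; have -> : U s x - U t x = U t (U (s - t) x - x).
  by rewrite groupB -(gr_add gU) [t + _]addrC subrK.
have h : `|U (s - t) x - x| < eps / (C + 1).
  by rewrite distrC; apply: hd; rewrite -ball_normE /= sub0r normrN.
apply: (le_lt_trans (hC _ _)); rewrite ltr_pdivlMr// mulrC in h.
by apply: le_lt_trans h; rewrite ler_wpM2r// lerDl.
Qed.

Lemma group_path_continuous (v : R -> X) :
  (forall T, exists C : R, forall s t, 0 <= s -> s <= t -> t <= T ->
     `|v t - v s| <= C * (t - s)) ->
  {within Rplus, continuous (fun t => U t (v t))}.
Proof.
move=> vL; apply/half_line_continuousP => t t0 eps eps0.
have [C C0 hC] := group_uniform_bound; have [Cv hv] := vL (t + 1).
have e2 : 0 < eps / 2 by exact: divr_gt0.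
have [del del0 hd] := orbit_continuous (v t) t e2.
have B0 : 0 < C * `|Cv| + 1 by rewrite ltr_wpDl// mulr_ge0.
exists (Num.min (Num.min del 1) (eps / 2 / (C * `|Cv| + 1))) => [|s s0].
  by rewrite !lt_min del0 ltr01 divr_gt0.
rewrite !lt_min => /andP[/andP[sdel s1]]; rewrite ltr_pdivlMr// => sB.
have -> : U s (v s) - U t (v t) = U s (v s - v t) + (U s (v t) - U t (v t)).
  by rewrite groupB; lmod R.
rewrite (le_lt_trans (ler_normD _ _))// (splitr eps) ltrD//; last exact: hd.
apply: le_lt_trans sB; apply: (le_trans (hC _ _)).
have st1 : s <= t + 1 by move: s1; rewrite ltr_norml => /andP[_]; rewrite ltrBlDl => /ltW.
have key p p' : 0 <= p -> p <= p' -> p' <= t + 1 -> `|v p' - v p| <= `|Cv| * `|p' - p|.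
  move=> p0 pp' p't; apply: (le_trans (hv p p' p0 pp' p't)).
  by rewrite (ger0_norm (_ : 0 <= p' - p)) ?subr_ge0// ler_wpM2r ?subr_ge0// ler_norm.
have h : `|v s - v t| <= `|Cv| * `|s - t|.
  have [ts|ts] := leP t s; first exact: key.
  by rewrite distrC [`|s - t|]distrC; apply: key => //; [exact: ltW|rewrite lerDl].
apply: (le_trans (ler_wpM2l C0 h)); rewrite mulrA mulrC ler_wpM2l//.
by rewrite lerDl.
Qed.

Lemma group_path_measurable (s : R -> R) (v : R -> X) : (s = id \/ s = -%R) ->
  sm v -> sm (fun t => U (s t) (v t)).
Proof.
move=> sE mv; apply: (strongly_measurable_caratheodory (mu := mu) (measurable_itv _)
  (phi := fun t x => U (s t) x)) => //.
- exact: (ss_separable ss).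
- move=> x; apply: (continuous_strongly_measurable (ss_separable ss)) => t _ eps eps0.
  have [del del0 hd] := orbit_continuous x (s t) eps0.
  exists del => // p _ pt; apply: hd; case: sE => ->//=.
  by rewrite opprK addrC distrC.
- by move=> t _; exact: (gr_bounded gU).
Qed.

End group.

(** * Removing the transport *)

(** The hypotheses on the nonlinear operators at a single time, gathered so
    that their exceptional null sets are discarded together. *)
Record model_at (R : realType) (X : completeNormedModType R) (le : X -> X -> Prop)
    (D : set X) (L L1 : operator X) (a rho : R -> R) (Qp Qm : R -> X -> X) (t : R) : Prop :=
  ModelAt {
  at_gain_isotone : isotone_on le le D (Qp t);
  at_loss_isotone : isotone_on le le D (Qm t);
  at_gain_oclosed : o_closed le D (Qp t);
  at_loss_oclosed : o_closed le D (Qm t);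
  at_gain_domain : forall k g, k = 1%N \/ k = 2%N ->
    domain_pos le L k.+1 g -> domain_pos le L k (Qp t g);
  at_loss_domain : forall k g, k = 1%N \/ k = 2%N ->
    domain_pos le L k.+1 g -> domain_pos le L k (Qm t g);
  at_loss_bound : forall g, domain_pos le L 1 g ->
    le 0 (Qm t g) /\ le (Qm t g) (a `|L g| *: L g);
  at_gap_isotone : isotone_on le le (domain_pos le L 1)
    (fun g => a `|L g| *: L g - Qm t g);
  at_diss_ge0 : forall g, domain_pos le L 2 g -> 0 <= dissipation Qp Qm L t g;
  at_diss_isotone : isotone_on le (fun x y : R => x <= y) (domain_pos le L 2)
    (dissipation Qp Qm L t);
  at_moment : forall g, domain_pos le L 2 g -> 0 <= dissipation Qp Qm L1 t g;
  at_second : forall g, domain_pos le L 3 g ->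
    `|L (L (Qp t g))| <= `|L (L (Qm t g))| + rho `|L1 g| * `|L (L g)|;
  at_gain_oo : forall g, domain_pos_oo le L g -> domain_pos_oo le L (Qp t g) }.

Section reduction.
Context (R : realType) (X : completeNormedModType R) (le : X -> X -> Prop).
Context (D : set X) (Qp Qm : R -> X -> X) (L L1 : operator X) (a rho : R -> R).
Context (J : X -> X) (S U : R -> X -> X).
Hypotheses (ss : state_space le) (nQp : nonlinear_operator le D Qp)
  (nQm : nonlinear_operator le D Qm) (ga : generator_assumption le D Qp Qm L)
  (la : loss_assumption le Qm L a) (da : dissipation_assumption le Qp Qm L)
  (ma : moment_assumption le Qp Qm L L1 rho) (gd : generator_data le L J S).
Hypotheses (gU : C0_group U) (U_pos : forall t g, cone le g -> cone le (U t g))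
  (U_norm : forall t g, cone le g -> `|U t g| = `|g|)
  (UL : forall t g, domain L g -> domain L (U t g) /\ L (U t g) = U t (L g))
  (UL1 : forall t g, domain L1 g -> domain L1 (U t g) /\ L1 (U t g) = U t (L1 g)).
Hypotheses (Qp_oo : \forall t \ae (@lebesgue_measure R), 0 <= t ->
    forall g, domain_pos_oo le L g -> domain_pos_oo le L (Qp t g))
  (Qp_loc : forall g k, domain_pos_oo le L g -> (1 <= k)%N ->
    L1loc_pos le (fun t => iter k L (Qp t (U t g)))).
Local Notation K := (cone le).
Local Notation mass := (mass le).
Local Notation DP := (domain_pos le L).
Local Notation DPoo := (domain_pos_oo le L).
Local Notation mu := (@lebesgue_measure R).
Local Notation Rplus := (`[0, +oo[%classic : set R).
Local Notation sm f := (strongly_measurable mu Rplus f).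
Local Notation good t := (0 <= t /\ model_at le D L L1 a rho Qp Qm t).
Implicit Types (x y g h : X) (t s : R) (k : nat).

Lemma model_ae : \forall t \ae mu, 0 <= t -> model_at le D L L1 a rho Qp Qm t.
Proof.
have and_ae (P Q : R -> Prop) : (\forall t \ae mu, P t) -> (\forall t \ae mu, Q t) ->
    \forall t \ae mu, P t /\ Q t by apply: ae_imp2.
have h := and_ae _ _ (nl_isotone nQp) (and_ae _ _ (nl_isotone nQm) (and_ae _ _ (nl_oclosed nQp)
  (and_ae _ _ (nl_oclosed nQm) (and_ae _ _ (ga_gain ga (or_introl erefl))
  (and_ae _ _ (ga_gain ga (or_intror erefl)) (and_ae _ _ (ga_loss ga (or_introl erefl))
  (and_ae _ _ (ga_loss ga (or_intror erefl)) (and_ae _ _ (la_bound la)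
  (and_ae _ _ (la_isotone la) (and_ae _ _ (da_ge0 da) (and_ae _ _ (da_isotone da)
  (and_ae _ _ (ma_dissipation ma) (and_ae _ _ (ma_bound ma) Qp_oo))))))))))))).
apply: ae_imp h => t [h1 [h2 [h3 [h4 [h5 [h6 [h7 [h8 [h9 [h10 [h11 [h12 [h13 [h14 h15]]]]]]]]]]]]]] t0.
split; [exact: h1|exact: h2|exact: h3|exact: h4| | |exact: h9|exact: h10|exact: h11|
  exact: h12|exact: h13|exact: h14|exact: h15].
- by move=> k g [] ->; [exact: h5|exact: h6].
- by move=> k g [] ->; [exact: h7|exact: h8].
Qed.

(** [moment (L g)] is [|L1 g|] on the positive domain; unlike [L1], this
    functional is defined and bounded on all of [X]. *)
Definition moment x : R := mass (L1 (J x)).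

Let L1_J x : domain L1 (J x).
Proof.
have [g [h [Kg Kh ->]]] := ss_generating ss x.
have [_ L1lin] := ma_linear ma.
have DJ y : K y -> domain L1 (J y).
  by move=> Ky; apply: (ma_domain ma); apply: (domain_pos_J gd).
rewrite (bl_sub (gd_J gd)); have -> : J g - J h = -1 *: J h + J g by lmod R.
by have [] := L1lin (-1) _ _ (DJ h Kh) (DJ g Kg).
Qed.

Let momentB x y : moment (x - y) = moment x - moment y.
Proof.
have [_ L1lin] := ma_linear ma; rewrite /moment (bl_sub (gd_J gd)).
have -> : J x - J y = -1 *: J y + J x by lmod R.
by have [_ ->] := L1lin (-1) _ _ (L1_J y) (L1_J x); rewrite scaleN1r addrC (massB ss).
Qed.

Let momentZ (b : R) x : moment (b *: x) = b * moment x.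
Proof.
have [L10 L1lin] := ma_linear ma; rewrite /moment (bl_scale (gd_J gd)).
have [_ E] := L1lin b _ _ (L1_J x) L10.
have [_ E0] := L1lin 1 _ _ L10 L10.
have L00 : L1 0 = 0 by move: E0; rewrite !scale1r addr0 -[LHS]addr0 => /addrI.
by rewrite -[b *: J x]addr0 E L00 addr0 (massZ ss).
Qed.

Lemma moment_ge0 x : K x -> 0 <= moment x.
Proof.
move=> Kx; apply: (mass_ge0 ss); apply: (ma_positive ma); first exact: L1_J.
exact: (gd_J_pos gd).
Qed.

Lemma moment_bounded_linear : bounded_linear (moment : X -> R^o).
Proof.
split; [exact: momentB|exact: momentZ|].
apply: (positive_functional_bounded ss momentB) => [b x _ _|]; first exact: momentZ.
exact: moment_ge0.
Qed.

Lemma moment_L g : DP 1 g -> moment (L g) = `|L1 g|.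
Proof.
move=> Dg; rewrite /moment (gd_LK gd (domain_pos1 Dg)) (mass_cone ss)//.
by apply: (ma_positive ma); [exact: (ma_domain ma)|case: Dg].
Qed.

Lemma moment_group t x : moment (U t x) = moment x.
Proof.
rewrite /moment (J_group gd UL); have [_ ->] := UL1 t (L1_J x).
exact: (mass_group ss gU U_pos U_norm).
Qed.

(** The nonlinear operators in the frame moving with the group. Gain and loss
    are set to zero at exceptional times, where all the bounds then hold
    trivially. *)
Definition pulled_back (Q : R -> X -> X) t x : X :=
  if `[< good t >] then U (- t) (Q t (U t x)) else 0.

Lemma good_time_ae (A : set R) (P : R -> Prop) : (forall t, A t -> 0 <= t) ->
  (forall t, good t -> P t) -> \forall t \ae mu, A t -> P t.
Proof.
move=> A0 H; apply: ae_imp model_ae => t h At.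
by apply: H; split; [exact: A0|exact/h/A0].
Qed.

Let pb_cases (Q : R -> X -> X) t : (good t /\ pulled_back Q t = fun x => U (- t) (Q t (U t x))) \/
  (~ good t /\ pulled_back Q t = fun=> 0).
Proof.
by rewrite /pulled_back; case: asboolP => h; [left|right].
Qed.

Lemma pulled_back_good (Q : R -> X -> X) t x : good t ->
  pulled_back Q t x = U (- t) (Q t (U t x)).
Proof. by rewrite /pulled_back => h; rewrite asboolT. Qed.

Let DU t k g : DP k g -> DP k (U t g).
Proof. by move=> /(domain_pos_group gd U_pos UL t)[]. Qed.

Let iterLU t k g : DP k g -> iter k L (U t g) = U t (iter k L g).
Proof. by move=> /(domain_pos_group gd U_pos UL t)[]. Qed.

Let D_U t g : DP 1 g -> D (U t g).
Proof. by move=> Dg; apply: (ga_domain ga); exact: DU. Qed.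

Let K_U t g h : K (h - g) -> K (U t h - U t g).
Proof. by move=> Kgh; rewrite -(groupB gU); exact: U_pos. Qed.

Let le_U t g h : K (h - g) -> le (U t g) (U t h).
Proof. by move=> Kgh; apply: (le_coneB ss _ _).2; exact: K_U. Qed.

Lemma pulled_back_pos Q t g : nonlinear_operator le D Q -> DP 1 g -> K (pulled_back Q t g).
Proof.
move=> nQ Dg; case: (pb_cases Q t) => -[h ->]; last exact: cone0.
by apply: U_pos; apply: (nl_pos nQ); [case: h|exact: D_U].
Qed.

Lemma pulled_back_isotone Q t g h : (good t -> isotone_on le le D (Q t)) ->
  DP 1 g -> DP 1 h -> K (h - g) -> K (pulled_back Q t h - pulled_back Q t g).
Proof.
move=> iQ Dg Dh Kgh; case: (pb_cases Q t) => -[gt ->]; last by rewrite subrr; exact: cone0.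
apply: K_U; apply: (le_coneB ss _ _).1.
by apply: (iQ gt); [exact: D_U|exact: D_U|exact: le_U].
Qed.

(** Isotonicity bounds the images of an increasing sequence, so that they
    converge, and order closedness identifies the limit. *)
Lemma pulled_back_cvg Q t (u : nat -> X) g : nonlinear_operator le D Q ->
  (good t -> isotone_on le le D (Q t)) -> (good t -> o_closed le D (Q t)) ->
  (forall n, DP 1 (u n)) -> (forall n, K (u n.+1 - u n)) -> u n @[n --> \oo] --> g ->
  DP 1 g -> pulled_back Q t (u n) @[n --> \oo] --> pulled_back Q t g.
Proof.
move=> nQ iQ oQ Du uS ug Dg; case: (pb_cases Q t) => -[gt ->]; last exact: cvg_cst.
have bU s := group_bounded_linear ss gU U_norm s.
have Kgu := incr_cone_lim ss uS ug.
have Kpos n : K (Q t (U t (u n))) by apply: (nl_pos nQ); [case: gt|exact: D_U].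
have KS n : K (Q t (U t (u n.+1)) - Q t (U t (u n))).
  by apply: (le_coneB ss _ _).1; apply: (iQ gt); [exact: D_U|exact: D_U|exact: le_U].
have bd n : mass (Q t (U t (u n))) <= mass (Q t (U t g)).
  apply: (mass_le ss); apply: (le_coneB ss _ _).1.
  by apply: (iQ gt); [exact: D_U|exact: D_U|exact: le_U].
have [h Qh _] := mono_cvg ss (Kpos 0%N) KS bd.
have [_ ->] := oQ gt (fun n => U t (u n)) (U t g) h (fun n => D_U t (Du n))
  (fun n => le_U t (uS n)) (bl_cvg (bU t) ug) Qh.
exact: (bl_cvg (bU (- t)) Qh).
Qed.

Lemma pulled_back_measurable Q (f : R -> X) : nonlinear_operator le D Q ->
  sm f -> (forall t, 0 <= t -> DP 1 (f t)) -> sm (fun t => pulled_back Q t (f t)).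
Proof.
move=> nQ mf Df; apply: (strongly_measurable_ae (mu := mu)
  (g := fun t => U (- t) (Q t (U t (f t))))).
  apply: good_time_ae => t; last exact: pulled_back_good.
  by rewrite /= in_itv/= andbT.
apply: (group_path_measurable ss gU U_norm (s := -%R)); first by right.
apply: (nl_measurable nQ).
- by apply: (group_path_measurable ss gU U_norm (s := id)) => //; left.
- by move=> t /Df[_ Kf]; exact: U_pos.
- by apply: ae_all => t /Df; exact: D_U.
Qed.

Let pb_L t k Q g : good t -> DP k (Q t (U t g)) ->
  iter k L (pulled_back Q t g) = U (- t) (iter k L (Q t (U t g))).
Proof. by move=> gt DQ; rewrite pulled_back_good// iterLU. Qed.

Let diss_eq (phi : X -> R) k t g : (k = 1%N \/ k = 2%N) ->
  (forall x y, phi (x - y) = phi x - phi y) -> (forall s x, phi (U s x) = phi x) ->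
  good t -> DP k.+1 g ->
  phi (iter k L (pulled_back Qm t g) - iter k L (pulled_back Qp t g)) =
  phi (iter k L (Qm t (U t g))) - phi (iter k L (Qp t (U t g))).
Proof.
move=> hk pB pU gt Dg; have [_ m] := gt.
have Dm := at_loss_domain m hk (DU t Dg); have Dp := at_gain_domain m hk (DU t Dg).
by rewrite !pb_L// pB !pU.
Qed.

Let mU s x : mass (U s x) = mass x.
Proof. exact: (mass_group ss gU U_pos U_norm). Qed.

(** The group commutes with [L] and preserves the mass. *)
Lemma dissipation_pulled_back t g : good t -> DP 2 g ->
  mass (L (pulled_back Qm t g) - L (pulled_back Qp t g)) =
  dissipation Qp Qm L t (U t g).
Proof.
move=> gt Dg; have [_ m] := gt; have D1 : 1%N = 1%N \/ 1%N = 2%N by left.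
have := @diss_eq mass 1 t g D1 (massB ss) mU gt Dg; rewrite /= => ->.
have [_ K1] := domain_pos_L gd (at_loss_domain m D1 (DU t Dg)).
have [_ K2] := domain_pos_L gd (at_gain_domain m D1 (DU t Dg)).
by rewrite (mass_cone ss K1) (mass_cone ss K2).
Qed.

Let normL t g : DP 1 g -> mass (L g) = `|L (U t g)|.
Proof.
move=> Dg; have [_ Kg] := domain_pos_L gd Dg.
have := iterLU t Dg; rewrite /= => ->; rewrite (mass_cone ss Kg) U_norm//.
Qed.

Let gap_pb t g : good t -> DP 1 g ->
  a (mass (L g)) *: L g - pulled_back Qm t g =
  U (- t) (a `|L (U t g)| *: L (U t g) - Qm t (U t g)).
Proof.
move=> gt Dg; rewrite pulled_back_good// (groupB gU) (normL t Dg).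
rewrite (bl_scale (group_bounded_linear ss gU U_norm (- t))); congr (_ *: _ - _).
by have := iterLU t Dg; rewrite /= => ->; rewrite (groupK gU).
Qed.

Let bad_diss t g : ~ good t ->
  L (pulled_back Qm t g) - L (pulled_back Qp t g) = 0.
Proof. by move=> ngt; rewrite /pulled_back asboolF// subrr. Qed.

(** Each clause is the hypothesis at the point [U t g], carried back by [U (-
    t)], which preserves order, mass and moment. *)
Lemma pulled_back_gain_loss :
  gain_loss le L a rho moment (pulled_back Qp) (pulled_back Qm).
Proof.
have rate : convex_rate a.
  by apply: convex_rateP; [exact: (la_pos la)|exact: (la_mono la)|exact: (la_convex la)].
have goodP t : good t \/ ~ good t by case: (pselect (good t)); [left|right].
split => //.
- exact: (ma_pos ma).
- exact: (ma_mono ma).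
- exact: moment_bounded_linear.
- exact: moment_ge0.
- by move=> t g; exact: pulled_back_pos.
- by move=> t g; exact: pulled_back_pos.
- by move=> t g h; apply: pulled_back_isotone => -[_ m]; exact: at_gain_isotone m.
- by move=> t g h; apply: pulled_back_isotone => -[_ m]; exact: at_loss_isotone m.
- move=> t u g; apply: pulled_back_cvg => // -[_ m]; [exact: at_gain_isotone m|exact: at_gain_oclosed m].
- move=> t u g; apply: pulled_back_cvg => // -[_ m]; [exact: at_loss_isotone m|exact: at_loss_oclosed m].
- move=> t k g hk Dg; case: (pb_cases Qp t) => -[gt ->]; last exact: (domain_pos_0 ss gd).
  by apply: DU; case: gt => _ m; exact: (at_gain_domain m hk (DU t Dg)).
- move=> t g Dg; case: (pb_cases Qp t) => -[gt ->].
    apply: (domain_pos_oo_group gd U_pos UL); case: gt => _ m; apply: (at_gain_oo m).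
    exact: (domain_pos_oo_group gd U_pos UL).
  by move=> k _; exact: (domain_pos_0 ss gd).
- move=> t g Dg; case: (goodP t) => gt; last first.
    rewrite /pulled_back asboolF// subr0; apply: coneZ => //; last by case: (domain_pos_L gd Dg).
    exact: (cr_ge0 rate) (mass_L_ge0 ss gd Dg).
  rewrite gap_pb//; apply: U_pos; apply: (le_coneB ss _ _).1.
  by case: gt => _ m; case: (at_loss_bound m (DU t Dg)).
- move=> t g h Dg Dh Kgh; case: (goodP t) => gt; last first.
    rewrite /pulled_back asboolF// !subr0.
    have -> : a (mass (L h)) *: L h - a (mass (L g)) *: L g =
      a (mass (L h)) *: (L h - L g) + (a (mass (L h)) - a (mass (L g))) *: L g by lmod R.
    apply: coneD => //; apply: coneZ => //.
    + exact: (cr_ge0 rate) (mass_L_ge0 ss gd Dh).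
    + exact: (L_isotone_pos gd Dg Dh).
    + by rewrite subr_ge0 (cr_mono rate)// ?(mass_L_ge0 ss gd Dg)// (mass_L_le ss gd Dg Dh).
    + by case: (domain_pos_L gd Dg).
  rewrite !gap_pb//; apply: K_U; apply: (le_coneB ss _ _).1.
  by case: gt => _ m; apply: (at_gap_isotone m); [exact: DU|exact: DU|exact: le_U].
- move=> t g Dg; case: (goodP t) => gt; last by rewrite bad_diss// (mass0 ss).
  by rewrite dissipation_pulled_back//; case: gt => _ m; apply: (at_diss_ge0 m); exact: DU.
- move=> t g h Dg Dh Kgh; case: (goodP t) => gt; last by rewrite !bad_diss.
  rewrite !dissipation_pulled_back//; case: gt => _ m.
  by apply: (at_diss_isotone m); [exact: DU|exact: DU|exact: le_U].
- move=> t g Dg; case: (goodP t) => gt; last first.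
    by rewrite bad_diss// (bl0 moment_bounded_linear).
  have D1 : 1%N = 1%N \/ 1%N = 2%N by left.
  have := @diss_eq moment 1 t g D1 momentB moment_group gt Dg; rewrite /= => ->.
  case: gt => _ m; rewrite !moment_L; first exact: (at_moment m (DU t Dg)).
    exact: (at_gain_domain m D1 (DU t Dg)).
  exact: (at_loss_domain m D1 (DU t Dg)).
- move=> t g Dg; have DLg := domain_pos_L gd Dg.
  have Dg1 : DP 1 g := domain_pos_lower (isT : (1 <= 3)%N) Dg.
  have Dg2 : DP 2 g := domain_pos_lower (isT : (2 <= 3)%N) Dg.
  have q0 : 0 <= moment (L g) by apply: moment_ge0; case: DLg.
  case: (goodP t) => gt; last first.
    rewrite /pulled_back asboolF// subrr (mass0 ss) mulr_ge0//.
      exact: (ma_pos ma).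
    exact: (mass_LL_ge0 ss gd Dg2).
  have D2 : 2%N = 1%N \/ 2%N = 2%N by right.
  have := @diss_eq (fun x => - mass x) 2 t g D2 _ _ gt Dg.
  rewrite /= => h; rewrite -[X in mass X]opprB (massN ss) h.
  + case: gt => _ m; have [_ K1] := domain_pos_L gd (domain_pos_L gd (at_loss_domain m D2 (DU t Dg))).
    have [_ K2] := domain_pos_L gd (domain_pos_L gd (at_gain_domain m D2 (DU t Dg))).
    rewrite opprK addrC (mass_cone ss K1) (mass_cone ss K2).
    have := at_second m (DU t Dg); rewrite moment_L//.
    have [_ ->] := UL1 t (ma_domain ma Dg1); rewrite U_norm; last first.
      by apply: (ma_positive ma); [exact: (ma_domain ma)|case: Dg1].
    have := iterLU t Dg2; rewrite /= => ->.
    have [_ K3] := domain_pos_L gd (domain_pos_L gd Dg2).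
    by rewrite U_norm// (mass_cone ss K3); lra.
  + by move=> x y; rewrite (massB ss) opprB opprK addrC.
  + by move=> s x; rewrite mU.
- by move=> f; exact: pulled_back_measurable.
- by move=> f; exact: pulled_back_measurable.
- move=> g k T Dg T0.
  have main j : exists I, itv_int 0 T (fun s => iter j.+1 L (pulled_back Qp s g)) I.
    have [hint _] := Qp_loc Dg (isT : (1 <= j.+1)%N).
    have hI := itv_int_of_bochner (hint T T0).
    have mK : sm (fun s => pulled_back Qp s g).
      by apply: pulled_back_measurable => //; [exact: strongly_measurable_cst|move=> t _; exact: Dg].
    have Doo t : DPoo (pulled_back Qp t g).
      case: (pb_cases Qp t) => -[gt ->]; last by move=> i _; exact: (domain_pos_0 ss gd).
      apply: (domain_pos_oo_group gd U_pos UL); case: gt => _ m; apply: (at_gain_oo m).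
      exact: (domain_pos_oo_group gd U_pos UL).
    apply: (itv_int_dominated (ss_separable ss) (lexx 0) _ hI).
      by apply: (iterL_measurable ss gd) => // t _.
    have := itv_ae (a := 0) T model_ae (lexx 0); apply: ae_imp => t mt tT.
    have t0 : 0 <= t by move: tT; rewrite /= in_itv/= => /andP[].
    have gt : good t by split => //; exact: mt.
    have DQ : DPoo (Qp t (U t g)).
      by case: gt => _ m; apply: (at_gain_oo m); exact: (domain_pos_oo_group gd U_pos UL).
    rewrite (pb_L gt (DQ j.+1 isT)) U_norm//.
    have := domain_pos_iterL gd (j := j.+1) (k := 0) (g := Qp t (U t g)); rewrite addn0.
    by move=> /(_ (DQ j.+1 isT))[].
  case: k => [|k]; last exact: main.
  have [I hI] := main 0%N; exists (J I).
  apply: (itv_int_J gd _ hI) => t _ _; case: (pb_cases Qp t) => -[gt ->].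
    have Doo : DPoo (Qp t (U t g)).
      by case: gt => _ m; apply: (at_gain_oo m); exact: (domain_pos_oo_group gd U_pos UL).
    exact: (domain_pos1 (DU (- t) (Doo 1%N isT))).
  by case: (L_0 gd).
Qed.

End reduction.

(** * Back to mild solutions *)

Section transport.
Context (R : realType) (X : completeNormedModType R) (le : X -> X -> Prop).
Context (D : set X) (Qp Qm : R -> X -> X) (L L1 : operator X) (a rho : R -> R).
Context (J : X -> X) (S U : R -> X -> X).
Hypotheses (ss : state_space le) (nQp : nonlinear_operator le D Qp)
  (nQm : nonlinear_operator le D Qm) (ga : generator_assumption le D Qp Qm L)
  (la : loss_assumption le Qm L a) (da : dissipation_assumption le Qp Qm L)
  (ma : moment_assumption le Qp Qm L L1 rho) (gd : generator_data le L J S).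
Hypotheses (gU : C0_group U) (U_pos : forall t g, cone le g -> cone le (U t g))
  (U_norm : forall t g, cone le g -> `|U t g| = `|g|)
  (UL : forall t g, domain L g -> domain L (U t g) /\ L (U t g) = U t (L g))
  (UL1 : forall t g, domain L1 g -> domain L1 (U t g) /\ L1 (U t g) = U t (L1 g)).
Hypotheses (Qp_oo : \forall t \ae (@lebesgue_measure R), 0 <= t ->
    forall g, domain_pos_oo le L g -> domain_pos_oo le L (Qp t g))
  (Qp_loc : forall g k, domain_pos_oo le L g -> (1 <= k)%N ->
    L1loc_pos le (fun t => iter k L (Qp t (U t g)))).
Local Notation K := (cone le).
Local Notation mass := (mass le).
Local Notation DP := (domain_pos le L).
Local Notation mu := (@lebesgue_measure R).
Local Notation Rplus := (`[0, +oo[%classic : set R).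
Local Notation good t := (0 <= t /\ model_at le D L L1 a rho Qp Qm t).
Local Notation Kp := (pulled_back le D Qp Qm L L1 a rho U Qp).
Local Notation Km := (pulled_back le D Qp Qm L L1 a rho U Qm).
Context (f0 : X).
Hypothesis Df0 : domain_pos le L 2 f0.
Implicit Types (x y h : X) (t s : R) (k : nat) (f g : R -> X).


Let good_ae t (P : R -> Prop) :
  (forall s, 0 <= s -> model_at le D L L1 a rho Qp Qm s -> P s) ->
  \forall s \ae mu, `[0, t]%classic s -> P s.
Proof.
move=> H; apply: (good_time_ae nQp nQm ga la da ma Qp_oo) => s; last by case=> s0; exact: H.
by rewrite /= in_itv/= => /andP[].
Qed.

Let bU t : bounded_linear (U t). Proof. exact: (group_bounded_linear ss gU U_norm). Qed.

Let DPU k t x : DP k x -> DP k (U t x) /\ iter k L (U t x) = U t (iter k L x).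
Proof. exact: (domain_pos_group gd U_pos UL). Qed.

Let normLL t x : DP 2 x -> `|L (L (U t x))| = mass (L (L x)).
Proof.
move=> Dx; have [_] := DPU t Dx; rewrite /= => ->.
have [_ KLL] := domain_pos_L gd (domain_pos_L gd Dx).
by rewrite U_norm// (mass_cone ss).
Qed.

(** [U (- t) U (t - s) = U (- s)] turns the integrand of the mild formulation
    into the pulled back operators. *)
Lemma mild_evolution f : regular_mild_solution le D U Qp Qm L f0 f ->
  evolution_solution le L Kp Km f0 (fun t => U (- t) (f t)).
Proof.
move=> [[[cf Kf] _ fint feq] Df fB]; split.
- apply: (group_path_measurable ss gU U_norm (s := -%R)); first by right.
  apply: (continuous_strongly_measurable (ss_separable ss)).
  exact/half_line_continuousP.
- by move=> t t0; have [] := DPU (- t) (Df t t0).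
- move=> T; have [B hB] := fB T; exists B => t t0 tT.
  have [Dt _] := DPU (- t) (Df t t0).
  by rewrite -(normLL t Dt) (groupNK gU); exact: hB.
move=> t t0; have hI := itv_int_of_bochner (fint t t0).
exists (U (- t) (bochner_integral mu `[0, t] (fun s => U (t - s) (Qp s (f s) - Qm s (f s))))).
  apply: itv_int_ae (itv_int_linear (bU (- t)) hI); apply: good_ae => s s0 m.
  rewrite !pulled_back_good// !(groupNK gU) -(groupB gU) -(gr_add gU).
  by congr (U _ _); rewrite addrA addNr add0r.
rewrite {1}(feq t t0) (bl_add (bU (- t))) (groupK gU); congr (_ + _).
Qed.

Lemma solution_path_lipschitz g : evolution_solution le L Kp Km f0 g ->
  (forall T, exists C : R, forall s t, 0 <= s -> s <= t -> t <= T ->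
      `|L (g t) - L (g s)| <= C * (t - s)) ->
  forall T, exists C : R, forall s t, 0 <= s -> s <= t -> t <= T ->
      `|g t - g s| <= C * (t - s).
Proof.
move=> [_ Dg _ _] LgL T; have [C hC] := LgL T; have [CJ CJ0 hJ] := bl_bound (gd_J gd).
exists (CJ * C) => s t s0 st tT; have t0 := le_trans s0 st.
rewrite -(gd_LK gd (domain_pos_dom gd (Dg t t0))) -(gd_LK gd (domain_pos_dom gd (Dg s s0))).
by rewrite -(bl_sub (gd_J gd)) -mulrA (le_trans (hJ _))// ler_wpM2l// hC.
Qed.

Lemma evolution_mild g : evolution_solution le L Kp Km f0 g ->
  (forall T, exists C : R, forall s t, 0 <= s -> s <= t -> t <= T ->
      `|L (g t) - L (g s)| <= C * (t - s)) ->
  regular_mild_solution le D U Qp Qm L f0 (fun t => U t (g t)).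
Proof.
move=> sg LgL; have gL := solution_path_lipschitz sg LgL; have [mg Dg Cg eg] := sg.
have int t : 0 <= t -> exists2 I, itv_int 0 t
    (fun s => U (t - s) (Qp s (U s (g s)) - Qm s (U s (g s)))) I & U t (g t) = U t f0 + I.
  move=> t0; have [I hI gE] := eg t t0.
  exists (U t I); last by rewrite gE (bl_add (bU t)).
  apply: itv_int_ae (itv_int_linear (bU t) hI); apply: good_ae => s s0 m.
  by rewrite !pulled_back_good// -(groupB gU) -(gr_add gU).
split.
- split.
  + split; first exact: (group_path_continuous ss gU U_norm gL).
    by move=> t t0; apply: U_pos; case: (Dg t t0).
  + apply: ae_all => s s0; apply: (ga_domain ga).
    by have [h _] := DPU s (Dg s s0); exact: domain_pos_lower h.
  + by move=> t t0; have [I hI _] := int t t0; case: (itv_int_bochner hI).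
  + by move=> t t0; have [I hI ->] := int t t0; case: (itv_int_bochner hI) => _ ->.
- by move=> t t0; case: (DPU t (Dg t t0)).
- move=> T; have [C hC] := Cg T; exists C => t t0 tT.
  by rewrite (normLL t (Dg t t0)) hC.
Qed.

Theorem transport_well_posed : exists f : R -> X,
  [/\ regular_mild_solution le D U Qp Qm L f0 f,
      forall f', regular_mild_solution le D U Qp Qm L f0 f' ->
        forall t, 0 <= t -> f' t = f t,
      continuous_pos le (fun t => L (f t)),
      forall t, 0 <= t ->
        strongly_measurable mu (X := R^o) `[0, t]
          (fun s => dissipation Qp Qm L s (f s)) /\
        (`|L (f t)|%:E
          + \int[mu]_(s in `[0%R, t]) (dissipation Qp Qm L s (f s))%:E = `|L f0|%:E)%E &
      forall t, 0 <= t ->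
        `|L (L (f t))| <= `|L (L f0)| * expR (rho `|L1 f0| * t)].
Proof.
have gl := pulled_back_gain_loss ss nQp nQm ga la da ma gd gU U_pos U_norm UL UL1 Qp_oo Qp_loc.
have [g [sg uniq g2]] := evolution_well_posed ss gd gl Df0.
have [E [hE LE EL]] := solution_dissipation ss gd gl Df0 sg.
have LgL := solution_lipschitz LE EL; have [_ Dg _ _] := sg.
have Df01 : DP 1 f0 := domain_pos_lower (isT : (1 <= 2)%N) Df0.
have KLf0 : K (L f0) by case: (domain_pos_L gd Df01).
have KLLf0 : K (L (L f0)) by case: (domain_pos_L gd (domain_pos_L gd Df0)).
have Dg1 t : 0 <= t -> DP 1 (g t) by move=> /Dg; exact: domain_pos_lower.
have LU t : 0 <= t -> L (U t (g t)) = U t (L (g t)).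
  by move=> t0; have [_] := DPU t (Dg1 t t0).
have KL t : 0 <= t -> K (L (g t)) by move=> t0; case: (domain_pos_L gd (Dg1 t t0)).
exists (fun t => U t (g t)); split.
- exact: evolution_mild.
- move=> f' sf' t t0; rewrite -(uniq _ (mild_evolution sf') t t0) (groupNK gU)//.
- split; last by move=> t t0; rewrite LU//; apply: U_pos; exact: KL.
  have := group_path_continuous ss gU U_norm LgL => /half_line_continuousP c.
  apply/half_line_continuousP => t t0 eps eps0; have [del del0 hd] := c t t0 eps eps0.
  by exists del => // s s0 st; rewrite !LU//; exact: hd.
- move=> t t0; have hR : itv_int 0 t (fun s => dissipation Qp Qm L s (U s (g s)) : R^o)
      (mass (E t) : R^o).
    apply: itv_int_ae (itv_int_linear (mass_bounded_linear ss) (hE t t0)).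
    apply: good_ae => s s0 m.
    exact: (dissipation_pulled_back ss gd gU U_pos U_norm UL (conj s0 m) (Dg s s0)).
  split; first exact: (has_int_measurable (mu := mu) hR).
  have := has_int_lebesgue (mu := mu) (measurable_itv _) (interval_finite _ _) hR => ->.
  rewrite -EFinD LU// U_norm; last exact: KL.
  by rewrite -(mass_cone ss (KL t t0)) LE// (massB ss) subrK (mass_cone ss KLf0).
- move=> t t0; rewrite (normLL t (Dg t t0)) -(mass_cone ss KLLf0).
  by rewrite -(moment_L ss ma gd Df01); exact: g2.
Qed.

End transport.

Unset Implicit Arguments.

Theorem corollary1 (R : realType) (X : completeNormedModType R)
  (le : X -> X -> Prop) (D : set X) (Qp Qm : R -> X -> X)
  (L L1 : operator X) (a rho : R -> R)
  (A : operator X) (U : R -> X -> X) (f0 : X) :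
  (* standing assumptions *)
  state_space le ->
  admissible_domain le D ->
  nonlinear_operator le D Qp ->
  nonlinear_operator le D Qm ->
  generator_assumption le D Qp Qm L ->
  lower_bound_assumption le L ->
  loss_assumption le Qm L a ->
  dissipation_assumption le Qp Qm L ->
  moment_assumption le Qp Qm L L1 rho ->
  (* the group generated by A *)
  C0_group U ->
  group_generator U A ->
  (forall t g, cone le g -> cone le (U t g)) ->
  (forall t g, cone le g -> `|U t g| = `|g|) ->
  (forall t, U t @` domain L = domain L) ->
  (forall t, U t @` domain L1 = domain L1) ->
  (forall t g, 0 < t -> domain L g -> U t (L g) = L (U t g)) ->
  (forall t g, 0 < t -> domain L1 g -> U t (L1 g) = L1 (U t g)) ->
  (* the initial datum and the gain operator *)
  domain_pos le L 2 f0 ->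
  (\forall t \ae (@lebesgue_measure R), 0 <= t ->
    forall g, domain_pos_oo le L g -> domain_pos_oo le L (Qp t g)) ->
  (forall g k, domain_pos_oo le L g -> (1 <= k)%N ->
    L1loc_pos le (fun t => iter k L (Qp t (U t g)))) ->
  exists f : R -> X,
    [/\ regular_mild_solution le D U Qp Qm L f0 f,
        forall f', regular_mild_solution le D U Qp Qm L f0 f' ->
          forall t, 0 <= t -> f' t = f t,
        continuous_pos le (fun t => L (f t)),
        forall t, 0 <= t ->
          strongly_measurable (@lebesgue_measure R) (X := R^o) `[0, t]
            (fun s => dissipation Qp Qm L s (f s)) /\
          (`|L (f t)|%:E
            + \int[@lebesgue_measure R]_(s in `[0%R, t])
                (dissipation Qp Qm L s (f s))%:E = `|L f0|%:E)%E &
        forall t, 0 <= t ->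
          `|L (L (f t))| <= `|L (L f0)| * expR (rho `|L1 f0| * t)].
Proof.
move=> ss _ nQp nQm ga lb la da ma gU _ U_pos U_norm imL imL1 cL cL1 Df0 Qp_oo Qp_loc.
have [S [C0S S_pos S_gen]] := ga_generator ga.
have gd := generator_dataP ss C0S S_pos S_gen (ga_linear ga) lb.
have UL := operator_image_domain gU imL cL.
have UL1 := operator_image_domain gU imL1 cL1.
exact: (transport_well_posed ss nQp nQm ga la da ma gd gU U_pos U_norm UL UL1 Qp_oo Qp_loc Df0).
Qed.
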